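(* In the white noise model, fix $0<\gamma<\frac12$, $0<s_{\min}<s_{\max}$ and $M>0$. Set $$r_n(s):=(n/\log n)^{-s/(2s+1)},\qquad \mathcal F:=\bigcup_{s\in(s_{\min},s_{\max})}C^s_1(M).$$ There is no sequence of confidence bands $C_n=\{g\in C([0,1]):\|g-\hat f_n\|_\infty\le R_n\}$, with centre $\hat f_n$ and radius $R_n$ depending only on the data, satisfying both: (i) $\limsup_n\mathbb P_f(f\notin C_n)\le\gamma$ for all $f\in\mathcal F$; and (ii) $R_n=O_p(r_n(s))$ under $\mathbb P_f$, for all $f\in C^s_1(M)$ and all $s\in(s_{\min},s_{\max})$.
   Context: White noise model: for an unknown $f:[0,1]\to\mathbb R$ one observes the process $Y_t=\int_0^t f(u)\,du+n^{-1/2}B_t$, $t\in[0,1]$, with $B$ a standard Brownian motion; $\mathbb P_f$ is the law of the data. $\|\cdot\|_\infty$ is the supremum norm on $[0,1]$. Wavelet basis: $\varphi,\psi$ are the scaling function and wavelet of an orthonormal multiresolution analysis of $L^2(\mathbb R)$ such that, for some $K,N\in\mathbb N$: $\varphi,\psi$ are supported in $[1-K,K]$; $\int x^i\psi(x)\,dx=0$ for $i=0,\dots,N-1$; $\varphi$ is twice continuously differentiable. Moreover the 1-periodic function $\sigma_\varphi^2(t):=\sum_{k\in\mathbb Z}\varphi(t-k)^2$ attains its maximum at a unique point $t_0\in[0,1)$, and $(\sigma_\varphi^2)''(t_0)<0$. From these, the Cohen–Daubechies–Vial boundary-corrected construction gives an orthonormal basis of $L^2([0,1])$ consisting of $\varphi_{j_0,k}$,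 $0\le k<2^{j_0}$, and $\psi_{j,k}$, $j\ge j_0$, $0\le k<2^j$, for a suitable fixed coarsest level $j_0>0$. For $k\in[N,2^j-N)$ the functions are $\varphi_{j_0,k}(x)=2^{j_0/2}\varphi(2^{j_0}x-k)$ and $\psi_{j,k}(x)=2^{j/2}\psi(2^jx-k)$; for the other $k$ they are the boundary functions of that construction. For $f=\sum_k\alpha_k\varphi_{j_0,k}+\sum_{j\ge j_0}\sum_k\beta_{j,k}\psi_{j,k}\in L^2([0,1])$ and $s\in(0,N)$ put $\|f\|_{C^s}:=\max\big(\sup_k|\alpha_k|,\ \sup_{j,k}2^{j(s+1/2)}|\beta_{j,k}|\big)$ and $C^s(M):=\{f\in L^2([0,1]):\|f\|_{C^s}\le M\}$. Such $f$ are continuous (after modification on a null set). Set $f_{i,j}:=\sum_{l=i}^j\sum_k\beta_{l,k}\psi_{l,k}$ for $i>j_0$, and $f_{j_0,j}:=\sum_k\alpha_k\varphi_{j_0,k}+\sum_{l=j_0}^j\sum_k\beta_{l,k}\psi_{l,k}$. Weakly self-similar functions: fix $s_{\max}\in(0,N)$, $\varepsilon\in(0,1)$, and a sequence $\rho_j\in\mathbb N$ ($j\ge j_0$) with $\rho_j\to\infty$ as $j\to\infty$. For $s\in(0,s_{\max})$, $M>0$, $C^s_1(M)$ is the set of $f\in C^s(M)$ with $\|f_{j,\rho_jj}\|_{C^s}\ge\varepsilon M$ for all $j\ge j_0$. *)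

(* Defs.v *)
From HB Require Import structures.
From mathcomp Require Import all_boot all_order all_algebra.
From mathcomp Require Import all_classical all_reals all_analysis.

Set Implicit Arguments.
Unset Strict Implicit.
Unset Printing Implicit Defensive.

Import Order.TTheory GRing.Theory Num.Theory.
Import numFieldNormedType.Exports.

Local Open Scope classical_set_scope.
Local Open Scope ring_scope.

Section L2.
Context {R : realType}.
Local Notation mu := (@lebesgue_measure R).

Definition square_integrable (D : set R) (f : R -> R) : Prop :=
  measurable_fun D f /\ mu.-integrable D (EFin \o (fun x => f x ^+ 2)).

Definition inner (D : set R) (f g : R -> R) : R :=
  \int[mu]_(x in D) (f x * g x).

Definition sqdist (D : set R) (f g : R -> R) : R :=
  \int[mu]_(x in D) (f x - g x) ^+ 2.

(* The sup norm on [0,1]. *)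
Definition sup_norm (f : R -> R) : \bar R :=
  ereal_sup [set `|f t|%:E | t in `[0, 1]].

(* 2^{j/2} g(2^j x - k) *)
Definition dilate (g : R -> R) (j k : int) (x : R) : R :=
  2 `^ (j%:~R / 2) * g (2 ^ j * x - k%:~R).

End L2.

Section Multiresolution.
Context {R : realType}.
Implicit Types (phi psi g f : R -> R).

Definition orthonormal_translates g : Prop :=
  forall k l : int,
    inner setT (dilate g 0 k) (dilate g 0 l) = (k == l)%:R.

(* Closed linear span in L^2(R) of the functions 2^{j/2} g(2^j x - k), k in Z;
   as a set of functions it is saturated under a.e. equality. *)
Definition closed_span g (j : int) : set (R -> R) :=
  [set f | square_integrable setT f /\
    forall e : R, 0 < e -> exists (s : seq int) (c : int -> R),
      sqdist setT f (fun x => \sum_(k <- s) c k * dilate g j k x) < e].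

(* V_j := closed_span phi j, so that closedness of V_j and the dilation property
   f in V_j <-> f(2 .) in V_{j+1} hold by construction. *)
Definition scaling_function phi : Prop :=
  [/\ square_integrable setT phi /\ orthonormal_translates phi,
      forall j : int, closed_span phi j `<=` closed_span phi (j + 1),
      forall f, (forall j : int, closed_span phi j f) ->
        {ae (@lebesgue_measure R), forall x, f x = 0} &
      forall f, square_integrable setT f -> forall e : R, 0 < e ->
        exists j : int, exists2 g, closed_span phi j g & sqdist setT f g < e].

(* The translates of psi are an orthonormal basis of the orthogonal complement
   of V_0 in V_1. *)
Definition wavelet_of phi psi : Prop :=
  [/\ square_integrable setT psi, orthonormal_translates psi &
      forall f, closed_span psi 0 f <->
        closed_span phi 1 f /\
        (forall k : int, inner setT f (dilate phi 0 k) = 0)].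

(* The sum has finitely many nonzero terms when phi has compact support. *)
Definition sigma2 phi (t : R) : R :=
  \sum_(k \in [set: int]) phi (t - k%:~R) ^+ 2.

Definition supported_in (a b : R) f : Prop :=
  forall x : R, x \notin `[a, b] -> f x = 0.

Definition twice_continuously_differentiable f : Prop :=
  [/\ forall x : R, derivable f x 1, forall x : R, derivable (derive1 f) x 1 &
      continuous (derive1n 2 f)].

Definition wavelet_assumptions (K N : nat) phi psi : Prop :=
  [/\ scaling_function phi /\ wavelet_of phi psi,
      supported_in (1 - K%:R) K%:R phi /\ supported_in (1 - K%:R) K%:R psi,
      forall i : nat, (i < N)%N ->
        \int[@lebesgue_measure R]_x (x ^+ i * psi x) = 0,
      twice_continuously_differentiable phi &
      exists t0 : R, [/\ 0 <= t0 < 1,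
        forall t : R, 0 <= t < 1 -> t != t0 -> sigma2 phi t < sigma2 phi t0 &
        derive1n 2 (sigma2 phi) t0 < 0]].

End Multiresolution.

(* Boundary-corrected wavelets on [0,1], after A. Cohen, I. Daubechies and
   P. Vial, "Wavelets on the interval and fast wavelet transforms",
   Appl. Comput. Harmon. Anal. 1 (1993). *)
Section CohenDaubechiesVial.
Context {R : realType}.

(* The functions sum_n binom(n,i) phi(x + n - N + 1), 0 <= i < N, considered on
   [0,+oo[: modulo the interior phi(. - m), m >= N, they span the polynomials of
   degree less than N. The terms with n >= K + N - 1 vanish on [0,+oo[ if phi is
   supported in [1 - K, K]. *)
Definition edge_generator (K N : nat) (phi : R -> R) (i : nat) (x : R) : R :=
  \sum_(0 <= n < (K + N).-1) 'C(n, i)%:R * phi (x + n%:R - (N%:R - 1)).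

(* Edge functions on the half-line [0,+oo[. Together with the orthonormality
   required in cdv_system, triangularity of A says that the phiL k come, up to
   sign, from the Gram-Schmidt procedure applied to the edge generators of index
   N-1, N-2, ..., 0; the support of phiL k is contained in [0, K + k].
   The psiL k lie in the edge part of the next finer scaling space and have the
   same staggered supports; that they span the wavelet space is part of the basis
   property in cdv_system. *)
Definition edge_functions (K N : nat) (phi : R -> R) (phiL psiL : nat -> R -> R)
    : Prop :=
  exists A B C : nat -> nat -> R, forall k : nat, (k < N)%N -> forall x : R, 0 <= x ->
    phiL k x = \sum_((N - k).-1 <= i < N) A k i * edge_generator K N phi i x /\
    psiL k x = \sum_(0 <= l < N) B k l * phiL l (2 * x)
               + \sum_(N <= m < (K + k.*2).+1) C k m * phi (2 * x - m%:R).

Definition reflect01 (g : R -> R) (x : R) : R := g (1 - x).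

(* The right edge at 1 is the left edge at 0 seen through x |-> 1 - x; note that
   reflect01 preserves supports in [1 - K, K]. *)
Record wavelet_system := WaveletSystem {
  wK : nat;
  wN : nat;
  wj0 : nat;
  wphi : R -> R;
  wpsi : R -> R;
  wphiL : nat -> R -> R;
  wpsiL : nat -> R -> R;
  wphiR : nat -> R -> R;
  wpsiR : nat -> R -> R }.

Definition interval_function (N : nat) (g : R -> R) (gL gR : nat -> R -> R)
    (j k : nat) (x : R) : R :=
  if (k < N)%N then dilate (gL k) j 0 x
  else if (k < 2 ^ j - N)%N then dilate g j k x
  else dilate (gR (2 ^ j - k).-1) j 0 (1 - x).

Variable w : wavelet_system.

Definition Phi (k : nat) : R -> R :=
  interval_function (wN w) (wphi w) (wphiL w) (wphiR w) (wj0 w) k.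

Definition Psi (j k : nat) : R -> R :=
  interval_function (wN w) (wpsi w) (wpsiL w) (wpsiR w) j k.

Definition alpha (f : R -> R) (k : nat) : R := inner `[0, 1] f (Phi k).

Definition beta (f : R -> R) (j k : nat) : R := inner `[0, 1] f (Psi j k).

(* f_{i,j}, for i >= j0 *)
Definition partial_sum (f : R -> R) (i j : nat) (x : R) : R :=
  (if i == wj0 w then \sum_(0 <= k < 2 ^ wj0 w) alpha f k * Phi k x else 0)
  + \sum_(i <= l < j.+1) \sum_(0 <= k < 2 ^ l) beta f l k * Psi l k x.

Definition L2_orthonormal_basis : Prop :=
  [/\ (forall k, (k < 2 ^ wj0 w)%N -> square_integrable `[0, 1] (Phi k)) /\
      (forall j k, (wj0 w <= j)%N -> (k < 2 ^ j)%N ->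
        square_integrable `[0, 1] (Psi j k)),
      forall k k', (k < 2 ^ wj0 w)%N -> (k' < 2 ^ wj0 w)%N ->
        inner `[0, 1] (Phi k) (Phi k') = (k == k')%:R,
      forall k j k', (k < 2 ^ wj0 w)%N -> (wj0 w <= j)%N -> (k' < 2 ^ j)%N ->
        inner `[0, 1] (Phi k) (Psi j k') = 0,
      forall j k j' k', (wj0 w <= j)%N -> (k < 2 ^ j)%N ->
        (wj0 w <= j')%N -> (k' < 2 ^ j')%N ->
        inner `[0, 1] (Psi j k) (Psi j' k') = ((j == j') && (k == k'))%:R &
      forall f, square_integrable `[0, 1] f ->
        sqdist `[0, 1] f (partial_sum f (wj0 w) J) @[J --> \oo] --> (0 : R)].

Definition cdv_system : Prop :=
  [/\ wavelet_assumptions (wK w) (wN w) (wphi w) (wpsi w),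
      (0 < wj0 w)%N /\ ((wN w).*2 <= 2 ^ wj0 w)%N,
      edge_functions (wK w) (wN w) (wphi w) (wphiL w) (wpsiL w),
      edge_functions (wK w) (wN w) (reflect01 (wphi w)) (wphiR w) (wpsiR w) &
      L2_orthonormal_basis].

Definition Cs_norm (s : R) (f : R -> R) : \bar R :=
  maxe (ereal_sup [set `|alpha f k|%:E | k in [set k | (k < 2 ^ wj0 w)%N]])
       (ereal_sup [set (2 `^ (p.1%:R * (s + 2^-1)) * `|beta f p.1 p.2|)%:E |
          p in [set p : nat * nat | (wj0 w <= p.1)%N /\ (p.2 < 2 ^ p.1)%N]]).

Definition Cs_ball (s M : R) : set (R -> R) :=
  [set f | square_integrable `[0, 1] f /\ (Cs_norm s f <= M%:E)%E].

Definition weakly_self_similar (eps : R) (rho : nat -> nat) (s M : R)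
    : set (R -> R) :=
  [set f | Cs_ball s M f /\
    forall j, (wj0 w <= j)%N ->
      ((eps * M)%:E <= Cs_norm s (partial_sum f j (rho j * j)%N))%E].

End CohenDaubechiesVial.

Section WhiteNoise.
Context {R : realType}.

Definition brownian_motion d (T : measurableType d) (P : probability T R)
    (B : R -> T -> R) : Prop :=
  [/\ forall t : R, 0 <= t <= 1 -> measurable_fun setT (B t),
      (forall x, B 0 x = 0) /\
      (forall x, {within `[0, 1], continuous (fun t => B t x)}),
      forall s t : R, 0 <= s -> s < t -> t <= 1 -> forall V : set R, measurable V ->
        P [set x | V (B t x - B s x)] = normal_prob 0 (Num.sqrt (t - s)) V &
      forall (m : nat) (t : nat -> R) (V : nat -> set R),
        (forall i, (i <= m)%N -> 0 <= t i <= 1) ->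
        (forall i, (i < m)%N -> t i <= t i.+1) ->
        (forall i, (i < m)%N -> measurable (V i)) ->
        P [set x | forall i, (i < m)%N -> V i (B (t i.+1) x - B (t i) x)] =
        (\prod_(0 <= i < m) P [set x | V i (B (t i.+1) x - B (t i) x)%R])%E].

(* C([0,1]), the space of observed C01; values off [0,1] are irrelevant. *)
Definition C01 : set (R -> R) :=
  [set g : R -> R | {within `[0, 1], continuous g}].

(* The sigma-algebra of the data: on C01, the one generated by the
   evaluations at the points of [0,1], i.e. the Borel sigma-algebra. *)
Definition data_event : set (set (R -> R)) :=
  <<s C01, [set A | exists2 t : R, t \in `[0, 1] &
    exists2 V : set R, measurable V & A = C01 `&` [set y | V (y t)]] >>.

Definition observation (T : Type) (B : R -> T -> R) (f : R -> R) (n : nat)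
    (x : T) (t : R) : R :=
  \int[@lebesgue_measure R]_(u in `[0, t]) f u + (Num.sqrt n%:R)^-1 * B t x.

(* P_f for sample size n: the law of the observed path. *)
Definition law d (T : measurableType d) (P : probability T R) (B : R -> T -> R)
    (f : R -> R) (n : nat) (A : set (R -> R)) : \bar R :=
  P (observation B f n @^-1` A).

Definition band (fhat : nat -> (R -> R) -> R -> R) (rad : nat -> (R -> R) -> R)
    (n : nat) (y : R -> R) : set (R -> R) :=
  [set g | C01 g /\ (sup_norm (fun t => g t - fhat n y t)%R <= (rad n y)%:E)%E].

(* The weakest measurability making P_f(f \notin C_n) and R_n = O_p(r_n)
   meaningful. *)
Definition band_measurable (fhat : nat -> (R -> R) -> R -> R)
    (rad : nat -> (R -> R) -> R) : Prop :=
  forall n,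
    (forall V : set R, measurable V -> data_event (C01 `&` rad n @^-1` V)) /\
    (forall g, C01 g ->
      data_event (C01 `&` [set y | band fhat rad n y g])).

(* X_n = O_p(r_n) under the laws Q_n *)
Definition bounded_in_prob (Q : nat -> set (R -> R) -> \bar R)
    (X : nat -> (R -> R) -> R) (r : nat -> R) : Prop :=
  forall e : R, 0 < e -> exists c : R, \forall n \near \oo,
    (Q n (C01 `&` [set y | c * r n < `|X n y|]%R) <= e%:E)%E.

Definition rate (s : R) (n : nat) : R :=
  (n%:R / ln n%:R) `^ (- s / (2 * s + 1)).

End WhiteNoise.
Arguments wavelet_system : clear implicits.

(* Main.v *)
Require Import Defs.
From mathcomp Require Import all_boot all_order all_algebra.
From mathcomp Require Import all_classical all_reals all_analysis.
From mathcomp Require Import measurable_realfun ring lra zify.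
Set Implicit Arguments.
Unset Strict Implicit.
Unset Printing Implicit Defensive.
Import Order.TTheory GRing.Theory Num.Theory.
Import numFieldNormedType.Exports.
Local Open Scope classical_set_scope.
Local Open Scope ring_scope.

(* Suppose that a band is honest and adapts to the smoothness. Given a
   self-similar [f] of smoothness [s], pick a sample size [n] at which the band
   covers [f] with probability about [1 - gamma] and has radius of order
   [rate s n]. Add to [f] a single wavelet of level [L] and coefficient
   [M 2^(-L(s' + 1/2))], with [s'] slightly smaller than [s]. There are about
   [2^L] disjoint positions for this bump, and if [n] times its squared
   coefficient is at most [L ln 2 / 2], the uniform mixture over the positions is
   close in chi-square distance to the law under [f]; so for some position the
   events "the band misses [f]" and "the radius is not of order [rate s n]" keep
   their probability up to a small error. Since the bump exceeds [rate s n], the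
   band cannot contain both functions, hence it misses the new one with
   probability close to [1 - gamma], which exceeds [gamma].
   Coefficients of much higher level than [L] are invisible at sample size [n], so
   the construction can be iterated; the smoothness decreases at each step but
   stays above [s0 > s_min]. The margin of self-similarity is lowered from [1]
   towards [eps], which pays for the replacement of [s] by [s']. The limit function
   lies in the class, yet is missed with probability at least
   [gamma + (1 - 2 gamma) / 10] for infinitely many [n].
   Mixtures are compared on the increments over dyadic grids, by the
   Cameron-Martin formula for Gaussian vectors, and general data events are
   approximated by cylinders. *)

(** * Change of measure for Gaussian vectors *)

(** Each step works with three levels. The bump sits at [L = r * L'], while the loss of smoothness
    is tuned to the lower level [L']: [2 ^ (L' (s - s'))] is exactly the ratio of the old margin to
    the new one. Witnesses of self-similarity at levels up to [L'] therefore lose at most this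
    ratio, and windows that start between [L'] and [L] are served by the bump, because [rho j]
    eventually reaches [r]; this is where the divergence of [rho] enters. Between [L'] and [L] the
    loss is amplified: the bump exceeds the rate by a factor that is a fixed power of the ratio,
    with exponent proportional to [r]. A large [r] thus beats the unknown constant in the O_p
    condition, although the ratio itself may be close to 1. From level [g * L] on the tail is reset
    to smoothness [s']. Here [g] depends only on [smax] and on the lower bound [s0] of all
    smoothness values, which makes this reset, and all later ones, invisible at the present sample
    size. The two functions are separated through one wavelet coefficient, not pointwise, so that no
    lower bound on the height of the wavelet at a given point is required. *)

Section IntegralFromIndicators.
Context {R : realType}.
Import HBNNSimple.
Local Open Scope ereal_scope.

Lemma weighted_integral_nnsfun d dY (T : measurableType d)
    (Y : measurableType dY) (m : {measure set T -> \bar R}) (X : T -> Y)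
    (G : T -> \bar R) (h : {nnsfun Y >-> R}) :
  measurable_fun setT X -> measurable_fun setT G -> (forall x, 0 <= G x) ->
  \int[m]_x ((h (X x))%:E * G x) =
  \sum_(y \in range h) (y%:E * \int[m]_x ((\1_(h @^-1` [set y]) (X x))%:E * G x)).
Proof.
move=> mX mG G0.
have mI y : measurable_fun setT (fun x => (\1_(h @^-1` [set y]) (X x))%:E : \bar R).
  by apply/measurable_EFinP/(measurableT_comp _ mX)/measurable_indic.
transitivity (\int[m]_x (\sum_(y \in range h)
    (y%:E * ((\1_(h @^-1` [set y]) (X x))%:E * G x)))).
  apply: eq_integral => x _; rewrite fimfunE -fsumEFin//.
  rewrite ge0_mule_fsuml; last by move=> r; rewrite EFinM nnfun_muleindic_ge0.
  by apply: eq_fsbigr => y _; rewrite EFinM muleA.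
rewrite ge0_integral_fsum//; last 2 first.
- by move=> y; apply: emeasurable_funM => //; apply: emeasurable_funM.
- by move=> y x _; rewrite muleA mule_ge0// nnfun_muleindic_ge0.
apply: eq_fsbigr => y; rewrite inE => -[z _ <-]; rewrite ge0_integralZl//.
- by apply: emeasurable_funM.
- by move=> x _; rewrite mule_ge0// lee_fin.
- by rewrite lee_fin.
Qed.

Lemma weighted_integral_lim d dY (T : measurableType d)
    (Y : measurableType dY) (m : {measure set T -> \bar R}) (X : T -> Y)
    (G : T -> \bar R) (g : Y -> \bar R) (mg : measurable_fun setT g) :
  measurable_fun setT X -> measurable_fun setT G -> (forall x, 0 <= G x) ->
  (forall y, 0 <= g y) ->
  \int[m]_x (g (X x) * G x) =
  limn (fun n => \int[m]_x ((nnsfun_approx measurableT mg n (X x))%:E * G x)).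
Proof.
move=> mX mG G0 g0; rewrite -monotone_convergence//=.
- apply: eq_integral => x _; apply/esym/cvg_lim => //.
  have gX := cvg_nnsfun_approx measurableT mg (fun y _ => g0 y) (I : setT (X x)).
  have -> : (fun n => (nnsfun_approx measurableT mg n (X x))%:E * G x) =
     (fun n => (G x * (nnsfun_approx measurableT mg n (X x))%:E)).
    by apply/funext => n; rewrite muleC.
  rewrite muleC.
  have [->|Gp] := eqVneq (G x) 0.
    by rewrite mul0e; under eq_fun do rewrite mul0e; exact: cvg_cst.
  case: (G x) (G0 x) Gp => [r r0 rp|_ _|//].
    by apply: cvgeZl.
  (* Here [G x] is infinite and multiplication by it is not continuous at 0; the products are
     instead eventually constant, equal to 0 or to [+oo]. *)
  have [g00|gp] := eqVneq (g (X x)) 0.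
    rewrite g00 mule0; apply: cvg_near_cst; apply: nearW => n.
    suff -> : nnsfun_approx measurableT mg n (X x) = 0%R by rewrite mule0.
    apply/eqP; rewrite eq_le fun_ge0 andbT -lee_fin nnsfun_approxE.
    by apply: le_trans (le_approx _ (fun y _ => g0 y) I) _; rewrite g00.
  have gpos : 0 < g (X x) by rewrite lt_neqAle eq_sym gp g0.
  rewrite gt0_mulye//.
  apply: cvg_near_cst.
  near=> n.
  rewrite gt0_mulye//.
  near: n. have h := (gX _ (open_nbhs_nbhs (conj (open_ereal_gt_ereal (x := 0)) gpos))). exact: h.
- by move=> n; apply: emeasurable_funM => //; apply/measurable_EFinP;
  exact: measurableT_comp.
- by move=> n x _; rewrite mule_ge0// lee_fin.
- move=> x _ n k nk; rewrite lee_wpmul2r// lee_fin.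
  exact/lefP/nd_nnsfun_approx.
Unshelve. all: end_near. Qed.

(** Simple functions and monotone convergence. Two base spaces and two weights are allowed, so that
    the same principle yields the product rule for independent variables, affine substitution, and
    the density formula for a normal variable. *)
Lemma ge0_integral_indic_ext d1 d2 dY (T1 : measurableType d1)
    (T2 : measurableType d2) (Y : measurableType dY)
    (m1 : {measure set T1 -> \bar R}) (m2 : {measure set T2 -> \bar R})
    (X1 : T1 -> Y) (X2 : T2 -> Y) (G1 : T1 -> \bar R) (G2 : T2 -> \bar R)
    (g : Y -> \bar R) :
  measurable_fun setT X1 -> measurable_fun setT X2 ->
  measurable_fun setT G1 -> measurable_fun setT G2 ->
  (forall x, 0 <= G1 x) -> (forall x, 0 <= G2 x) ->
  (forall W, measurable W -> \int[m1]_x ((\1_W (X1 x))%:E * G1 x) =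
                             \int[m2]_x ((\1_W (X2 x))%:E * G2 x)) ->
  measurable_fun setT g -> (forall y, 0 <= g y) ->
  \int[m1]_x (g (X1 x) * G1 x) = \int[m2]_x (g (X2 x) * G2 x).
Proof.
move=> mX1 mX2 mG1 mG2 G10 G20 E mg g0.
rewrite !(weighted_integral_lim _ mg)//; congr (limn _); apply/funext => n.
rewrite !weighted_integral_nnsfun//; apply: eq_fsbigr => y _.
by rewrite E.
Qed.

End IntegralFromIndicators.

Section ProductRule.
Context {R : realType} d (T : measurableType d) (P : probability T R) (m : nat).
Context (X : 'I_m -> T -> R).
Hypothesis mX : forall i, measurable_fun setT (X i).
Hypothesis indepX : forall V : 'I_m -> set R, (forall i, measurable (V i)) ->
  P [set x | forall i, V i (X i x)] = (\prod_(i < m) P (X i @^-1` V i))%E.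
Local Open Scope ereal_scope.

Lemma emeasurable_prod (I : finType) (Q : pred I) d' (S : measurableType d')
    (f : I -> S -> \bar R) :
  (forall i, measurable_fun setT (f i)) ->
  measurable_fun setT (fun x => \prod_(i | Q i) f i x).
Proof.
move=> mf.
elim: (index_enum I) => [|i r IH].
  by under eq_fun do rewrite big_nil; exact: measurable_cst.
under eq_fun do rewrite big_cons.
by case: (Q i) => //; apply: emeasurable_funM.
Qed.

Lemma prode_ge0 (I : finType) (Q : pred I) (f : I -> \bar R) :
  (forall i, 0 <= f i) -> 0 <= \prod_(i | Q i) f i.
Proof.
move=> f0; elim: (index_enum I) => [|i r IH]; first by rewrite big_nil.
by rewrite big_cons; case: (Q i) => //; rewrite mule_ge0.
Qed.

Lemma prod_indic_indep (x : T) (V : 'I_m -> set R) :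
  \prod_(i < m) (\1_(V i) (X i x))%:E =
  (\1_[set x | forall i, V i (X i x)] x)%:E :> \bar R.
Proof.
rewrite indicE; have [|] := boolP (x \in _).
  by rewrite inE /= => Vx; rewrite big1// => i _; rewrite indicE mem_set.
rewrite notin_setE /= => /existsNP[i Vi].
by rewrite (bigD1 i)//= indicE memNset// mul0e.
Qed.

(** Indicators are exchanged for the [g i] one coordinate at a time. With [k] factors exchanged and
    the sets [V] still arbitrary, the factor of index [k] passes from indicators to [g] by extension
    from indicators, the other factors acting as a weight. *)
Lemma expectation_prod_indep (g : 'I_m -> R -> \bar R) :
  (forall i, measurable_fun setT (g i)) -> (forall i y, 0 <= g i y) ->
  \int[P]_x \prod_(i < m) g i (X i x) = \prod_(i < m) \int[P]_x g i (X i x).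
Proof.
move=> mg g0.
pose h (k : nat) (V : 'I_m -> set R) (i : 'I_m) (y : R) : \bar R :=
  if (i < k)%N then g i y else (\1_(V i) y)%:E.
have mI (V : set R) : measurable V ->
    measurable_fun setT (fun y => (\1_V y)%:E : \bar R).
  by move=> mV; apply/measurable_EFinP/measurable_indic.
have mh k V i : (forall i, measurable (V i)) -> measurable_fun setT (h k V i).
  by move=> mV; rewrite /h; case: (i < k)%N => //; apply: mI.
have h0 k V i y : 0 <= h k V i y by rewrite /h; case: ifP.
suff H k : (k <= m)%N -> forall V, (forall i, measurable (V i)) ->
    \int[P]_x \prod_(i < m) h k V i (X i x) = \prod_(i < m) \int[P]_x h k V i (X i x).
  have hm i x : h m (fun=> setT) i x = g i x by rewrite /h ltn_ord.
  transitivity (\int[P]_x \prod_(i < m) h m (fun=> setT) i (X i x)).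
    by apply: eq_integral => x _; apply: eq_bigr => i _; rewrite hm.
  rewrite H//; apply: eq_bigr => i _.
  by apply: eq_integral => x _; rewrite hm.
elim: k => [_ V mV|k IH km V mV].
  rewrite (eq_integral (fun x => (\1_[set x | forall i, V i (X i x)] x)%:E)); last first.
    by move=> x _; rewrite -prod_indic_indep.
  have mall : measurable [set x | forall i, V i (X i x)].
    rewrite [X in measurable X](_ : _ = \bigcap_(i in [set: 'I_m]) (X i @^-1` V i)).
      apply: fin_bigcap_measurable => // i _.
      by rewrite -[X in measurable X]setTI; exact: mX.
    by apply/seteqP; split=> x /= H i; [move=> _|]; apply: H.
  rewrite integral_indic// setIT; apply: etrans (indepX mV) _.
  apply: eq_bigr => i _.
  have mi : measurable (X i @^-1` V i).
    by rewrite -[X in measurable X]setTI; exact: mX.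
  by rewrite -(setIT (_ @^-1` _)) -integral_indic.
pose j := Ordinal km.
have hE V' i y : i != j -> h k.+1 V' i y = h k V' i y.
  move=> ij; rewrite /h ltnS leq_eqVlt.
  by rewrite (negbTE (_ : val i != k))//.
have hVE V' i y : i != j ->
    h k (fun i => if i == j then V' else V i) i y = h k V i y.
  by move=> ij; rewrite /h (negbTE ij).
pose C := \prod_(i < m | i != j) \int[P]_x h k V i (X i x).
have mG : measurable_fun setT (fun x => \prod_(i < m | i != j) h k V i (X i x)).
  by apply: emeasurable_prod => i; apply: measurableT_comp => //; apply: mh.
transitivity (\int[P]_x (g j (X j x) * \prod_(i < m | i != j) h k V i (X i x))).
  apply: eq_integral => x _; rewrite (bigD1 j)//= {1}/h ltnSn; congr (_ * _).
  by apply: eq_bigr => i ij; rewrite hE.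
have C0 : 0 <= C by apply: prode_ge0 => i; apply: integral_ge0.
rewrite (@ge0_integral_indic_ext R _ _ _ _ _ _ P P (X j) (X j) _ (cst C))//.
- rewrite ge0_integralZr//; last exact: measurableT_comp.
  rewrite [RHS](bigD1 j)//=; congr (_ * _).
    by apply: eq_integral => x _; rewrite /h ltnSn.
  by apply: eq_bigr => i ij; apply: eq_integral => x _; rewrite hE.
- by move=> x; apply: prode_ge0.
move=> W mW; pose V' i := if i == j then W else V i.
have mV' i : measurable (V' i) by rewrite /V'; case: ifP.
rewrite ge0_integralZr//; last first.
  exact: (measurableT_comp (mI W mW) (mX j)).
have := IH (ltnW km) V' mV'.
rewrite [in RHS](bigD1 j)//= => E.
transitivity (\int[P]_x \prod_(i < m) h k V' i (X i x)).
  apply: eq_integral => x _; rewrite [RHS](bigD1 j)//=; congr (_ * _).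
    by rewrite /h ltnn /V' eqxx.
  by apply: eq_bigr => i ij; rewrite hVE.
rewrite E; congr (_ * _).
  by apply: eq_integral => x _; rewrite /h ltnn /V' eqxx.
by apply: eq_bigr => i ij; apply: eq_integral => x _; rewrite hVE.
Qed.

End ProductRule.

(** * Affine changes of variable *)

Section LebesgueAffine.
Context {R : realType}.
Local Notation mu := (@lebesgue_measure R).

Lemma measurable_affine (c d : R) : measurable_fun setT (fun x : R => c * x + d).
Proof. by apply: measurable_funD => //; apply: measurable_funM. Qed.

Lemma lebesgue_measure_affine (c d : R) (A : set R) : 0 < c -> measurable A ->
  mu ((fun x => c * x + d) @^-1` A) = (c^-1%:E * mu A)%E.
Proof.
move=> c0 mA.
pose F : measurableTypeR R -> measurableTypeR R := fun x => c * x + d.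
have mF : measurable_fun setT F := measurable_affine c d.
pose nu : {measure set (measurableTypeR R) -> \bar R} :=
  mscale (NngNum (ltW c0)) (pushforward mu F).
suff -> : mu A = (c%:E * mu (F @^-1` A))%E.
  by rewrite muleA -EFinM mulVf ?gt_eqF// mul1e.
suff : mu A = nu mF A by [].
apply: lebesgue_measure_unique => // X [[a b] _ <-] /=.
rewrite /nu /mscale /= /pushforward.
have -> : F @^-1` `]a, b] = `](a - d) / c, (b - d) / c]%classic.
  apply/seteqP; split => x /=; rewrite !in_itv/= /F ltr_pdivrMr// ler_pdivlMr//.
    by move=> /andP[? ?]; apply/andP; split; lra.
  by move=> /andP[? ?]; apply/andP; split; lra.
rewrite !lebesgue_measure_itv/= !lte_fin ltr_pM2r ?invr_gt0// ltrD2r.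
case: ifPn => _; last by rewrite mule0.
rewrite -EFinD -EFinM; congr (_%:E); field.
by rewrite gt_eqF.
Qed.

Lemma ge0_integral_affine (c d : R) (f : R -> \bar R) : 0 < c ->
  measurable_fun setT f -> (forall x, 0 <= f x)%E ->
  (\int[mu]_x f (c * x + d)%R = c^-1%:E * \int[mu]_x f x)%E.
Proof.
move=> c0 mf f0.
transitivity (\int[mu]_x (f (c * x + d)%R * cst 1%E x))%E.
  by apply: eq_integral => x _; rewrite mule1.
rewrite (@ge0_integral_indic_ext R _ _ _ _ _ _ mu mu (fun x : R => c * x + d)
  (fun x : R => x) (cst 1%E) (cst c^-1%:E) f)//.
- by rewrite ge0_integralZr// 1?muleC// lee_fin invr_ge0 ltW.
- exact: measurable_affine.
- by move=> x; rewrite lee_fin invr_ge0 ltW.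
move=> W mW; under eq_integral do rewrite mule1.
rewrite ge0_integralZr//; [|exact/measurable_EFinP/measurable_indic|
  by rewrite lee_fin invr_ge0 ltW].
rewrite [X in _ = (X * _)%E](_ : _ = mu W); last by rewrite integral_indic// setIT.
have mpre : measurable ((fun x => c * x + d) @^-1` W).
  by rewrite -[X in measurable X]setTI; exact: measurable_affine.
transitivity (\int[mu]_x (\1_((fun x => c * x + d) @^-1` W) x)%:E)%E.
  by apply: eq_integral => x _; rewrite !indicE.
rewrite integral_indic// setIT muleC; exact: lebesgue_measure_affine.
Qed.

End LebesgueAffine.

(** * Shifts of a single normal variable *)

Section GaussianShift.
Context {R : realType} d (T : measurableType d) (P : probability T R).
Context (X : T -> R) (s : R).
Hypothesis mX : measurable_fun setT X.
Hypothesis s0 : 0 < s.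
Hypothesis lawX : forall V, measurable V -> P (X @^-1` V) = normal_prob 0 s V.
Local Notation mu := (@lebesgue_measure R).

(* Likelihood ratio at [x] of N(a, s^2) with respect to N(0, s^2). *)
Definition gauss_lr (a x : R) : R := expR (a * x / s ^+ 2 - a ^+ 2 / (2 * s ^+ 2)).

Lemma measurable_gauss_lr a : measurable_fun setT (gauss_lr a).
Proof.
apply: measurableT_comp => //; apply: measurable_funB => //.
by apply: measurable_funM => //; apply: measurable_funM.
Qed.

Lemma gauss_lr_ge0 a x : 0 <= gauss_lr a x.
Proof. exact: expR_ge0. Qed.

Lemma expectation_normal (g : R -> \bar R) :
  measurable_fun setT g -> (forall y, 0 <= g y)%E ->
  (\int[P]_x g (X x) = \int[mu]_y (g y * (normal_pdf 0 s y)%:E))%E.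
Proof.
move=> mg g0; have mpdf := measurable_normal_pdf 0 s.
transitivity (\int[P]_x (g (X x) * cst 1%E x))%E.
  by apply: eq_integral => x _; rewrite mule1.
apply: (@ge0_integral_indic_ext R _ _ _ _ _ _ P mu X
  (fun x : R => x) (cst 1%E) (fun y => (normal_pdf 0 s y)%:E) g) => //.
- exact/measurable_EFinP.
- by move=> x; rewrite lee_fin normal_pdf_ge0.
move=> W mW; under eq_integral do rewrite mule1.
have mXW : measurable (X @^-1` W) by rewrite -[_ @^-1` _]setTI; exact: mX.
transitivity (\int[P]_x (\1_(X @^-1` W) x)%:E)%E.
  by apply: eq_integral => x _; rewrite !indicE.
rewrite integral_indic// setIT; apply: etrans (lawX mW) _.
rewrite /normal_prob [LHS]integral_mkcond. apply: eq_integral => y _.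
by rewrite patchE indicE; case: (y \in W); rewrite ?mul1e ?mul0e.
Qed.

Lemma normal_pdf_shift a y :
  normal_pdf 0 s (y - a) = gauss_lr a y * normal_pdf 0 s y.
Proof.
rewrite !normal_pdfE ?gt_eqF// /normal_fun mulrCA; congr (_ * _).
rewrite /gauss_lr -expRD; congr expR; field.
by rewrite gt_eqF.
Qed.

Lemma normal_shift a (V : set R) : measurable V ->
  (P ((fun x => X x + a)%R @^-1` V) =
   \int[P]_x ((\1_V (X x))%:E * (gauss_lr a (X x))%:E))%E.
Proof.
move=> mV.
have mXV : measurable ((fun x => X x + a) @^-1` V).
  by rewrite -[_ @^-1` _]setTI; apply: (measurable_funD mX (measurable_cst a)).
have mI : measurable_fun setT (fun y => (\1_V y)%:E : \bar R).
  exact/measurable_EFinP/measurable_indic.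
have ml : measurable_fun setT (fun y => (gauss_lr a y)%:E : \bar R).
  apply/measurable_EFinP. exact: measurable_gauss_lr.
rewrite (expectation_normal (g := fun y => (\1_V y)%:E * (gauss_lr a y)%:E)%E)//; last 2 first.
- exact: emeasurable_funM.
- by move=> y; rewrite mule_ge0// lee_fin ?gauss_lr_ge0.
transitivity (\int[P]_x (\1_V (X x + a))%:E)%E.
  rewrite -[in LHS](setIT (_ @^-1` _)) -integral_indic//; apply: eq_integral => x _.
rewrite (expectation_normal (g := fun y => (\1_V (y + a))%:E)%E)//; last first.
  exact: (measurableT_comp mI (measurable_funD (@measurable_id _ R setT) (measurable_cst a))).
have mpdf := measurable_normal_pdf 0 s.
pose f y := ((\1_V y)%:E * (normal_pdf 0 s (y - a))%:E)%E.
have mf : measurable_fun setT f.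
  apply: emeasurable_funM => //; apply/measurable_EFinP.
  exact: (measurableT_comp mpdf (measurable_funB (@measurable_id _ R setT) (measurable_cst a))).
have f0 y : (0 <= f y)%E by rewrite mule_ge0// lee_fin ?normal_pdf_ge0.
transitivity (\int[mu]_y f (1 * y + a)%R)%E.
  by apply: eq_integral => y _; rewrite /f mul1r addrK.
rewrite ge0_integral_affine// invr1 mul1e; apply: eq_integral => y _.
by rewrite /f normal_pdf_shift EFinM muleA.
Qed.

Lemma expectation_gauss_lr a : (\int[P]_x (gauss_lr a (X x))%:E = 1)%E.
Proof.
have := normal_shift a measurableT; rewrite preimage_setT probability_setT => ->.
by apply: eq_integral => x _; rewrite indicT mul1e.
Qed.

(** The product of the two ratios is a constant times the ratio for [a + b], which has mean 1. These
    cross moments become the entries of the chi-square sum. *)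
Lemma expectation_gauss_lrM a b :
  (\int[P]_x (gauss_lr a (X x) * gauss_lr b (X x))%:E = (expR (a * b / s ^+ 2))%:E)%E.
Proof.
transitivity (\int[P]_x ((expR (a * b / s ^+ 2))%:E * (gauss_lr (a + b) (X x))%:E))%E.
  apply: eq_integral => x _; rewrite -EFinM /gauss_lr -!expRD; congr (expR _)%:E.
  by field; rewrite gt_eqF.
rewrite ge0_integralZl//; last 2 first.
- apply/measurable_EFinP; exact: (measurableT_comp (measurable_gauss_lr (a + b)) mX).
- by move=> x _; rewrite lee_fin gauss_lr_ge0.
by rewrite expectation_gauss_lr mule1.
Qed.

End GaussianShift.

(** * Shifts of a vector of independent normal variables *)

Section DiscreteCameronMartin.
Context {R : realType}.

Lemma adde_cancel (x y z : \bar R) :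
  x \is a fin_num -> (x + y = x + z)%E -> y = z.
Proof.
case: x y z => [x||] [y||] [z||] //= _.
by rewrite -!EFinD => -[/addrI ->].
Qed.

Lemma measurable_tuple_boxes (m : nat) :
  @measurable _ (m.-tuple R) = <<s [set A : set (m.-tuple R) |
    exists2 V : 'I_m -> set R, (forall i, measurable (V i)) &
      A = [set t | forall i, V i (tnth t i)]] >>.
Proof.
apply/seteqP; split.
- apply: smallest_sub; first exact: smallest_sigma_algebra.
  move=> A; rewrite -bigcup_seq/= => -[i _ [B mB <-]].
  apply: sub_sigma_algebra; exists (fun j => if j == i then B else setT).
    by move=> j; case: ifP.
  rewrite setTI; apply/seteqP; split => t /=.
    by move=> Bt j; case: eqP => // ->.
  by move=> /(_ i); rewrite eqxx.
- apply: smallest_sub; first exact: sigma_algebra_measurable.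
  move=> A [V mV ->].
  rewrite [X in measurable X](_ : _ =
      \bigcap_(i in [set: 'I_m]) ((fun t => tnth t i) @^-1` V i)).
    apply: fin_bigcap_measurable => // i _.
    by rewrite -[X in measurable X]setTI; exact: measurable_tnth.
  by apply/seteqP; split=> t /= H i; [move=> _|]; apply: H.
Qed.

Context d (T : measurableType d) (P : probability T R) (m : nat).
Context (X : 'I_m -> T -> R) (s : R).
Hypothesis mX : forall i, measurable_fun setT (X i).
Hypothesis indepX : forall V : 'I_m -> set R, (forall i, measurable (V i)) ->
  P [set x | forall i, V i (X i x)] = (\prod_(i < m) P (X i @^-1` V i))%E.
Hypothesis s0 : 0 < s.
Hypothesis lawX : forall i V, measurable V -> P (X i @^-1` V) = normal_prob 0 s V.

Definition shifted_vector (a : 'I_m -> R) (x : T) : m.-tuple R :=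
  [tuple X i x + a i | i < m].

Definition cm_density (a : 'I_m -> R) (x : T) : \bar R :=
  (\prod_(i < m) (gauss_lr s (a i) (X i x))%:E)%E.

Lemma measurable_shifted_vector a : measurable_fun setT (shifted_vector a).
Proof.
apply/measurable_fun_tnthP => i.
rewrite (_ : _ \o _ = fun x => X i x + a i); first exact: measurable_funD.
by apply/funext => x /=; rewrite tnth_mktuple.
Qed.

Lemma measurable_cm_density a : measurable_fun setT (cm_density a).
Proof.
apply: emeasurable_prod => i; apply/measurable_EFinP.
exact: (measurableT_comp (measurable_gauss_lr s (a i)) (mX i)).
Qed.

Lemma cm_density_ge0 a x : (0 <= cm_density a x)%E.
Proof. by apply: prode_ge0 => i; rewrite lee_fin gauss_lr_ge0. Qed.

(** Both sides are finite measures in [W], so boxes suffice, and there independence splits the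
    integral into one-dimensional shifts. *)
Lemma discrete_cameron_martin a (W : set (m.-tuple R)) : measurable W ->
  P (shifted_vector a @^-1` W) =
  (\int[P]_(x in shifted_vector (fun=> 0%R) @^-1` W) cm_density a x)%E.
Proof.
have mpre b (V : set (m.-tuple R)) : measurable V ->
    measurable (shifted_vector b @^-1` V).
  by move=> mV; rewrite -[X in measurable X]setTI; exact: measurable_shifted_vector.
pose Q (W : set (m.-tuple R)) := P (shifted_vector a @^-1` W) =
  (\int[P]_(x in shifted_vector (fun=> 0%R) @^-1` W) cm_density a x)%E.
have QT : Q setT.
  rewrite /Q !preimage_setT probability_setT.
  rewrite (@expectation_prod_indep _ _ _ _ _ X mX indepX
    (fun i y => (gauss_lr s (a i) y)%:E)).
  - rewrite big1// => i _.
    exact: expectation_gauss_lr (mX i) s0 (lawX i) (a i).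
  - by move=> i; apply/measurable_EFinP; exact: measurable_gauss_lr.
  - by move=> i y; rewrite lee_fin gauss_lr_ge0.
rewrite {1}measurable_tuple_boxes => mW; move: W mW.
apply: (dynkin_induction (measurable_tuple_boxes m) _ QT).
- move=> _ _ [V mV ->] [V' mV' ->]; exists (fun i => V i `&` V' i).
    by move=> i; exact: measurableI.
  apply/seteqP; split => t /=; first by move=> [h h'] i; split.
  by move=> h; split => i; case: (h i).
- move=> _ [V mV ->]; rewrite /Q.
  have mU i : measurable ((fun x => X i x + a i) @^-1` V i).
    rewrite -[X in measurable X]setTI.
    exact: (measurable_funD (mX i) (measurable_cst (a i))).
  transitivity (P [set x | forall i, ([set y | V i (y + a i)]) (X i x)]).
    congr (P _); apply/seteqP; split => x /= h i; have := h i;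
    by rewrite tnth_mktuple.
  have mVa i : measurable [set y : R | V i (y + a i)].
    rewrite -[X in measurable X]setTI.
    exact: (measurable_funD (@measurable_id _ R setT) (measurable_cst (a i))).
  rewrite [RHS]integral_mkcond; apply: etrans (indepX mVa) _.
  transitivity (\int[P]_x (\prod_(i < m)
     (fun i y => (\1_(V i) y)%:E * (gauss_lr s (a i) y)%:E) i (X i x)))%E.
    rewrite (@expectation_prod_indep _ _ _ _ _ X mX indepX
      (fun i y => (\1_(V i) y)%:E * (gauss_lr s (a i) y)%:E)%E).
    - apply: eq_bigr => i _.
      exact: normal_shift (mX i) s0 (lawX i) (a i) _ (mV i).
    - move=> i; apply: emeasurable_funM; apply/measurable_EFinP => //.
      exact: measurable_gauss_lr.
    - by move=> i y; rewrite mule_ge0// lee_fin ?gauss_lr_ge0.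
  apply: eq_integral => x _; rewrite big_split/=.
  rewrite (prod_indic_indep X) patchE indicE /cm_density.
  rewrite (_ : (x \in [set x0 | forall i, V i (X i x0)]) =
    (x \in shifted_vector (fun=> 0%R) @^-1` [set t | forall i, V i (tnth t i)])).
    by case: ifP => _; rewrite ?mul1e ?mul0e.
  by apply/idP/idP; rewrite !inE /= => h i; have := h i; rewrite tnth_mktuple addr0.
- move=> S mS QS; rewrite /Q -!preimage_setC.
  have mA := mpre a S mS; have mB := mpre (fun=> 0) S mS.
  move: QT; rewrite /Q !preimage_setT.
  rewrite -[in X in X = _](setUv (shifted_vector a @^-1` S)).
  rewrite -[in X in _ = X](setUv (shifted_vector (fun=> 0) @^-1` S)).
  rewrite measureU//; [|exact: measurableC|by rewrite setICr].
  rewrite ge0_integral_setU//; last 4 first.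
  + exact: measurableC.
  + by rewrite setUv; exact: measurable_cm_density.
  + by move=> x _; exact: cm_density_ge0.
  + by rewrite disj_set2E setICr.
  (* The mass of [S], common to both sides and finite, is subtracted from the total mass 1. *)
  rewrite -QS; apply: adde_cancel.
  by rewrite ge0_fin_numE// (le_lt_trans (probability_le1 P mA))// ltry.
- move=> F mF tF QF; rewrite /Q !preimage_bigcup.
  have tp b : trivIset setT (fun k => shifted_vector b @^-1` F k).
    move=> i j _ _ [x [/= Fi Fj]]; apply: (tF i j) => //.
    by exists (shifted_vector b x).
  rewrite ge0_integral_bigcup//=.
  + rewrite measure_semi_bigcup//.
    * by apply: eq_eseriesr => k _; exact: QF.
    * by move=> k; exact: mpre.
    * by apply: bigcupT_measurable => k; exact: mpre.
  + by move=> k; exact: mpre.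
  + by apply: measurable_funTS; exact: measurable_cm_density.
  + by move=> x _; exact: cm_density_ge0.
Qed.

Lemma expectation_cm_densityM a b :
  (\int[P]_x (cm_density a x * cm_density b x) =
   (expR (\sum_(i < m) a i * b i / s ^+ 2)%R)%:E)%E.
Proof.
transitivity (\int[P]_x (\prod_(i < m)
  (fun i y => (gauss_lr s (a i) y * gauss_lr s (b i) y)%:E) i (X i x)))%E.
  by apply: eq_integral => x _; rewrite /cm_density -big_split.
rewrite (@expectation_prod_indep _ _ _ _ _ X mX indepX
    (fun i y => (gauss_lr s (a i) y * gauss_lr s (b i) y)%:E)%E).
- rewrite expR_sum; elim/big_ind2: _ => //; last first.
    by move=> i _; exact: expectation_gauss_lrM (mX i) s0 (lawX i) (a i) (b i).
  by move=> _ x _ y -> ->; rewrite EFinM.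
- move=> i; apply/measurable_EFinP; apply: measurable_funM;
  exact: measurable_gauss_lr.
- by move=> i y; rewrite lee_fin mulr_ge0// gauss_lr_ge0.
Qed.

End DiscreteCameronMartin.

(** * From second moments to probabilities of events *)

Section ChiSquareBound.
Context {R : realType} d (T : measurableType d) (P : probability T R).
Local Open Scope ereal_scope.

(** Integrate the pointwise bound [z <= 1 + e / 2 + (z - 1)^2 / (2 e)] over [A]: since [P A <= 1]
    and the variance is at most [e^2], the two corrections contribute at most [e / 2] each. *)
Lemma chi_square_bound (z : T -> R) (e : R) : measurable_fun setT z ->
  (forall x, (0 <= z x)%R) -> (0 < e)%R ->
  \int[P]_x (z x)%:E = 1 -> \int[P]_x (z x ^+ 2)%:E <= (1 + e ^+ 2)%:E ->
  forall A, measurable A -> \int[P]_(x in A) (z x)%:E <= P A + e%:E.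
Proof.
move=> mz z0 e0 Ez Ez2 A mA.
have mz2 : measurable_fun setT (fun x => z x ^+ 2)%R by exact: measurable_funX.
have mzm : measurable_fun setT (fun x => (z x - 1) ^+ 2)%R.
  by apply: measurable_funX; apply: measurable_funB.
have H : \int[P]_x ((z x - 1) ^+ 2)%:E <= (e ^+ 2)%:E.
  (* The identity [(z - 1)^2 + 2 z = z^2 + 1] is kept additive, so that nothing is subtracted before
     it is known to be finite. *)
  have E : \int[P]_x ((z x - 1) ^+ 2)%:E + 2%:E = \int[P]_x (z x ^+ 2)%:E + 1.
    rewrite -[X in _ = _ + X](probability_setT P) -(mul1e (P setT)).
    rewrite -integral_cst// -ge0_integralD//; last 2 first.
    - by move=> x _; rewrite lee_fin sqr_ge0.
    - exact/measurable_EFinP.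
    rewrite (_ : 2%:E = \int[P]_x (2%:E * (z x)%:E)); last first.
      rewrite ge0_integralZl ?Ez ?mule1//.
      + exact/measurable_EFinP.
      + by move=> x _; rewrite lee_fin.
    rewrite -ge0_integralD//; last 4 first.
    - by move=> x _; rewrite lee_fin sqr_ge0.
    - exact/measurable_EFinP.
    - by move=> x _; rewrite mule_ge0// lee_fin.
    - by apply: emeasurable_funM => //; exact/measurable_EFinP.
    apply: eq_integral => x _; rewrite -EFinM -!EFinD; congr (_%:E); ring.
  have : \int[P]_x ((z x - 1) ^+ 2)%:E + 2%:E <= (1 + e ^+ 2)%:E + 1.
    by rewrite E leeD2r.
  have I0 : 0 <= \int[P]_x ((z x - 1) ^+ 2)%:E.
    by apply: integral_ge0 => x _; rewrite lee_fin sqr_ge0.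
  move: I0; case: (\int[P]_x _) => [r||]//=.
  by rewrite -!EFinD !lee_fin => _ ?; lra.
have mcA : measurable_fun A (fun x => ((2 * e)^-1 * (z x - 1) ^+ 2)%:E).
  by apply/measurable_EFinP/measurable_funTS; apply: measurable_funM.
have e2 : (0 <= (2 * e)^-1)%R by rewrite invr_ge0 mulr_ge0// ltW.
have PA1 : P A <= 1 by exact: probability_le1.
apply: (@le_trans _ _ (\int[P]_(x in A)
    ((1 + e / 2)%:E + ((2 * e)^-1 * (z x - 1) ^+ 2)%:E))).
  apply: ge0_le_integral => //.
  - by move=> x _; rewrite lee_fin.
  - by apply/measurable_EFinP/measurable_funTS.
  - by apply: emeasurable_funD.
  move=> x _; rewrite -EFinD lee_fin.
  rewrite -(ler_pM2l (x := 2 * e)) ?mulr_gt0// mulrDr mulrA mulfV ?gt_eqF ?mulr_gt0// mul1r.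
  by have := sqr_ge0 (z x - 1 - e); nra.
rewrite ge0_integralD//; last 2 first.
- by move=> x _; rewrite lee_fin addr_ge0// divr_ge0// ltW.
- by move=> x _; rewrite lee_fin mulr_ge0// sqr_ge0.
rewrite (_ : \int[P]_(x in A) (1 + e / 2)%:E = (1 + e / 2)%:E * P A);
  last exact: integral_cst.
have B : \int[P]_(x in A) ((2 * e)^-1 * (z x - 1) ^+ 2)%:E <= (e / 2)%:E.
  apply: (@le_trans _ _ (\int[P]_x ((2 * e)^-1 * (z x - 1) ^+ 2)%:E)).
    apply: ge0_subset_integral => //.
    - by apply/measurable_EFinP; apply: measurable_funM.
    - by move=> x _; rewrite lee_fin mulr_ge0// sqr_ge0.
  under eq_integral do rewrite EFinM.
  rewrite ge0_integralZl//; last 2 first.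
  - exact/measurable_EFinP.
  - by move=> x _; rewrite lee_fin sqr_ge0.
  apply: le_trans (lee_wpmul2l _ H) _; first by rewrite lee_fin.
  rewrite -EFinM lee_fin le_eqVlt; apply/orP; left; apply/eqP; field.
  by rewrite gt_eqF.
apply: le_trans (leeD2l _ B) _.
have PA0 : 0 <= P A by [].
move: PA0 PA1; case: (P A) => [r||]//=.
rewrite -!EFinM -!EFinD !lee_fin => r0 r1; nra.
Qed.

End ChiSquareBound.

Section DiscreteMixture.
Context {R : realType} d (T : measurableType d) (P : probability T R) (m : nat).
Context (X : 'I_m -> T -> R) (s : R).
Hypothesis mX : forall i, measurable_fun setT (X i).
Hypothesis indepX : forall V : 'I_m -> set R, (forall i, measurable (V i)) ->
  P [set x | forall i, V i (X i x)] = (\prod_(i < m) P (X i @^-1` V i))%E.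
Hypothesis s0 : 0 < s.
Hypothesis lawX : forall i V, measurable V -> P (X i @^-1` V) = normal_prob 0 s V.

(** The average [z] of the likelihood ratios integrates over an event to the average of the shifted
    probabilities, and the hypothesis on the double sum says that its second moment is at most
    [1 + e^2]. *)
Lemma discrete_mixture_bound (I : finType) (a : I -> 'I_m -> R) (e : R)
    (W : set (m.-tuple R)) : (0 < #|I|)%N -> 0 < e ->
  \sum_(k : I) \sum_(l : I) expR (\sum_(i < m) a k i * a l i / s ^+ 2) <=
    (1 + e ^+ 2) * #|I|%:R ^+ 2 ->
  measurable W ->
  (#|I|%:R^-1%:E * \sum_(k : I) P (shifted_vector X (a k) @^-1` W) <=
   P (shifted_vector X (fun=> 0%R) @^-1` W) + e%:E)%E.
Proof.
move=> I0 e0 chi mW.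
have N0 : 0 < #|I|%:R :> R by rewrite ltr0n.
have Nn : #|I|%:R != 0 :> R by rewrite gt_eqF.
pose zk k x := \prod_(i < m) gauss_lr s (a k i) (X i x).
pose z x := #|I|%:R^-1 * \sum_(k : I) zk k x.
have zkE k x : (zk k x)%:E = cm_density X s (a k) x.
  apply: (big_ind2 (fun u v => u%:E = v)) => // u _ v _ <- <-.
  by rewrite EFinM.
have mzk k : measurable_fun setT (zk k).
  apply/measurable_EFinP; rewrite (_ : EFin \o _ = cm_density X s (a k)).
    exact: measurable_cm_density.
  by apply/funext => x /=; rewrite zkE.
have zk0 k x : 0 <= zk k x by apply: prodr_ge0 => i _; exact: gauss_lr_ge0.
have mz : measurable_fun setT z by apply: measurable_funM => //; exact: measurable_sum.
have z0 x : 0 <= z x.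
  by apply: mulr_ge0; [rewrite invr_ge0 ltW|exact: sumr_ge0].
have zA A : measurable A -> (\int[P]_(x in A) (z x)%:E =
    #|I|%:R^-1%:E * \sum_(k : I) \int[P]_(x in A) (cm_density X s (a k) x))%E.
  move=> mA; rewrite -ge0_integral_sum//; last 2 first.
  - by move=> k; apply: measurable_funTS; exact: measurable_cm_density.
  - by move=> k x _; exact: cm_density_ge0.
  rewrite -ge0_integralZl//; last 2 first.
  - by apply: emeasurable_sum => k; apply: measurable_funTS; exact: measurable_cm_density.
  - by move=> x _; apply: sume_ge0 => k _; exact: cm_density_ge0.
  apply: eq_integral => x _; rewrite /z EFinM -sumEFin; congr (_ * _)%E.
  by apply: eq_bigr => k _; rewrite zkE.
have E1 : (\int[P]_x (z x)%:E = 1)%E.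
  rewrite zA// (eq_bigr (fun=> 1%:E)); last first.
    move=> k _.
    have := discrete_cameron_martin mX indepX s0 lawX (a k) measurableT.
    by rewrite !preimage_setT probability_setT => <-.
  by rewrite sumEFin -EFinM sumr_const -mulr_natl mulr1 mulVf.
rewrite (eq_bigr (fun k => \int[P]_(x in shifted_vector X (fun=> 0%R) @^-1` W)
    cm_density X s (a k) x))%E; last first.
  by move=> k _; exact: discrete_cameron_martin mX indepX s0 lawX (a k) _ mW.
have mS : measurable (shifted_vector X (fun=> 0) @^-1` W).
  by rewrite -[X in measurable X]setTI; exact: measurable_shifted_vector.
rewrite -zA//; apply: chi_square_bound => //.
have -> : (\int[P]_x (z x ^+ 2)%:E =
   (#|I|%:R^-1 ^+ 2)%:E * \sum_(k : I) \sum_(l : I)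
     \int[P]_x (cm_density X s (a k) x * cm_density X s (a l) x))%E.
  transitivity (\int[P]_x ((#|I|%:R^-1 ^+ 2)%:E * \sum_(k : I) \sum_(l : I)
     (zk k x * zk l x)%:E))%E.
    apply: eq_integral => x _; rewrite /z exprMn EFinM; congr (_ * _)%E.
    rewrite expr2 mulr_suml -sumEFin; apply: eq_bigr => k _.
    by rewrite mulr_sumr -sumEFin.
  have mkl k l : measurable_fun setT (fun x => (zk k x * zk l x)%:E : \bar R).
    by apply/measurable_EFinP; apply: measurable_funM.
  rewrite ge0_integralZl//; last 2 first.
  - by apply: emeasurable_sum => k; apply: emeasurable_sum.
  - by move=> x _; apply: sume_ge0 => k _; apply: sume_ge0 => l _;
      rewrite lee_fin mulr_ge0.
  congr (_ * _)%E; rewrite ge0_integral_sum//; last 2 first.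
  - by move=> k; apply: emeasurable_sum.
  - by move=> k x _; apply: sume_ge0 => l _; rewrite lee_fin mulr_ge0.
  apply: eq_bigr => k _; rewrite ge0_integral_sum//; last first.
    by move=> l x _; rewrite lee_fin mulr_ge0.
  apply: eq_bigr => l _; apply: eq_integral => x _.
  by rewrite EFinM !zkE.
under eq_bigr => k _ do under eq_bigr => l _ do
  rewrite (expectation_cm_densityM mX indepX s0 lawX).
under eq_bigr => k _ do rewrite sumEFin.
rewrite sumEFin -EFinM lee_fin exprVn ler_pdivrMl ?exprn_gt0//.
by rewrite mulrC.
Qed.

End DiscreteMixture.

(** * Approximation of data events by cylinders *)

Section AlgebraApproximation.
Context {R : realType} d (T : measurableType d) (P : probability T R).
Context (J : finType) (U : Type) (Y : J -> T -> U) (C : set (set U)).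
Hypothesis mC : forall j A, C A -> measurable (Y j @^-1` A).
Hypothesis C0 : C set0.
Hypothesis CC : forall A, C A -> C (~` A).
Hypothesis CU : forall A A', C A -> C A' -> C (A `|` A').

Definition symdiff (A A' : set U) : set U := (A `\` A') `|` (A' `\` A).

(** One set [B] must serve all the laws [Y j] at once, so that an inequality between a mixture and a
    reference law passes to the limit. Measurability of the preimages is included because [U]
    carries no sigma-algebra. *)
Definition approximable (A : set U) : Prop :=
  (forall j, measurable (Y j @^-1` A)) /\
  forall e : R, 0 < e -> exists2 B, C B &
    forall j, (P (Y j @^-1` symdiff A B) <= e%:E)%E.

Lemma measurable_symdiff (A B : set U) :
  (forall j, measurable (Y j @^-1` A)) -> (forall j, measurable (Y j @^-1` B)) ->
  forall j, measurable (Y j @^-1` symdiff A B).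
Proof.
move=> mA mB j; rewrite (_ : _ @^-1` _ =
  ((Y j @^-1` A) `\` (Y j @^-1` B)) `|` ((Y j @^-1` B) `\` (Y j @^-1` A)))//.
by apply: measurableU; apply: measurableD.
Qed.

Lemma approximable_sub A : C A -> approximable A.
Proof.
move=> CA; split=> [j|e e0]; first exact: mC.
exists A => // j; rewrite /symdiff !setDv setU0 preimage_set0 measure0.
by rewrite lee_fin ltW.
Qed.

Lemma approximableC A : approximable A -> approximable (~` A).
Proof.
move=> [mA aA]; split=> [j|e e0].
  by rewrite -preimage_setC; exact: measurableC.
have [B CB PB] := aA e e0; exists (~` B); first exact: CC.
move=> j; apply: le_trans (PB j); rewrite le_eqVlt; apply/orP; left; apply/eqP.
congr (P (_ @^-1` _)); rewrite /symdiff; apply/seteqP; split => y /= [] [a b].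
- by right; split => //; apply: contrapT.
- by left; split => //; apply: contrapT.
- by right; split => // /(_ a).
- by left; split => // /(_ a).
Qed.

Lemma approximableU A A' :
  approximable A -> approximable A' -> approximable (A `|` A').
Proof.
move=> [mA aA] [mA' aA']; have mAA' j : measurable (Y j @^-1` (A `|` A')).
  by rewrite preimage_setU; exact: measurableU.
split=> // e e0; have e20 : 0 < e / 2 by rewrite divr_gt0.
have [B CB PB] := aA _ e20; have [B' CB' PB'] := aA' _ e20.
exists (B `|` B'); first exact: CU.
move=> j.
have m1 := measurable_symdiff mA (fun j => mC j CB) j.
have m2 := measurable_symdiff mA' (fun j => mC j CB') j.
apply: (@le_trans _ _ (P ((Y j @^-1` symdiff A B) `|` (Y j @^-1` symdiff A' B')))).
  apply: le_measure; rewrite ?inE.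
  - by apply: measurable_symdiff => // i; exact/mC/CU.
  - exact: measurableU.
  - move=> x /= [[[a|a] /not_orP[b b']]|[[a|a] /not_orP[b b']]].
    + by left; left.
    + by right; left.
    + by left; right.
    + by right; right.
apply: le_trans (measureU2 _ m1 m2) _.
by apply: le_trans (leeD (PB j) (PB' j)) _; rewrite -EFinD -splitr.
Qed.

Lemma approximable_bigsetU (F : nat -> set U) n : (forall i, approximable (F i)) ->
  approximable (\big[setU/set0]_(i < n) F i).
Proof.
move=> aF; elim: n => [|n IH].
  by rewrite big_ord0; exact: approximable_sub.
by rewrite big_ord_recr /=; exact: approximableU.
Qed.

Lemma approximable_bigcup (F : nat -> set U) : (forall i, approximable (F i)) ->
  approximable (\bigcup_i F i).
Proof.
move=> aF.
have mF i j : measurable (Y j @^-1` F i) by case: (aF i).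
have mUF j : measurable (Y j @^-1` \bigcup_i F i).
  by rewrite preimage_bigcup; exact: bigcupT_measurable.
split=> // e e0; have e20 : 0 < e / 2 by rewrite divr_gt0.
pose G n := \big[setU/set0]_(i < n) F i.
have mG n j : measurable (Y j @^-1` G n).
  by case: (approximable_bigsetU n aF) => + _; apply.
have mD n j : measurable (Y j @^-1` ((\bigcup_i F i) `\` G n)).
  rewrite (_ : _ @^-1` _ = (Y j @^-1` \bigcup_i F i) `\` (Y j @^-1` G n))//.
  exact: measurableD.
have small : \forall n \near \oo, forall j,
    (P (Y j @^-1` ((\bigcup_i F i) `\` G n)) <= (e / 2)%:E)%E.
  (* Finiteness of [J] provides one truncation index for all the laws. *)
  apply: filter_forall => j.
  have : P (Y j @^-1` ((\bigcup_i F i) `\` G n)) @[n --> \oo] -->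
      P (\bigcap_n (Y j @^-1` ((\bigcup_i F i) `\` G n))).
    apply: nonincreasing_cvg_mu => //.
    - by rewrite (le_lt_trans (probability_le1 P _)) ?ltry.
    - exact: bigcapT_measurable.
    - move=> n n' nn'; apply/subsetPset => x /= [Fx Gx]; split => // Gx'; apply: Gx.
      by apply: (subset_bigsetU (F := F) nn').
  rewrite (_ : \bigcap_n _ = set0) ?measure0; last first.
    apply/seteqP; split => // x Hx.
    have [[i _ Fi] _] := Hx 0%N I.
    have [_ ] := Hx i.+1 I; apply.
    by rewrite /G big_ord_recr /=; right.
  move=> /fine_cvgP[fn /cvgrPdist_le /(_ _ e20)] cv.
  near=> n; rewrite -[leLHS]fineK; last by near: n.
  rewrite lee_fin; apply: le_trans (ler_norm _) _; rewrite -normrN -[- _]add0r.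
  by near: n.
have [n _ /(_ n (leqnn n)) Pn] := small.
have [_ /(_ _ e20)[B CB PB]] := approximable_bigsetU n aF.
exists B => // j.
have m2 := measurable_symdiff (fun j => mG n j) (fun j => mC j CB) j.
apply: (@le_trans _ _ (P ((Y j @^-1` ((\bigcup_i F i) `\` G n)) `|`
    (Y j @^-1` symdiff (G n) B)))).
  apply: le_measure; rewrite ?inE.
  - by apply: measurable_symdiff => // i; exact: mC.
  - exact: measurableU.
  - move=> x /= [[Fx Bx]|[Bx Fx]].
      by have [Gx|Gx] := pselect (G n (Y j x)); [right; left|left].
    right; right; split => // Gx; apply: Fx.
    exact: (bigsetU_bigcup (F := F) Gx).
apply: le_trans (measureU2 _ (mD n j) m2) _.
by apply: le_trans (leeD (Pn j) (PB j)) _; rewrite -EFinD -splitr.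
Unshelve. all: end_near. Qed.

Lemma sigma_algebra_approximable : sigma_algebra setT approximable.
Proof.
split.
- exact: approximable_sub.
- by move=> A; rewrite setTD; exact: approximableC.
- exact: approximable_bigcup.
Qed.

End AlgebraApproximation.

(** [None] stands for the reference law and [Some k] for the components of the mixture. The
    approximation error [r / 2] is paid once on each side. *)
Lemma mixture_bound_approximable {R : realType} d (T : measurableType d)
    (P : probability T R) (I : finType) (U : Type) (Y : option I -> T -> U)
    (C : set (set U)) (e : R) (A : set U) : (0 < #|I|)%N ->
  (forall j A, C A -> measurable (Y j @^-1` A)) ->
  (forall A, C A -> (#|I|%:R^-1%:E * \sum_(k : I) P (Y (Some k) @^-1` A) <=
    P (Y None @^-1` A) + e%:E)%E) ->
  approximable P Y C A ->
  (#|I|%:R^-1%:E * \sum_(k : I) P (Y (Some k) @^-1` A) <=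
    P (Y None @^-1` A) + e%:E)%E.
Proof.
move=> I0 mC H [mA aA]; apply/lee_addgt0Pr => r r0.
have r20 : 0 < r / 2 by rewrite divr_gt0.
have [B CB PB] := aA _ r20.
have mB j := mC j _ CB.
have mS := measurable_symdiff mA mB.
have le1 j : (P (Y j @^-1` A) <= P (Y j @^-1` B) + (r / 2)%:E)%E.
  apply: (@le_trans _ _ (P ((Y j @^-1` B) `|` (Y j @^-1` symdiff A B)))).
    apply: le_measure; rewrite ?inE//; first exact: measurableU.
    move=> x /= Ax; have [Bx|Bx] := pselect (B (Y j x)); first by left.
    by right; left.
  by apply: le_trans (measureU2 _ (mB j) (mS j)) _; apply: leeD2l; exact: PB.
have le2 j : (P (Y j @^-1` B) <= P (Y j @^-1` A) + (r / 2)%:E)%E.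
  apply: (@le_trans _ _ (P ((Y j @^-1` A) `|` (Y j @^-1` symdiff A B)))).
    apply: le_measure; rewrite ?inE//; first exact: measurableU.
    move=> x /= Ax; have [Bx|Bx] := pselect (A (Y j x)); first by left.
    by right; right.
  by apply: le_trans (measureU2 _ (mA j) (mS j)) _; apply: leeD2l; exact: PB.
have N0 : 0 < #|I|%:R :> R by rewrite ltr0n.
apply: (@le_trans _ _ (#|I|%:R^-1%:E *
   \sum_(k : I) (P (Y (Some k) @^-1` B) + (r / 2)%:E))%E).
  apply: lee_wpmul2l; first by rewrite lee_fin invr_ge0 ltW.
  by apply: lee_sum => k _.
rewrite big_split/= ge0_muleDr; last 2 first.
- by apply: sume_ge0 => k _.
- by apply: sume_ge0 => k _; rewrite lee_fin ltW.
rewrite sumEFin sumr_const -EFinM -[X in _ * X]mulr_natl mulKf ?gt_eqF//.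
apply: le_trans (leeD2r _ (H _ CB)) _.
apply: le_trans (leeD2r _ (leeD2r _ (le2 None))) _.
rewrite -!addeA; apply: leeD2l; rewrite -!EFinD lee_fin; lra.
Qed.

(** * Cylinders over dyadic grids *)

Section PathSpace.
Context {R : realType}.

Definition dyad (p i : nat) : R := i%:R / 2 ^+ p.

Definition path_values (p : nat) (y : R -> R) : (2 ^ p).+1.-tuple R :=
  [tuple y (dyad p i) | i < (2 ^ p).+1].

(** Dyadic grids are nested, so any two cylinders can be written over a common grid, and cylinders
    form an algebra. The remaining times are reached through continuity of the paths. *)
Definition cylinder : set (set (R -> R)) :=
  [set A | exists p, exists2 W, measurable W & A = path_values p @^-1` W].

Lemma dyad_itv p i : (i <= 2 ^ p)%N -> 0 <= dyad p i <= 1.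
Proof.
move=> ip; rewrite /dyad divr_ge0 ?exprn_ge0//= ler_pdivrMr ?exprn_gt0//.
by rewrite mul1r -natrX ler_nat.
Qed.

Lemma dyad_refine p q i : dyad (p + q) (i * 2 ^ q) = dyad p i.
Proof.
rewrite /dyad exprD natrM natrX; field.
by rewrite !expf_neq0//.
Qed.

Definition coarsen p q (v : (2 ^ (p + q)).+1.-tuple R) : (2 ^ p).+1.-tuple R :=
  [tuple tnth v (inord (i * 2 ^ q)) | i < (2 ^ p).+1].

Lemma measurable_coarsen p q : measurable_fun setT (@coarsen p q).
Proof.
apply/measurable_fun_tnthP => i; rewrite (_ : _ \o _ = fun v => tnth v (inord (i * 2 ^ q))).
  exact: measurable_tnth.
by apply/funext => v /=; rewrite tnth_mktuple.
Qed.

Lemma coarsen_path_values p q y : coarsen (path_values (p + q) y) = path_values p y.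
Proof.
apply: eq_from_tnth => i; rewrite !tnth_mktuple inordK ?dyad_refine//.
by rewrite ltnS expnD leq_mul2r -ltnS ltn_ord orbT.
Qed.

Lemma cylinder_lift p q W : measurable W ->
  exists2 W', measurable W' & path_values p @^-1` W = path_values (p + q) @^-1` W'.
Proof.
move=> mW; exists (@coarsen p q @^-1` W).
  by rewrite -[X in measurable X]setTI; exact: (measurable_coarsen measurableT mW).
rewrite -comp_preimage (_ : _ \o _ = path_values p)//.
by apply/funext => y /=; rewrite coarsen_path_values.
Qed.

Lemma cylinder0 : cylinder set0.
Proof. by exists 0%N, set0 => //; rewrite preimage_set0. Qed.

Lemma cylinderC A : cylinder A -> cylinder (~` A).
Proof.
move=> [p [W mW ->]]; exists p, (~` W); first exact: measurableC.
by rewrite -preimage_setC.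
Qed.

Lemma cylinderU A A' : cylinder A -> cylinder A' -> cylinder (A `|` A').
Proof.
move=> [p [W mW ->]] [q [W' mW' ->]].
have [V mV ->] := cylinder_lift q mW.
have [V' mV' ->] := cylinder_lift p mW'.
move: V' mV'; rewrite (addnC q p) => V' mV'.
exists (p + q)%N, (V `|` V'); first exact: measurableU.
by rewrite preimage_setU.
Qed.

Context d (T : measurableType d) (P : probability T R).
Context (J : finType) (Y : J -> T -> R -> R).
Hypothesis YC : forall j x, C01 (Y j x).
Hypothesis mY : forall j t, 0 <= t <= 1 -> measurable_fun setT (fun x => Y j x t).

Lemma measurable_cylinder j A : cylinder A -> measurable (Y j @^-1` A).
Proof.
move=> [p [W mW ->]]; rewrite -comp_preimage -[X in measurable X]setTI.
suff : measurable_fun setT (path_values p \o Y j) by apply.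
apply/measurable_fun_tnthP => i.
rewrite (_ : _ \o _ = fun x => Y j x (dyad p i)).
  by apply: mY; apply: dyad_itv; rewrite -ltnS.
by apply/funext => x /=; rewrite tnth_mktuple.
Qed.

(** Data events are subsets of [C01] and cylinders are not; as all paths lie in [C01], a set matters
    only through its trace there. *)
Lemma approximable_on_C01 (C : set (set (R -> R))) A A' :
  C01 `&` A = C01 `&` A' -> approximable P Y C A -> approximable P Y C A'.
Proof.
move=> AA' [mA aA]; have E j : Y j @^-1` A' = Y j @^-1` A.
  apply/seteqP; split => x /= h.
  - by have [] : (C01 `&` A) (Y j x) by rewrite AA'.
  - by have [] : (C01 `&` A') (Y j x) by rewrite -AA'.
split=> [j|e e0]; first by rewrite E.
have [B CB PB] := aA e e0; exists B => // j.
rewrite (_ : _ @^-1` _ = Y j @^-1` symdiff A B) ?PB//.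
apply/seteqP; split => x /=; rewrite /symdiff /setU /setD /=.
  by rewrite -![A' _]/((Y j @^-1` A') x) E.
by rewrite -![A (Y j x)]/((Y j @^-1` A) x) -E.
Qed.

Lemma C01_dyadic_limit (y : R -> R) (t : R) : C01 y -> 0 <= t <= 1 ->
  y (dyad q (Num.truncn (t * 2 ^+ q))) @[q --> \oo] --> y t.
Proof.
move=> cy /andP[t0 t1].
have t2 q : 0 <= t * 2 ^+ q by rewrite mulr_ge0// exprn_ge0.
have dq q : dyad q (Num.truncn (t * 2 ^+ q)) <= t < dyad q (Num.truncn (t * 2 ^+ q)) + (2 ^+ q)^-1.
  have /andP[a b] := truncn_itv (t2 q).
  rewrite /dyad ler_pdivrMr ?exprn_gt0// a /= -[X in _ + X]mul1r -mulrDl.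
  by rewrite ltr_pdivlMr ?exprn_gt0// natr1.
have cvd : dyad q (Num.truncn (t * 2 ^+ q)) @[q --> \oo] --> t.
  apply/cvgrPdist_lt => e e0.
  have h2 : `|2^-1 : R| < 1 by rewrite ger0_norm ?invr_ge0// invf_lt1// ltr1n.
  have /cvgrPdist_lt /(_ _ e0) H := cvg_geometric 1 h2.
  near=> q; have /andP[a b] := dq q.
  rewrite ger0_norm ?subr_ge0//.
  have : `|0 - geometric 1 2^-1 q| < e by near: q.
  rewrite /geometric /= mul1r sub0r normrN ger0_norm ?exprn_ge0 ?invr_ge0// exprVn.
  lra.
have dI q : (`[0, 1]%classic : set R) (dyad q (Num.truncn (t * 2 ^+ q))).
  rewrite /= in_itv/=; apply: dyad_itv.
  rewrite -(ler_nat R) natrX; have /andP[a _] := truncn_itv (t2 q).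
  by rewrite (le_trans a)// -[leRHS]mul1r ler_wpM2r// exprn_ge0.
have tI : (`[0, 1]%classic : set R) t by rewrite /= in_itv/= t0 t1.
move/subspace_continuousP : cy => /(_ t tI) cyt.
apply: (cvg_trans _ cyt) => V; rewrite /= /within /= => near_t.
have h : \forall q \near \oo, `[0, 1]%classic (dyad q (Num.truncn (t * 2 ^+ q))) ->
    V (y (dyad q (Num.truncn (t * 2 ^+ q)))).
  have h : \forall q \near \oo, dyad q (Num.truncn (t * 2 ^+ q)) \in `[0, 1] ->
    V (y (dyad q (Num.truncn (t * 2 ^+ q)))) := cvd _ near_t.
  by apply: filterS h => q + dq1; apply; exact: dI.
suff : \forall q \near \oo, V (y (dyad q (Num.truncn (t * 2 ^+ q)))) by [].
by apply: filterS h => q; apply; exact: dI.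
Unshelve. all: end_near. Qed.

Lemma approximable_evaluation (t : R) (V : set R) : 0 <= t <= 1 -> measurable V ->
  approximable P Y cylinder (C01 `&` [set y | V (y t)]).
Proof.
move=> t01 mV.
have SA : sigma_algebra setT (approximable P Y cylinder).
  exact: sigma_algebra_approximable measurable_cylinder cylinder0 cylinderC cylinderU.
pose S := g_sigma_algebraType (approximable P Y cylinder).
have mS (A : set S) : measurable A -> approximable P Y cylinder A.
  by rewrite -[measurable A]/(<<s approximable P Y cylinder >> A) sigma_algebra_id.
pose e q (y : S) : R := (y : R -> R) (dyad q (Num.truncn (t * 2 ^+ q))).
have me q : measurable_fun setT (e q).
  move=> _ W mW; rewrite setTI; apply: sub_sigma_algebra.
  apply: (approximable_sub P measurable_cylinder).
  have kq : (Num.truncn (t * 2 ^+ q) < (2 ^ q).+1)%N.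
    have /andP[t0 t1] := t01.
    have t2 : 0 <= t * 2 ^+ q by rewrite mulr_ge0// exprn_ge0.
    rewrite ltnS -(ler_nat R) natrX; have /andP[a _] := truncn_itv t2.
    by rewrite (le_trans a)// -[leRHS]mul1r ler_wpM2r// exprn_ge0.
  exists q, ((fun v => tnth v (Ordinal kq)) @^-1` W).
    by rewrite -[X in measurable X]setTI; exact: (measurable_tnth (Ordinal kq) measurableT mW).
  by apply/seteqP; split => y /=; rewrite tnth_mktuple.
(* The upper limit is defined and measurable for every function [y], including discontinuous ones;
   on [C01] it is the value at [t]. *)
pose h (y : S) : \bar R := limn_esup (fun q => (e q y)%:E).
have mh : measurable_fun setT h.
  apply: measurable_fun_limn_esup => q; exact/measurable_EFinP.
have hE (y : S) : C01 (y : R -> R) -> h y = ((y : R -> R) t)%:E.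
  move=> cy; rewrite /h; have cv := C01_dyadic_limit cy t01.
  have cvE : (e q y)%:E @[q --> \oo] --> ((y : R -> R) t)%:E.
    by apply: cvg_EFin => //; exact: nearW.
  by rewrite is_cvg_limn_esupE; [exact: cvg_lim|apply/cvg_ex; eexists; exact: cvE].
apply: (@approximable_on_C01 _ (h @^-1` (EFin @` V))).
  apply/seteqP; split => y /= [cy].
    by move=> [v Vv hv]; have [<-] : v%:E = (y t)%:E := etrans hv (hE y cy).
  by move=> [_ Vy]; split => //; exists (y t) => //; exact: (esym (hE y cy)).
apply: mS; rewrite -[X in measurable X]setTI; apply: mh => //.
exact: measurable_image_EFin.
Qed.

Lemma approximable_data_event A : data_event A -> approximable P Y cylinder A.
Proof.
have SA : sigma_algebra setT (approximable P Y cylinder).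
  exact: sigma_algebra_approximable measurable_cylinder cylinder0 cylinderC cylinderU.
apply: smallest_sub.
(* Complements of data events are taken within [C01], those of approximable sets in the whole
   function space; the traces on [C01] agree. *)
- case: SA => S0 SC SU; split => // B aB.
  apply: (@approximable_on_C01 _ (setT `\` B)); last exact: SC.
  by apply/seteqP; split => y /= [cy]; [move=> [_ By]|move=> [_ By]]; split.
- move=> _ [t t01 [V mV ->]]; apply: approximable_evaluation => //.
Qed.

End PathSpace.

(** * Comparison of laws in the white noise model *)

Section WhiteNoiseComparison.
Context {R : realType}.
Local Notation mu := (@lebesgue_measure R).
Local Notation integrable01 f := (mu.-integrable `[0, 1] (EFin \o f)).

Definition primitive (f : R -> R) (t : R) : R := \int[mu]_(u in `[0, t]) f u.

Definition cell (f : R -> R) (p i : nat) : R :=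
  primitive f (dyad p i.+1) - primitive f (dyad p i).

(* Discretization at level [p] of the inner product of [f] and [g] on [0,1]. *)
Definition energy (p : nat) (f g : R -> R) : R :=
  2 ^+ p * \sum_(i < 2 ^ p) cell f p i * cell g p i.

Lemma primitive0 (f : R -> R) : primitive f 0 = 0.
Proof. by rewrite /primitive set_itv1 Rintegral_set1. Qed.

Lemma integrable01_sub (f : R -> R) t : 0 <= t <= 1 -> integrable01 f ->
  mu.-integrable `[0, t] (EFin \o f).
Proof.
move=> /andP[t0 t1] fi; apply: integrableS fi => //.
by apply: subset_itvl; rewrite bnd_simp.
Qed.

Lemma primitiveD (f h : R -> R) t : 0 <= t <= 1 ->
  integrable01 f -> integrable01 h ->
  primitive (f \+ h) t = primitive f t + primitive h t.
Proof.
by move=> t01 fi hi; rewrite /primitive RintegralD//; exact: integrable01_sub.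
Qed.

Lemma sum_cell (h : R -> R) p k :
  \sum_(i < k) cell h p i = primitive h (dyad p k).
Proof.
rewrite -(big_mkord xpredT (cell h p)) telescope_sumr//.
by rewrite /dyad mul0r primitive0 subr0.
Qed.

Context d (T : measurableType d) (P : probability T R) (B : R -> T -> R).
Hypothesis hB : brownian_motion P B.

Definition increment (p : nat) (i : 'I_(2 ^ p)) (x : T) : R :=
  B (dyad p i.+1) x - B (dyad p i) x.
Arguments increment : clear implicits.

Lemma measurable_increment p i : measurable_fun setT (increment p i).
Proof.
have [mB _ _ _] := hB; apply: measurable_funB; apply: mB; apply: dyad_itv => //.
exact: ltnW.
Qed.

Lemma dyad_lt p i : dyad p i < dyad p i.+1 :> R.
Proof. by rewrite /dyad ltr_pM2r ?invr_gt0 ?exprn_gt0// ltr_nat. Qed.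

Lemma dyadB p i : dyad p i.+1 - dyad p i = (2 ^+ p)^-1 :> R.
Proof. by rewrite /dyad -mulrBl -natr1 addrAC subrr add0r mul1r. Qed.

Lemma increment_law p i V : measurable V ->
  P (increment p i @^-1` V) = normal_prob 0 (Num.sqrt (2 ^+ p)^-1) V.
Proof.
move=> mV; have [_ _ lB _] := hB.
have /andP[a0 _] : 0 <= (dyad p i : R) <= 1 by apply: dyad_itv; exact: ltnW.
have /andP[_ b1] : 0 <= (dyad p i.+1 : R) <= 1 by exact: dyad_itv.
by have := lB _ _ a0 (dyad_lt p i) b1 V mV; rewrite dyadB.
Qed.

Lemma increment_indep p (V : 'I_(2 ^ p) -> set R) : (forall i, measurable (V i)) ->
  P [set x | forall i, V i (increment p i x)] =
  (\prod_(i < 2 ^ p) P (increment p i @^-1` V i))%E.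
Proof.
move=> mV; have [_ _ _ iB] := hB.
pose V' (i : nat) : set R := if insub i is Some j then V j else setT.
have V'E (i : 'I_(2 ^ p)) : V' i = V i by rewrite /V' valK.
have := iB (2 ^ p)%N (dyad p) V'; rewrite big_mkord => H.
transitivity (P [set x | forall i, (i < 2 ^ p)%N ->
    V' i (B (dyad p i.+1) x - B (dyad p i) x)]).
  congr (P _); apply/seteqP; split => x /= h.
    move=> i ip; rewrite -[i]/(val (Ordinal ip)) V'E; exact: h.
  by move=> i; have := h i (ltn_ord i); rewrite V'E.
rewrite H; first by apply: eq_bigr => i _; rewrite V'E.
- by move=> i; exact: dyad_itv.
- by move=> i _; rewrite ltW// dyad_lt.
- by move=> i _; rewrite /V'; case: insub.
Qed.

Lemma observation_C01 (f : R -> R) n x : integrable01 f -> C01 (observation B f n x).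
Proof.
move=> fi; have [_ [_ cB] _ _] := hB.
apply/subspace_continuousP => t t01; apply: cvgD.
  have := parameterized_integral_continuous ler01 fi.
  by move/subspace_continuousP; exact.
apply: cvgM; first exact: cvg_cst.
by have /subspace_continuousP := cB x; exact.
Qed.

Lemma measurable_observation (f : R -> R) n t : 0 <= t <= 1 ->
  measurable_fun setT (fun x => observation B f n x t).
Proof.
move=> t01; have [mB _ _ _] := hB; apply: measurable_funD => //.
by apply: measurable_funM => //; exact: mB.
Qed.

(** The path on the grid as a function of the noise increments, with [f] as fixed drift. Adding a
    signal then only shifts the Gaussian vector, and the same measurable map serves both laws. *)
Definition grid_values (f : R -> R) (n p : nat) (v : (2 ^ p).-tuple R) :
    (2 ^ p).+1.-tuple R :=
  [tuple primitive f (dyad p i) + (Num.sqrt n%:R)^-1 *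
     \sum_(j < 2 ^ p | (j < i)%N) tnth v j | i < (2 ^ p).+1].

Lemma measurable_grid_values f n p : measurable_fun setT (@grid_values f n p).
Proof.
apply/measurable_fun_tnthP => i.
rewrite (_ : _ \o _ = fun v => primitive f (dyad p i) + (Num.sqrt n%:R)^-1 *
     \sum_(j < 2 ^ p | (j < i)%N) tnth v j).
  apply: measurable_funD => //; apply: measurable_funM => //.
  under eq_fun do rewrite big_mkcond.
  apply: measurable_sum => j; case: (j < i)%N => //.
  exact: measurable_tnth.
by apply/funext => v /=; rewrite tnth_mktuple.
Qed.

Lemma path_values_observation (f h : R -> R) n p x : (0 < n)%N ->
  integrable01 f -> integrable01 h ->
  path_values p (observation B (f \+ h) n x) =
  grid_values f n (shifted_vector (increment p)
    (fun i => Num.sqrt n%:R * cell h p i) x).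
Proof.
move=> n0 fi hi; apply: eq_from_tnth => i; rewrite !tnth_mktuple /observation.
have [_ [B0 _] _ _] := hB.
have ip : (i <= 2 ^ p)%N by rewrite -ltnS.
rewrite -/(primitive _ _) primitiveD//; last exact: dyad_itv.
rewrite -addrA; congr (_ + _).
under eq_bigr do rewrite tnth_mktuple.
rewrite big_split /= mulrDr addrC; congr (_ + _).
  congr (_ * _).
  rewrite (big_ord_narrow ip) /=.
  transitivity (\sum_(j < i) (B (dyad p j.+1) x - B (dyad p j) x)); last by [].
  rewrite -(big_mkord xpredT (fun j => B (dyad p j.+1) x - B (dyad p j) x)).
  by rewrite telescope_sumr// /dyad mul0r B0 subr0.
rewrite -mulr_sumr mulKf; last by rewrite sqrtr_eq0 -ltNge ltr0n.
by rewrite (big_ord_narrow ip) /= -sum_cell.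
Qed.

Lemma path_values_observation0 (f : R -> R) n p x :
  path_values p (observation B f n x) =
  grid_values f n (shifted_vector (increment p) (fun=> 0) x).
Proof.
apply: eq_from_tnth => i; rewrite !tnth_mktuple /observation.
have [_ [B0 _] _ _] := hB.
have ip : (i <= 2 ^ p)%N by rewrite -ltnS.
congr (_ + _ * _).
under eq_bigr do rewrite tnth_mktuple addr0.
rewrite (big_ord_narrow ip) /=.
transitivity (\sum_(j < i) (B (dyad p j.+1) x - B (dyad p j) x)); last by [].
rewrite -(big_mkord xpredT (fun j => B (dyad p j.+1) x - B (dyad p j) x)).
by rewrite telescope_sumr// /dyad mul0r B0 subr0.
Qed.

Lemma level_mixture_bound (I : finType) (f : R -> R) (h : I -> R -> R) (n p : nat)
    (e : R) (W : set ((2 ^ p).+1.-tuple R)) :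
  (0 < #|I|)%N -> (0 < n)%N -> 0 < e ->
  integrable01 f -> (forall k, integrable01 (h k)) ->
  \sum_(k : I) \sum_(l : I) expR (n%:R * energy p (h k) (h l)) <=
    (1 + e ^+ 2) * #|I|%:R ^+ 2 ->
  measurable W ->
  (#|I|%:R^-1%:E * \sum_(k : I)
     P (observation B (f \+ h k)%R n @^-1` (path_values p @^-1` W)) <=
   P (observation B f n @^-1` (path_values p @^-1` W)) + e%:E)%E.
Proof.
move=> I0 n0 e0 fi hi chi mW.
have p0 : 0 < (2 ^+ p : R) by rewrite exprn_gt0.
have s0 : 0 < Num.sqrt (2 ^+ p)^-1 :> R by rewrite sqrtr_gt0 invr_gt0.
have mG : measurable (@grid_values f n p @^-1` W).
  rewrite -[X in measurable X]setTI.
  exact: (measurable_grid_values f n measurableT mW).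
pose a k (i : 'I_(2 ^ p)) : R := Num.sqrt n%:R * cell (h k) p i.
have -> : observation B f n @^-1` (path_values p @^-1` W) =
    shifted_vector (increment p) (fun=> 0) @^-1` (@grid_values f n p @^-1` W).
  by apply/seteqP; split => x /=; rewrite path_values_observation0.
rewrite (eq_bigr (fun k => P (shifted_vector (increment p) (a k) @^-1`
    (@grid_values f n p @^-1` W)))); last first.
  move=> k _; congr (P _).
  by apply/seteqP; split => x /=; rewrite path_values_observation.
apply: (@discrete_mixture_bound R _ T P _ (increment p) _ (@measurable_increment p)
  (@increment_indep p) s0 (@increment_law p) I a e _ I0 e0 _ mG).
apply: le_trans chi; apply: ler_sum => k _; apply: ler_sum => l _.
rewrite ler_expR le_eqVlt; apply/orP; left; apply/eqP.
rewrite /energy mulrA mulr_sumr; apply: eq_bigr => i _.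
rewrite sqr_sqrtr ?invr_ge0 ?ltW// invrK /a.
by rewrite -[in RHS](sqr_sqrtr (ler0n R n)); ring.
Qed.

(* Bounding [energy] at all large levels stands for bounding the chi-square
   distance between the mixture and the law under [f]. *)
Lemma law_mixture_bound (I : finType) (f : R -> R) (h : I -> R -> R) (n p0 : nat)
    (e : R) (A : set (R -> R)) :
  (0 < #|I|)%N -> (0 < n)%N -> 0 < e ->
  integrable01 f -> (forall k, integrable01 (h k)) ->
  (forall p, (p0 <= p)%N ->
    \sum_(k : I) \sum_(l : I) expR (n%:R * energy p (h k) (h l)) <=
    (1 + e ^+ 2) * #|I|%:R ^+ 2) ->
  data_event A ->
  (#|I|%:R^-1%:E * \sum_(k : I) law P B (f \+ h k)%R n A <= law P B f n A + e%:E)%E.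
Proof.
move=> I0 n0 e0 fi hi chi dA.
pose Y (j : option I) (x : T) : R -> R :=
  observation B (if j is Some k then f \+ h k else f) n x.
have YC j x : C01 (Y j x).
  apply: observation_C01; case: j => [k|//].
  rewrite (_ : EFin \o _ = (EFin \o f) \+ (EFin \o h k))%E; last by [].
  exact: integrableD.
have mY j t : 0 <= t <= 1 -> measurable_fun setT (fun x => Y j x t).
  by move=> t01; exact: measurable_observation.
apply: (@mixture_bound_approximable R _ T P I _ Y cylinder) => //.
- by move=> j C; exact: measurable_cylinder.
- move=> _ [p [W mW ->]].
  (* Any cylinder can be rewritten over a grid of level at least [p0], where the energy bound is
     available. *)
  have [W' mW' ->] := cylinder_lift p0 mW.
  by apply: level_mixture_bound => //; apply: chi; rewrite leq_addl.
- exact: approximable_data_event.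
Qed.

Lemma measurable_law (f : R -> R) n A : integrable01 f -> data_event A ->
  measurable (observation B f n @^-1` A).
Proof.
move=> fi dA.
(* Approximability for a one-element family of laws contains the measurability sought. *)
have [+ _] := @approximable_data_event R _ T P unit (fun _ => observation B f n)
  (fun _ x => observation_C01 fi) (fun _ t t01 => measurable_observation f n t01) A dA.
by move=> /(_ tt).
Qed.

End WhiteNoiseComparison.

(** * Square-integrable functions *)

Section SquareIntegrable.
Context {R : realType}.
Local Notation mu := (@lebesgue_measure R).
Context (D : set R).
Hypothesis mD : measurable D.
Implicit Types f g : R -> R.

Lemma integrable_le f g : measurable_fun D f -> mu.-integrable D (EFin \o g) ->
  (forall x, D x -> `|f x| <= g x) -> mu.-integrable D (EFin \o f).
Proof.
move=> mf gi fg; apply: le_integrable gi => //; first exact/measurable_EFinP.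
by move=> x Dx /=; rewrite lee_fin (le_trans (fg x Dx))// ler_norm.
Qed.

Lemma integrableMz (c : R) f : mu.-integrable D (EFin \o f) ->
  mu.-integrable D (EFin \o (fun x => c * f x)).
Proof.
move=> fi; rewrite (_ : EFin \o _ = (fun x => c%:E * (EFin \o f) x)%E).
  exact: integrableZl.
by apply/funext => x /=; rewrite EFinM.
Qed.

Lemma integrableDz f g : mu.-integrable D (EFin \o f) ->
  mu.-integrable D (EFin \o g) -> mu.-integrable D (EFin \o (fun x => f x + g x)).
Proof.
move=> fi gi; rewrite (_ : EFin \o _ = (EFin \o f) \+ (EFin \o g))%E//.
exact: integrableD.
Qed.

Lemma square_integrableM f g : square_integrable D f -> square_integrable D g ->
  mu.-integrable D (EFin \o (fun x => f x * g x)).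
Proof.
move=> [mf f2] [mg g2]; apply: integrable_le (integrableDz f2 g2) _.
  exact: measurable_funM.
move=> x _; rewrite ler_norml; apply/andP; split.
- by have := sqr_ge0 (f x + g x); have := sqr_ge0 (f x - g x); nra.
- by have := sqr_ge0 (f x + g x); have := sqr_ge0 (f x - g x); nra.
Qed.

Lemma square_integrableD f g : square_integrable D f -> square_integrable D g ->
  square_integrable D (fun x => f x + g x).
Proof.
move=> sf sg; have [mf f2] := sf; have [mg g2] := sg.
split; first exact: measurable_funD.
have fg := square_integrableM sf sg.
have := integrableDz (integrableDz f2 (integrableMz 2 fg)) g2.
congr (integrable _ _ _); apply/funext => x /=; congr (_%:E); ring.
Qed.

Lemma square_integrableZ c f : square_integrable D f ->
  square_integrable D (fun x => c * f x).
Proof.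
move=> [mf f2]; split; first exact: measurable_funM.
have := integrableMz (c ^+ 2) f2.
by congr (integrable _ _ _); apply/funext => x /=; rewrite exprMn.
Qed.

Lemma square_integrableB f g : square_integrable D f -> square_integrable D g ->
  square_integrable D (fun x => f x - g x).
Proof.
move=> sf /(square_integrableZ (-1)) sg.
have := square_integrableD sf sg.
by congr (square_integrable _ _); apply/funext => x; rewrite mulN1r.
Qed.

Lemma square_integrable0 : square_integrable D (fun=> 0).
Proof.
split => //; rewrite (_ : EFin \o _ = cst 0%E); first exact: integrable0.
by apply/funext => x /=; rewrite expr0n.
Qed.

Lemma square_integrable_sum (I : Type) (r : seq I) (Q : pred I) (F : I -> R -> R) :
  (forall i, Q i -> square_integrable D (F i)) ->
  square_integrable D (fun x => \sum_(i <- r | Q i) F i x).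
Proof.
move=> sF; elim: r => [|i r IH].
  by under eq_fun do rewrite big_nil; exact: square_integrable0.
under eq_fun do rewrite big_cons.
by have [Qi|//] := boolP (Q i); apply: square_integrableD => //; exact: sF.
Qed.

Lemma innerC f g : inner D f g = inner D g f.
Proof. by rewrite /inner; apply: eq_Rintegral => x _; rewrite mulrC. Qed.

Lemma inner_ext f f' g g' : (forall x, D x -> f x = f' x) ->
  (forall x, D x -> g x = g' x) -> inner D f g = inner D f' g'.
Proof.
move=> ff gg; apply: eq_Rintegral => x; rewrite inE => Dx.
by rewrite ff ?gg.
Qed.

Lemma innerDl f f' g : square_integrable D f -> square_integrable D f' ->
  square_integrable D g ->
  inner D (fun x => f x + f' x) g = inner D f g + inner D f' g.
Proof.
move=> sf sf' sg; rewrite /inner -RintegralD//; try exact: square_integrableM.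
by apply: eq_Rintegral => x _; rewrite mulrDl.
Qed.

Lemma innerZl c f g : square_integrable D f -> square_integrable D g ->
  inner D (fun x => c * f x) g = c * inner D f g.
Proof.
move=> sf sg; rewrite /inner -RintegralZl//; try exact: square_integrableM.
by apply: eq_Rintegral => x _; rewrite mulrA.
Qed.

Lemma innerBl f f' g : square_integrable D f -> square_integrable D f' ->
  square_integrable D g ->
  inner D (fun x => f x - f' x) g = inner D f g - inner D f' g.
Proof.
move=> sf sf' sg; rewrite /inner -RintegralB//; try exact: square_integrableM.
by apply: eq_Rintegral => x _; rewrite mulrBl.
Qed.

Lemma inner0l g : inner D (fun=> 0) g = 0.
Proof.
rewrite /inner (eq_Rintegral _ (g := fun=> 0)) ?Rintegral_cst ?mul0r//.
by move=> x _; rewrite mul0r.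
Qed.

Lemma inner_suml (I : Type) (r : seq I) (Q : pred I) (F : I -> R -> R) g :
  (forall i, Q i -> square_integrable D (F i)) -> square_integrable D g ->
  inner D (fun x => \sum_(i <- r | Q i) F i x) g = \sum_(i <- r | Q i) inner D (F i) g.
Proof.
move=> sF sg; elim: r => [|i r IH].
  rewrite big_nil -[RHS](inner0l g).
  by apply: inner_ext => // x _; rewrite big_nil.
transitivity (inner D (fun x => if Q i then F i x + \sum_(j <- r | Q j) F j x
    else \sum_(j <- r | Q j) F j x) g).
  by apply: inner_ext => // x _; rewrite big_cons.
rewrite big_cons; have [Qi|//] := boolP (Q i); rewrite innerDl ?IH//; first exact: sF.
exact: square_integrable_sum.
Qed.

Lemma inner_self_ge0 f : 0 <= inner D f f.
Proof. by apply: Rintegral_ge0 => x _; rewrite -expr2 sqr_ge0. Qed.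

Lemma inner_sqr_le f g : square_integrable D f -> square_integrable D g ->
  inner D f g ^+ 2 <= inner D f f * inner D g g.
Proof.
move=> sf sg.
have H (a b : R) :
    0 <= a ^+ 2 * inner D f f - 2 * (a * b) * inner D f g + b ^+ 2 * inner D g g.
  have saf := square_integrableZ a sf; have sbg := square_integrableZ b sg.
  have sab := square_integrableB saf sbg.
  have := inner_self_ge0 (fun x => a * f x - b * g x).
  rewrite innerBl// innerZl// innerZl//.
  rewrite (innerC f) (innerC g) !innerBl// !innerZl// (innerC g f).
  by congr (0 <= _); ring.
have [g0|g0] := eqVneq (inner D g g) 0.
  have [->|fg0] := eqVneq (inner D f g) 0.
    by rewrite expr0n mulr_ge0// inner_self_ge0.
  (* When [inner D g g = 0] the form is affine in [b], and this value of [b] would make it equal to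
     -1. *)
  have := H 1 ((inner D f f + 1) / (2 * inner D f g)).
  rewrite g0 !mulr0 addr0 !mul1r expr1n mul1r.
  have -> : 2 * ((inner D f f + 1) / (2 * inner D f g)) * inner D f g =
    inner D f f + 1 by field.
  by rewrite opprD addNKr; lra.
have gp : 0 < inner D g g by rewrite lt_neqAle eq_sym g0 inner_self_ge0.
have := H (inner D g g) (inner D f g).
have -> : inner D g g ^+ 2 * inner D f f
   - 2 * (inner D g g * inner D f g) * inner D f g
   + inner D f g ^+ 2 * inner D g g =
   inner D g g * (inner D f f * inner D g g - inner D f g ^+ 2) by ring.
by rewrite pmulr_rge0// subr_ge0.
Qed.

End SquareIntegrable.

Section UnitInterval.
Context {R : realType}.
Local Notation mu := (@lebesgue_measure R).
Local Notation I01 := (`[0 : R, 1]%classic : set R).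

Lemma mu01 : mu I01 = 1%E.
Proof. by rewrite lebesgue_measure_itv/= lte_fin ltr01 -EFinB subr0. Qed.

Lemma bounded_integrable01 (f : R -> R) (c : R) : measurable_fun I01 f ->
  (forall x, I01 x -> `|f x| <= c) -> mu.-integrable I01 (EFin \o f).
Proof.
move=> mf fc; apply: measurable_bounded_integrable => //.
  apply: (@le_lt_trans _ _ 1%E); last exact: ltry.
  by rewrite le_eqVlt; apply/orP; left; apply/eqP; exact: mu01.
exists c; split; first exact: num_real.
move=> M cM x xI.
exact: le_trans (fc x xI) (ltW cM).
Qed.

Lemma bounded_square_integrable01 (f : R -> R) (c : R) : measurable_fun I01 f ->
  (forall x, I01 x -> `|f x| <= c) -> square_integrable I01 f.
Proof.
move=> mf fc; split=> //; apply: (@bounded_integrable01 _ (c ^+ 2)).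
  exact: measurable_funX.
by move=> x xI; rewrite normrX lerXn2r ?nnegrE ?fc// (le_trans _ (fc x xI)).
Qed.

Lemma square_integrable01_int (f : R -> R) : square_integrable I01 f ->
  mu.-integrable I01 (EFin \o f).
Proof.
move=> sf; have s1 : square_integrable I01 (fun=> 1).
  by apply: (@bounded_square_integrable01 _ 1) => // x _; rewrite normr1.
have := square_integrableM (measurable_itv _) sf s1.
by congr (integrable _ _ _); apply/funext => x /=; rewrite mulr1.
Qed.

Lemma continuous_bounded01 (f : R -> R) : continuous f ->
  exists c, forall x, I01 x -> `|f x| <= c.
Proof.
move=> cf; have cn : {within I01, continuous (fun x => `|f x|)}.
  apply: continuous_subspaceT => x; apply: continuous_comp; first exact: cf.
  exact: norm_continuous.
have [c _ H] := EVT_max ler01 cn; exists `|f c| => x xI; exact: H.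
Qed.

Lemma continuous_square_integrable01 (f : R -> R) :
  continuous f -> square_integrable I01 f.
Proof.
move=> cf; have [c fc] := continuous_bounded01 cf.
apply: bounded_square_integrable01 fc.
by apply: measurable_funTS; exact: continuous_measurable_fun.
Qed.

(** The duality of sup norm and L^1 norm: in this form two functions in one band have close wavelet
    coefficients, and uniform tail bounds pass to coefficients. *)
Lemma le_inner01 (f g : R -> R) (c : R) : square_integrable I01 f ->
  square_integrable I01 g -> (forall x, I01 x -> `|f x| <= c) ->
  `|inner I01 f g| <= c * \int[mu]_(x in I01) `|g x|.
Proof.
move=> sf sg fc; have gi := square_integrable01_int sg.
have gni : mu.-integrable I01 (EFin \o (fun x => `|g x|)) by exact: integrable_norm.
have fgi := square_integrableM (measurable_itv _) sf sg.
apply: le_trans (le_normr_Rintegral _ _) _ => //.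
rewrite -RintegralZl//; apply: le_Rintegral => //.
- exact: integrable_norm.
- exact: integrableMz.
- by move=> x xI; rewrite normrM ler_wpM2r// fc.
Qed.

End UnitInterval.

(** * The discretized energy *)

Section EnergyBounds.
Context {R : realType}.
Local Notation mu := (@lebesgue_measure R).
Local Notation I01 := (`[0 : R, 1]%classic : set R).

Lemma square_integrableS (A D : set R) (f : R -> R) : measurable A -> measurable D ->
  A `<=` D -> square_integrable D f -> square_integrable A f.
Proof.
move=> mA mD AD [mf f2]; split; last exact: integrableS f2.
exact: measurable_funS mf.
Qed.

Lemma dyad_cell_sub p i : (i < 2 ^ p)%N ->
  `]dyad p i, dyad p i.+1]%classic `<=` I01.
Proof.
move=> ip x /=; rewrite !in_itv/= => /andP[a b].
have /andP[i0 _] := dyad_itv (R := R) (ltnW ip).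
have /andP[_ i1] := dyad_itv (R := R) ip.
by rewrite (le_trans i0 (ltW a)) (le_trans b i1).
Qed.

Lemma cellE (h : R -> R) p i : (i < 2 ^ p)%N -> mu.-integrable I01 (EFin \o h) ->
  cell h p i = \int[mu]_(x in `]dyad p i, dyad p i.+1]) h x.
Proof.
move=> ip hi; rewrite /cell /primitive Rintegral_itvB//.
- apply: integrable01_sub hi; exact: dyad_itv.
- by rewrite bnd_simp; have /andP[] := dyad_itv (R := R) (ltnW ip).
- by rewrite bnd_simp ltW// dyad_lt.
Qed.

Lemma cell_eq0 (h : R -> R) p i : (i < 2 ^ p)%N -> mu.-integrable I01 (EFin \o h) ->
  (forall x, dyad p i <= x <= dyad p i.+1 -> h x = 0) -> cell h p i = 0.
Proof.
move=> ip hi h0; rewrite cellE// (eq_Rintegral _ (g := fun=> 0)).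
  by rewrite Rintegral_cst ?mul0r.
move=> x; rewrite inE /= in_itv/= => /andP[a b].
by apply: h0; rewrite ltW.
Qed.

Lemma energy_eq0 p (h h' : R -> R) :
  (forall i, (i < 2 ^ p)%N -> cell h p i = 0 \/ cell h' p i = 0) ->
  energy p h h' = 0.
Proof.
move=> H; rewrite /energy big1 ?mulr0// => i _.
by have [->|->] := H i (ltn_ord i); rewrite ?mulr0 ?mul0r.
Qed.

(** Cauchy-Schwarz on each cell, of length [2^-p]: averaging over cells can only lose energy. *)
Lemma energy_le p (h : R -> R) : square_integrable I01 h ->
  energy p h h <= inner I01 h h.
Proof.
move=> sh; have hi := square_integrable01_int sh.
have hh := square_integrableM (measurable_itv _) sh sh.
have p0 : 0 < (2 ^+ p : R) by rewrite exprn_gt0.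
have -> : inner I01 h h = \sum_(i < 2 ^ p) cell (fun x => h x * h x) p i.
  by rewrite sum_cell /inner /primitive /dyad natrX divff ?gt_eqF.
rewrite /energy mulr_sumr; apply: ler_sum => i _.
rewrite !cellE//.
set D := `]dyad p i, dyad p i.+1]%classic.
have mD : measurable D by exact: measurable_itv.
have DI : D `<=` I01 by exact: dyad_cell_sub.
have sD : square_integrable D h by apply: square_integrableS sh.
have s1 : square_integrable D (fun=> 1).
  apply: (square_integrableS mD (measurable_itv `[0 : R, 1]) DI).
  by apply: (@bounded_square_integrable01 R _ 1) => // x _; rewrite normr1.
have := inner_sqr_le mD sD s1.
have -> : inner D h (fun=> 1) = \int[mu]_(x in D) h x.
  by apply: eq_Rintegral => x _; rewrite mulr1.
have -> : inner D (fun=> 1) (fun=> 1) = (2 ^+ p)^-1 :> R.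
  rewrite /inner (eq_Rintegral _ (g := fun=> 1)); last by move=> x _; rewrite mulr1.
  rewrite Rintegral_cst// mul1r.
  have muD : mu D = (dyad p i.+1 - dyad p i)%:E.
    by rewrite /D lebesgue_measure_itv/= lte_fin dyad_lt -EFinB.
  by rewrite -[LHS]/(fine (mu D)) muD /= dyadB.
by rewrite ler_pdivlMr// mulrC expr2.
Qed.

End EnergyBounds.

(** * Wavelet series *)

Section AffineChange.
Context {R : realType}.
Local Notation mu := (@lebesgue_measure R).

Lemma integrable_affine (c d : R) (f : R -> R) : 0 < c ->
  mu.-integrable setT (EFin \o f) ->
  mu.-integrable setT (EFin \o (fun x => f (c * x + d))).
Proof.
move=> c0 /integrableP[mf fi]; apply/integrableP; split.
  apply: (measurableT_comp mf); exact: measurable_affine.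
rewrite (ge0_integral_affine d (f := fun x => `|(EFin \o f) x|%E) c0)//.
  by apply: lte_mul_pinfty => //; rewrite lee_fin invr_ge0 ltW.
exact: measurableT_comp.
Qed.

Lemma Rintegral_affine (c d : R) (f : R -> R) : 0 < c ->
  mu.-integrable setT (EFin \o f) ->
  \int[mu]_x f (c * x + d) = c^-1 * \int[mu]_x f x.
Proof.
move=> c0 fi; have [mf _] := integrableP _ _ _ fi.
rewrite /Rintegral.
have -> : (\int[mu]_x (f (c * x + d))%:E = c^-1%:E * \int[mu]_x (f x)%:E)%E.
  have LE := integralE mu setT (fun x => (f (c * x + d))%:E).
  have RE := integralE mu setT (fun x => (f x)%:E).
  rewrite LE RE.
  have -> : (\int[mu]_x (fun x => (f (c * x + d))%:E)^\+ x =
      c^-1%:E * \int[mu]_x (fun x => (f x)%:E)^\+ x)%E.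
    have mpos : measurable_fun setT ((EFin \o f)^\+)%E by exact: measurable_funepos.
    have fpos x : (0 <= (EFin \o f)^\+ x)%E by exact: funepos_ge0.
    apply: etrans (ge0_integral_affine d c0 mpos fpos).
    by apply: eq_integral => x _; rewrite !funeposE.
  have -> : (\int[mu]_x (fun x => (f (c * x + d))%:E)^\- x =
      c^-1%:E * \int[mu]_x (fun x => (f x)%:E)^\- x)%E.
    have mneg : measurable_fun setT ((EFin \o f)^\-)%E by exact: measurable_funeneg.
    have fneg x : (0 <= (EFin \o f)^\- x)%E by exact: funeneg_ge0.
    apply: etrans (ge0_integral_affine d c0 mneg fneg).
    by apply: eq_integral => x _; rewrite !funenegE.
  rewrite [RHS]muleBr//.
  exact: (integrable_add_def measurableT fi).
rewrite fineM//.
by apply: integrable_fin_num.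
Qed.

Lemma negligible_affine (c d : R) (A : set R) : 0 < c ->
  mu.-negligible A -> mu.-negligible ((fun x => c * x + d) @^-1` A).
Proof.
move=> c0 [N [mN N0 AN]]; exists ((fun x => c * x + d) @^-1` N); split.
- by rewrite -[X in measurable X]setTI; exact: measurable_affine.
- by apply: etrans (lebesgue_measure_affine d c0 mN) _; rewrite N0 mule0.
- by move=> x; exact: AN.
Qed.

Lemma dilateE (g : R -> R) (j k : int) x :
  dilate g j k x = 2 `^ (j%:~R / 2) * g (2 ^ j * x + (- k%:~R)).
Proof. by []. Qed.

Lemma exprz2_gt0 (j : int) : 0 < (2 ^ j : R).
Proof. by rewrite exprz_gt0. Qed.

Lemma powR_half_sqr (j : int) : (2 `^ (j%:~R / 2)) ^+ 2 = 2 ^ j :> R.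
Proof.
rewrite -powR_mulrn ?powR_ge0// -powRrM.
by rewrite mulfVK ?pnatr_eq0// powR_intmul// lt0r_neq0.
Qed.

Lemma square_integrable_dilate (g : R -> R) (j k : int) :
  square_integrable setT g -> square_integrable setT (dilate g j k).
Proof.
move=> [mg g2]; split.
  apply: measurable_funM => //; apply: (measurableT_comp mg).
  exact: measurable_affine.
have := integrableMz (measurableT) (2 ^ j) (integrable_affine (- k%:~R) (exprz2_gt0 j) g2).
congr (integrable _ _ _); apply/funext => x /=.
by rewrite dilateE exprMn powR_half_sqr.
Qed.

Lemma inner_dilate (f g : R -> R) (j k l : int) :
  square_integrable setT f -> square_integrable setT g ->
  inner setT (dilate f j k) (dilate g j l) = inner setT (dilate f 0 k) (dilate g 0 l).
Proof.
move=> sf sg.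
have d0 (h : R -> R) (i : int) x : dilate h 0 i x = h (x - i%:~R).
  by rewrite dilateE mul0r powRr0 mul1r expr0z mul1r.
have sf0 := square_integrable_dilate 0 k sf.
have sg0 := square_integrable_dilate 0 l sg.
have fg := square_integrableM measurableT sf0 sg0.
have := Rintegral_affine 0 (exprz2_gt0 j) fg.
rewrite /inner => E; apply: (mulfI (x := (2 ^ j)^-1)).
  by rewrite invr_eq0 lt0r_neq0// exprz2_gt0.
rewrite -E -RintegralZl//; last first.
  apply: square_integrableM => //; exact: square_integrable_dilate.
apply: eq_Rintegral => x _; rewrite !d0 !dilateE addr0.
rewrite mulrACA -expr2 powR_half_sqr mulKf//.
by rewrite lt0r_neq0// exprz2_gt0.
Qed.

End AffineChange.

(** * A continuous version of the wavelet *)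

Section ContinuousWavelet.
Context {R : realType}.
Local Notation mu := (@lebesgue_measure R).
Context (K : nat) (phi psi : R -> R).
Hypothesis hphi : scaling_function phi.
Hypothesis hpsi : wavelet_of phi psi.
Hypothesis sphi : supported_in (1 - K%:R) K%:R phi.
Hypothesis spsi : supported_in (1 - K%:R) K%:R psi.
Hypothesis cphi : continuous phi.

(** As [psi] lives on [|x| <= K] and [phi (2 x - k)] on [|2 x - k| <= K], only indices with
    [|k| <= 3 K] can give a nonzero inner product. *)
Definition wavelet_support : seq int := [seq i%:Z - (3 * K)%:Z | i <- iota 0 (6 * K).+1].

(* The wavelet is given as an element of L^2 only; this finite sum is a
   continuous version of it. *)
Definition cont_wavelet (x : R) : R :=
  \sum_(k <- wavelet_support) inner setT psi (dilate phi 1 k) * dilate phi 1 k x.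

Lemma psi_span0 : closed_span psi 0 psi.
Proof.
have [si _ _] := hpsi; split=> // e e0; exists [:: 0], (fun=> 1).
rewrite /sqdist (eq_Rintegral _ (g := fun=> 0)) ?Rintegral_cst ?mul0r//.
move=> x _; rewrite big_seq1 dilateE mul0r powRr0 !mul1r subr0.
by rewrite subrr expr0n.
Qed.

Lemma mem_wavelet_support (k : int) : (k \in wavelet_support) = (`|k| <= (3 * K)%:Z).
Proof.
apply/mapP/idP.
- by move=> [i]; rewrite mem_iota => ? ->; lia.
- move=> h; exists (absz (k + (3 * K)%:Z)); first by rewrite mem_iota; lia.
  lia.
Qed.

Lemma dilate_phi_eq0 (k : int) (x : R) : (3 * K)%:Z < `|k| -> `|x| <= K%:R ->
  dilate phi 1 k x = 0.
Proof.
move=> kK xK; rewrite dilateE sphi ?mulr0//.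
rewrite in_itv/= expr1z; apply/negP => /andP[a b].
have k3 : `|k|%:~R <= 3 * K%:R :> R.
  rewrite intr_norm; move: xK; rewrite !ler_norml => /andP[c d].
  by apply/andP; split; lra.
have : (3 * K)%:Z%:~R < `|k|%:~R :> R by rewrite ltr_int.
by rewrite -pmulrn natrM; lra.
Qed.

Lemma supported_norm (g : R -> R) x : supported_in (1 - K%:R) K%:R g ->
  g x != 0 -> `|x| <= K%:R.
Proof.
move=> sg gx; rewrite ler_norml.
have := contra_neqN (fun h => sg x h) gx; rewrite negbK in_itv/= => /andP[a b].
by apply/andP; split; lra.
Qed.

Lemma sphi_int : square_integrable setT phi.
Proof. by case: hphi => -[]. Qed.

Lemma spsi_int : square_integrable setT psi.
Proof. by case: hpsi. Qed.

Let dilate_phi_int k := square_integrable_dilate 1 k sphi_int.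

Lemma dilate_phi_orthonormal (k l : int) :
  inner setT (dilate phi 1 k) (dilate phi 1 l) = (k == l)%:R.
Proof.
rewrite inner_dilate; [|exact: sphi_int|exact: sphi_int].
by have [[_ +] _ _ _] := hphi; apply.
Qed.

Lemma square_integrable_cont_wavelet : square_integrable setT cont_wavelet.
Proof.
apply: square_integrable_sum => // k _.
by exact: square_integrableZ.
Qed.

Lemma wavelet_residual_orthogonal (k : int) :
  inner setT (fun x => psi x - cont_wavelet x) (dilate phi 1 k) = 0.
Proof.
have sc := square_integrable_cont_wavelet; have sp := spsi_int.
rewrite innerBl//.
have -> : inner setT cont_wavelet (dilate phi 1 k) =
   \sum_(l <- wavelet_support) inner setT psi (dilate phi 1 l) * (l == k)%:R.
  rewrite inner_suml//; last first.
    by move=> l _; exact: square_integrableZ.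
  by apply: eq_bigr => l _; rewrite innerZl ?dilate_phi_orthonormal//.
have [kS|kS] := boolP (k \in wavelet_support).
  have inj : injective (fun i : nat => i%:Z - (3 * K)%:Z) by move=> i j; lia.
  have uS : uniq wavelet_support by rewrite (map_inj_uniq inj) iota_uniq.
  rewrite (bigD1_seq k kS uS).
  rewrite eqxx mulr1 big1 => [|l /negbTE ->]; last by rewrite mulr0.
  by rewrite [X in _ - X](addr0 (inner _ _ _)) subrr.
rewrite big_seq big1 ?subr0; last first.
  move=> l lS; have [lk|_] := eqVneq l k; last by rewrite mulr0.
  by rewrite lk (negbTE kS) in lS.
rewrite /inner (eq_Rintegral _ (g := fun=> 0)) ?Rintegral_cst ?mul0r// => x _.
have [->|px] := eqVneq (psi x) 0; first by rewrite mul0r.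
rewrite dilate_phi_eq0 ?mulr0//; first by rewrite mem_wavelet_support -ltNge in kS.
exact: supported_norm px.
Qed.

(** The wavelet lies in the closed span of the [phi (2 x - k)], whereas the residual is orthogonal
    to all of them. Its squared norm is thus its inner product with [psi - q], for a finite
    combination [q] arbitrarily close to [psi], and Cauchy-Schwarz forces it to vanish. *)
Lemma cont_wavelet_ae : {ae mu, forall x, psi x = cont_wavelet x}.
Proof.
have sc := square_integrable_cont_wavelet; have sp := spsi_int.
pose u x := psi x - cont_wavelet x.
have hu k : inner setT u (dilate phi 1 k) = 0 := wavelet_residual_orthogonal k.
have su : square_integrable setT u by exact: square_integrableB.
have [_ _ /(_ psi)[+ _]] := hpsi; move=> /(_ psi_span0)[[_ app] _].
have uu : inner setT u u = 0.
  apply/eqP; rewrite eq_le inner_self_ge0 andbT; apply/ler_addgt0Pr => e e0.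
  rewrite add0r; have [s [c hc]] := app e e0.
  set q := (fun x => \sum_(k <- s) c k * dilate phi 1 k x) in hc.
  have sq : square_integrable setT q.
    apply: square_integrable_sum => // k _; exact: square_integrableZ.
  have uq : inner setT u q = 0.
    rewrite innerC inner_suml// => [|k _]; last first.
      by exact: square_integrableZ.
    rewrite big1// => k _; rewrite innerZl//.
    by rewrite (innerC _ _ u) hu mulr0.
  have uc : inner setT u cont_wavelet = 0.
    rewrite innerC inner_suml// => [|k _]; last first.
      by exact: square_integrableZ.
    rewrite big1// => k _; rewrite innerZl//.
    by rewrite (innerC _ _ u) hu mulr0.
  have spq : square_integrable setT (fun x => psi x - q x) by exact: square_integrableB.
  have E : inner setT u u = inner setT u (fun x => psi x - q x).
    rewrite [RHS]innerC innerBl// [inner _ q u]innerC uq.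
    transitivity (inner setT (fun x => psi x - cont_wavelet x) u); first by [].
    by rewrite innerBl// [inner _ cont_wavelet u]innerC uc.
  have CS := inner_sqr_le measurableT su spq.
  have sq_e : inner setT (fun x => psi x - q x) (fun x => psi x - q x) < e.
    move: hc; rewrite /sqdist /inner; congr (_ < _); apply: eq_Rintegral => x _; rewrite expr2.
  move: CS; rewrite -E expr2.
  have [->|u0] := eqVneq (inner setT u u) 0; first by move=> _; exact: ltW.
  have up : 0 < inner setT u u by rewrite lt_neqAle eq_sym u0 inner_self_ge0.
  by rewrite ler_pM2l// => h; rewrite (le_trans h)// ltW.
have ui := square_integrableM measurableT su su.
have : (\int[mu]_x `|(u x * u x)%:E| = 0)%E.
  transitivity (\int[mu]_x (u x * u x)%:E)%E.
    by apply: eq_integral => x _; rewrite gee0_abs// lee_fin -expr2 sqr_ge0.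
  rewrite -[LHS]fineK; last exact: integrable_fin_num.
  by rewrite -[fine _]/(inner setT u u) uu.
move=> /ae_eq_integral_abs H.
have : ae_eq mu setT (fun x => (u x * u x)%:E) (cst 0%E).
  by apply: H => //; have [] := integrableP _ _ _ ui.
apply: filterS => x /(_ I) /= [] /eqP; rewrite mulf_eq0 orbb subr_eq0.
by move=> /eqP.
Qed.

Lemma cont_wavelet_continuous : continuous cont_wavelet.
Proof.
rewrite /cont_wavelet; elim: wavelet_support => [|k s IH] x.
  under eq_fun do rewrite big_nil; exact: cvg_cst.
under eq_fun do rewrite big_cons.
apply: cvgD; last exact: IH.
apply: cvgM; first exact: cvg_cst.
apply: cvgM; first exact: cvg_cst.
apply: (cvg_comp (fun x => 2 ^ 1 * x - k%:~R) phi); last exact: cphi.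
by apply: cvgB; [apply: cvgM; [exact: cvg_cst|exact: cvg_id]|exact: cvg_cst].
Qed.

(** A nonzero term has [|k| <= 3 K] and [|2 x - k| <= K], hence [|x| <= 2 K]. *)
Lemma cont_wavelet_eq0 x : (2 * K)%:R + 1 <= `|x| -> cont_wavelet x = 0.
Proof.
move=> xK; rewrite /cont_wavelet big_seq big1// => k; rewrite mem_wavelet_support => kK.
rewrite dilateE; have [->|h] := eqVneq (phi (2 ^ 1 * x + - k%:~R)) 0.
  by rewrite !mulr0.
have := supported_norm sphi h; rewrite expr1z.
have : `|k%:~R| <= 3 * K%:R :> R.
  by rewrite -intr_norm; move: kK; rewrite -(ler_int R) -pmulrn natrM.
move: xK; rewrite natrM !ler_norml lerNl ler_normr => /orP xK /andP[a b] /andP[c d].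
by exfalso; case: xK; lra.
Qed.

Lemma cont_wavelet_bounded : exists2 C : R, 0 < C & forall x, `|cont_wavelet x| <= C.
Proof.
have L0 : - ((2 * K)%:R + 1) <= (2 * K)%:R + 1 :> R.
  by rewrite ge0_cp// addr_ge0.
have cn : {within `[- ((2 * K)%:R + 1), (2 * K)%:R + 1],
    continuous (fun x => `|cont_wavelet x|)}.
  apply: continuous_subspaceT => x; apply: continuous_comp.
    exact: cont_wavelet_continuous.
  exact: norm_continuous.
have [c _ H] := EVT_max L0 cn; exists (`|cont_wavelet c| + 1).
  by rewrite ltr_wpDl.
move=> x; have [xI|xI] := leP ((2 * K)%:R + 1) `|x|.
  by rewrite cont_wavelet_eq0// normr0 addr_ge0.
apply: (@le_trans _ _ `|cont_wavelet c|); last by rewrite lerDl.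
by apply: H; rewrite in_itv/= -ler_norml ltW.
Qed.

End ContinuousWavelet.

Section GeometricSeries.
Context {R : realType}.
Context (u : nat -> R -> R) (A q : R).
Hypothesis q0 : 0 <= q.
Hypothesis q1 : q < 1.
Hypothesis uA : forall l x, `|u l x| <= A * q ^+ l.

Definition sum_series (x : R) : R := limn (series (u ^~ x)).

Lemma geometric_partial_le m L : \sum_(m <= l < L) A * q ^+ l <= A * q ^+ m / (1 - q).
Proof.
have A0 : 0 <= A by have := uA 0 0; rewrite expr0 mulr1; apply: le_trans.
have q10 : 0 < 1 - q by rewrite subr_gt0.
have [mL|Lm] := leqP m L; last first.
  by rewrite big_geq ?(ltnW Lm)// divr_ge0 ?(ltW q10)// mulr_ge0// exprn_ge0.
rewrite ler_pdivlMr// -mulr_sumr -mulrA; apply: ler_wpM2l => //; rewrite mulr_suml.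
have -> : \sum_(m <= l < L) q ^+ l * (1 - q) = \sum_(m <= l < L) (q ^+ l - q ^+ l.+1).
  by apply: eq_bigr => l _; rewrite mulrBr mulr1 exprSr.
rewrite -(opprK (\sum_(_ <= _ < _) _)) -sumrN.
under eq_bigr do rewrite opprB.
by rewrite telescope_sumr// opprB lerBlDr lerDl exprn_ge0.
Qed.

Lemma sum_series_cvg x : cvgn (series (u ^~ x)).
Proof.
apply: normed_cvg; apply: (@series_le_cvg _ _ (fun l => A * q ^+ l)) => //.
- by move=> l /=.
- by move=> l; exact: le_trans (normr_ge0 _) (uA l x).
- by move=> l /=.
- apply: (@is_cvg_geometric_series _ A q).
  by rewrite ger0_norm.
Qed.

Lemma sum_series_tail L x :
  `|sum_series x - \sum_(l < L) u l x| <= A * q ^+ L / (1 - q).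
Proof.
have cv := @sum_series_cvg x.
have cvd : `|series (u ^~ x) n - \sum_(l < L) u l x| @[n --> \oo] -->
    `|sum_series x - \sum_(l < L) u l x|.
  by apply: cvg_norm; apply: cvgB; [exact: cv|exact: cvg_cst].
rewrite -(cvg_lim _ cvd)//; apply: limr_le; first by apply/cvg_ex; eexists; exact: cvd.
near=> n; have Ln : (L <= n)%N by near: n; exists L.
rewrite /series /= -(big_mkord xpredT (u ^~ x)) (big_cat_nat (n := L))//= addrC addrK.
apply: le_trans (ler_norm_sum _ _ _) _.
apply: le_trans (geometric_partial_le L n).
by apply: ler_sum => l _.
Unshelve. all: end_near. Qed.

Lemma sum_series_continuous : (forall l, continuous (u l)) -> continuous sum_series.
Proof.
move=> cu x; apply/cvgrPdist_lt => e e0.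
have e3 : 0 < e / 3 by rewrite divr_gt0.
have h : `|q| < 1 by rewrite ger0_norm.
have /cvgrPdist_lt/(_ _ e3) [L _ /(_ L (leqnn L)) HL] := cvg_geometric (A / (1 - q)) h.
have {}HL : A * q ^+ L / (1 - q) < e / 3.
  move: HL; rewrite /geometric /= sub0r normrN => /(le_lt_trans (ler_norm _)).
  by rewrite mulrAC.
have cp : continuous (fun y => \sum_(l < L) u l y).
  elim: (L) => [|k IH] y; first by under eq_fun do rewrite big_ord0; exact: cvg_cst.
  by under eq_fun do rewrite big_ord_recr; apply: cvgD; [exact: IH|exact: cu].
have := cp x; move/cvgrPdist_lt => /(_ _ e3) H.
near=> y.
have T1 := sum_series_tail L x; have T2 := sum_series_tail L y.
have T3 : `|\sum_(l < L) u l x - \sum_(l < L) u l y| < e / 3 by near: y.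
have -> : sum_series x - sum_series y = (sum_series x - \sum_(l < L) u l x) +
  (\sum_(l < L) u l x - \sum_(l < L) u l y) - (sum_series y - \sum_(l < L) u l y) by ring.
apply: le_lt_trans (ler_normB _ _) _; apply: le_lt_trans (lerD (ler_normD _ _) (lexx _)) _.
lra.
Unshelve. all: end_near. Qed.

End GeometricSeries.

Lemma continuous_sum {R : realType} (I : Type) (r : seq I) (F : I -> R -> R) :
  (forall i, continuous (F i)) -> continuous (fun x => \sum_(i <- r) F i x).
Proof.
move=> cF; elim: r => [|i r IH] x.
  by under eq_fun do rewrite big_nil; exact: cvg_cst.
by under eq_fun do rewrite big_cons; apply: cvgD; [exact: cF|exact: IH].
Qed.

(** * Basis functions and their continuous representatives *)

Section ContinuousBasis.
Context {R : realType}.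
Local Notation mu := (@lebesgue_measure R).
Local Notation I01 := (`[0 : R, 1]%classic : set R).
Context (w : wavelet_system R).
Hypothesis hw : cdv_system w.

Definition cwav : R -> R := cont_wavelet (wK w) (wphi w) (wpsi w).

Definition cpsi (l k : nat) : R -> R := dilate cwav l k.

Definition interior_index (l k : nat) : bool :=
  (wN w <= k)%N && (k < 2 ^ l - wN w)%N.

Lemma interior_lt l k : interior_index l k -> (k < 2 ^ l)%N.
Proof. by move=> /andP[_]; lia. Qed.

Lemma cpsiE l k x : cpsi l k x = 2 `^ (l%:R / 2) * cwav (2 ^+ l * x - k%:R).
Proof. by rewrite /cpsi dilateE -!pmulrn -exprnP. Qed.

Lemma wphi_continuous : continuous (wphi w).
Proof.
have [[_ _ _ [dphi _ _] _] _ _ _ _] := hw => x.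
exact/differentiable_continuous/derivable1_diffP.
Qed.

Lemma cwav_continuous : continuous cwav.
Proof. by apply: cont_wavelet_continuous; exact: wphi_continuous. Qed.

Lemma cpsi_continuous l k : continuous (cpsi l k).
Proof.
move=> x; apply: cvgM; first exact: cvg_cst.
apply: (cvg_comp (fun x => 2 ^ l * x - k%:~R) cwav); last exact: cwav_continuous.
by apply: cvgB; [apply: cvgM; [exact: cvg_cst|exact: cvg_id]|exact: cvg_cst].
Qed.

Lemma cpsi_square_integrable l k : square_integrable I01 (cpsi l k).
Proof. by apply: continuous_square_integrable01; exact: cpsi_continuous. Qed.

Lemma cpsi_bounded : exists2 C : R, 0 < C &
  forall l k x, `|cpsi l k x| <= C * 2 `^ (l%:R / 2).
Proof.
have [[_ [sphi _] _ _ _] _ _ _ _] := hw.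
have [C C0 HC] := cont_wavelet_bounded (wpsi w) sphi wphi_continuous.
exists C => // l k x; rewrite cpsiE normrM ger0_norm ?powR_ge0// mulrC.
by rewrite ler_wpM2r ?powR_ge0.
Qed.

Lemma cpsi_eq0 l k x : (2 * wK w)%:R + 1 <= `|2 ^+ l * x - k%:R| -> cpsi l k x = 0.
Proof.
have [[_ [sphi _] _ _ _] _ _ _ _] := hw.
by move=> h; rewrite cpsiE /cwav cont_wavelet_eq0 ?mulr0.
Qed.

Lemma cpsi_ae l k : interior_index l k ->
  {ae mu, forall x, Psi w l k x = cpsi l k x}.
Proof.
move=> /andP[Nk kN]; have [[[sf wf] [sphi spsi] _ _ _] _ _ _ _] := hw.
have ae := cont_wavelet_ae sf wf sphi spsi.
have [A [mA A0 sub]] := negligible_affine (- k%:~R) (exprz2_gt0 l) ae.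
exists A; split => // x /= nh; apply: sub => /= h; apply: nh.
rewrite /Psi /interval_function ltnNge Nk /= kN dilateE.
by rewrite /cpsi dilateE h.
Qed.

Lemma sqint_Psi l k : (wj0 w <= l)%N -> (k < 2 ^ l)%N -> square_integrable I01 (Psi w l k).
Proof. by have [_ _ _ _ [[_ +] _ _ _ _]] := hw; apply. Qed.

Lemma sqint_Phi k : (k < 2 ^ wj0 w)%N -> square_integrable I01 (Phi w k).
Proof. by have [_ _ _ _ [[+ _] _ _ _ _]] := hw; apply. Qed.

Lemma inner_cpsi l k (g : R -> R) : (wj0 w <= l)%N -> interior_index l k ->
  square_integrable I01 g -> inner I01 (cpsi l k) g = inner I01 (Psi w l k) g.
Proof.
move=> jl ik sg; have [mg _] := sg; have [mc _] := cpsi_square_integrable l k.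
have [mP _] := sqint_Psi jl (interior_lt ik).
rewrite /inner /Rintegral; congr fine; apply: ae_eq_integral => //.
- by apply/measurable_EFinP; exact: measurable_funM.
- by apply/measurable_EFinP; exact: measurable_funM.
have [Z [mZ Z0 sub]] := cpsi_ae ik; exists Z; split => // x /= nh.
    by apply: sub => /= h; apply: nh => _; rewrite h.
Qed.

Lemma inner_cpsi_Psi l k l' k' : (wj0 w <= l)%N -> interior_index l k ->
  (wj0 w <= l')%N -> (k' < 2 ^ l')%N ->
  inner I01 (cpsi l k) (Psi w l' k') = ((l == l') && (k == k'))%:R.
Proof.
move=> jl ik jl' kl'; rewrite inner_cpsi//; last exact: sqint_Psi.
have [_ _ _ _ [_ _ _ o _]] := hw; apply: o => //; exact: interior_lt.
Qed.

Lemma inner_cpsi_Phi l k k' : (wj0 w <= l)%N -> interior_index l k ->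
  (k' < 2 ^ wj0 w)%N -> inner I01 (cpsi l k) (Phi w k') = 0.
Proof.
move=> jl ik kl'; rewrite inner_cpsi//; last exact: sqint_Phi.
rewrite innerC; have [_ _ _ _ [_ _ o _ _]] := hw; apply: o => //; exact: interior_lt.
Qed.

Lemma inner_cpsi_self l k : (wj0 w <= l)%N -> interior_index l k ->
  inner I01 (cpsi l k) (cpsi l k) = 1.
Proof.
move=> jl ik; rewrite inner_cpsi//; last exact: cpsi_square_integrable.
rewrite innerC inner_cpsi_Psi ?eqxx//; exact: interior_lt.
Qed.

(** Height of order [2^(l/2)] on a support of length of order [2^-l]. Coefficients are inner
    products with [Psi], hence the statement; the pointwise estimates are made on the continuous
    version. *)
Lemma norm1_Psi : exists2 C : R, 0 < C & forall l k, (wj0 w <= l)%N ->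
  interior_index l k -> \int[mu]_(x in I01) `|Psi w l k x| <= C * 2 `^ (- (l%:R / 2)).
Proof.
have [C C0 HC] := cpsi_bounded.
pose L : R := (2 * wK w)%:R + 1.
have L0 : 0 < L by rewrite ltr_wpDl.
exists (C * (2 * L)); first by rewrite !mulr_gt0.
move=> l k jl ik.
have l0 : 0 < (2 ^+ l : R) by rewrite exprn_gt0.
have mc := (cpsi_square_integrable l k).1.
have mP := (sqint_Psi jl (interior_lt ik)).1.
pose a := (k%:R - L) / 2 ^+ l; pose b := (k%:R + L) / 2 ^+ l.
have ab : a < b by rewrite /a /b ltr_pM2r ?invr_gt0//; lra.
have c0 : 0 <= C * 2 `^ (l%:R / 2) by rewrite mulr_ge0 ?powR_ge0 ?ltW.
have H : (\int[mu]_(x in I01) (`|Psi w l k x|)%:E <=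
    (C * 2 `^ (l%:R / 2))%:E * mu `[a, b])%E.
  rewrite (_ : \int[mu]_(x in I01) _ = \int[mu]_(x in I01) (`|cpsi l k x|)%:E)%E; last first.
    apply: ae_eq_integral => //.
    - by apply/measurable_EFinP; exact: measurableT_comp.
    - by apply/measurable_EFinP; exact: measurableT_comp.
    have [Z [mZ Z0 sub]] := cpsi_ae ik; exists Z; split => // x /= nh.
    by apply: sub => /= h; apply: nh => _; rewrite h.
  apply: (@le_trans _ _ (\int[mu]_(x in I01) ((C * 2 `^ (l%:R / 2))%:E *
      (\1_(`[a, b]%classic : set R) x)%:E))%E).
    apply: ge0_le_integral => //.
    - by apply/measurable_EFinP; exact: measurableT_comp.
    - by apply: measurable_funTS; apply: emeasurable_funM => //;
        apply/measurable_EFinP/measurable_indic.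
    move=> x xI; rewrite -EFinM lee_fin indicE.
    have [xab|xab] := boolP (x \in _); first by rewrite mulr1 HC.
    rewrite mulr0 normr_le0; apply/eqP/cpsi_eq0.
    rewrite -/L leNgt; apply/negP => h; move/negP: xab; apply.
    rewrite inE /= in_itv/= /a /b ler_pdivrMr// ler_pdivlMr//.
    by move: h; rewrite ltr_norml => /andP[? ?]; apply/andP; split; lra.
  rewrite ge0_integralZl//; last first.
    by apply: measurable_funTS; apply/measurable_EFinP/measurable_indic.
  apply: lee_wpmul2l; first by rewrite lee_fin.
  rewrite integral_indic//.
  by apply: le_measure; rewrite ?inE//; exact: measurableI.
have -> : 2 `^ (- (l%:R / 2)) = 2 `^ (l%:R / 2) / 2 ^+ l :> R.
  have := powR_half_sqr (R := R) l; rewrite -exprnP -pmulrn => <-.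
  by rewrite powRN; field; rewrite gt_eqF// powR_gt0.
have muab : mu `[a, b] = (b - a)%:E.
  by rewrite lebesgue_measure_itv/= lte_fin ab -EFinB.
move: H; rewrite muab -EFinM => H.
rewrite /Rintegral -lee_fin fineK.
  apply: le_trans H _; rewrite lee_fin le_eqVlt; apply/orP; left; apply/eqP.
  by rewrite /a /b; field; rewrite gt_eqF.
rewrite ge0_fin_numE; first exact: le_lt_trans H (ltry _).
by apply: integral_ge0 => x _; rewrite lee_fin.
Qed.

(** As [wN w] is positive, index 0 belongs to the left edge, where the function is prescribed on the
    half-line as a finite combination of translates of [phi]. The same formula extends it
    continuously to the whole line. *)
Lemma scaling_edge_continuous : (0 < wN w)%N ->
  exists2 F : R -> R, continuous F & forall x, I01 x -> F x = Phi w 0 x.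
Proof.
move=> N0; have [_ _ [A [B [C H]]] _ _] := hw.
pose F0 x := \sum_((wN w - 0).-1 <= i < wN w) A 0%N i *
  edge_generator (wK w) (wN w) (wphi w) i x.
have cF0 : continuous F0.
  apply: continuous_sum => i x; apply: cvgM; first exact: cvg_cst.
  move: x; apply: continuous_sum => n x; apply: cvgM; first exact: cvg_cst.
  apply: (cvg_comp (fun x => x + n%:R - ((wN w)%:R - 1)) (wphi w)); last exact: wphi_continuous.
  by apply: cvgB; [apply: cvgD; [exact: cvg_id|exact: cvg_cst]|exact: cvg_cst].
exists (dilate F0 (wj0 w) 0).
  move=> x; apply: cvgM; first exact: cvg_cst.
  apply: (cvg_comp (fun x => 2 ^ wj0 w * x - 0%:~R) F0); last exact: cF0.
  by apply: cvgB; [apply: cvgM; [exact: cvg_cst|exact: cvg_id]|exact: cvg_cst].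
move=> x /=; rewrite in_itv/= => /andP[x0 x1].
rewrite /Phi /interval_function N0 !dilateE; congr (_ * _).
have y0 : 0 <= 2 ^ wj0 w * x + - (0 : int)%:~R.
  by rewrite oppr0 addr0 mulr_ge0// exprz_ge0.
by have [-> _] := H 0%N N0 _ y0.
Qed.

End ContinuousBasis.

(** * Functions with prescribed coefficients *)

Section WaveletSeries.
Context {R : realType}.
Local Notation mu := (@lebesgue_measure R).
Local Notation I01 := (`[0 : R, 1]%classic : set R).
Context (w : wavelet_system R).
Hypothesis hw : cdv_system w.
Context (F : R -> R).
Hypothesis cF : continuous F.
Hypothesis F_Phi : forall x, I01 x -> F x = Phi w 0 x.
Context (C : R).
Hypothesis C0 : 0 < C.
Hypothesis cpsiC : forall l k x, `|cpsi w l k x| <= C * 2 `^ (l%:R / 2).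
Implicit Types (b : nat -> nat -> R) (s A M : R).

Definition wlevel b (l : nat) (x : R) : R := \sum_(k < 2 ^ l) b l k * cpsi w l k x.

(* The summand [M * F] has scaling coefficient [M], which makes self-similarity
   at [j = wj0 w] immediate; only the levels above [wj0 w] matter then. *)
Definition wseries M b (x : R) : R := M * F x + sum_series (wlevel b) x.

(** [M * decay s l] is the largest absolute coefficient of level [l] allowed in the ball of radius
    [M]. *)
Definition decay s (l : nat) : R := 2 `^ (- (l%:R * (s + 2^-1))).

(** Level [wj0 w] is excluded because the index [wN w], which will carry the rough tail, is
    guaranteed to be interior only above it: [2 N <= 2 ^ wj0] may be an equality. *)
Definition interior_supported b : Prop :=
  forall l k, b l k != 0 -> (wj0 w < l)%N && interior_index w l k.

(** Bounding the sum over [k], not only the largest coefficient, gives uniform geometric convergence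
    without counting overlapping supports. The functions constructed have at most two nonzero
    coefficients per level. *)
Definition admissible s A b : Prop :=
  [/\ 0 < s, interior_supported b &
      forall l, \sum_(k < 2 ^ l) `|b l k| <= A * decay s l].

Lemma decay_gt0 s l : 0 < decay s l.
Proof. by rewrite powR_gt0. Qed.

Lemma decayE s l : decay s l * 2 `^ (l%:R / 2) = (2 `^ (- s)) ^+ l.
Proof.
rewrite /decay -powRD; last by rewrite pnatr_eq0 implybT.
rewrite -powR_mulrn ?powR_ge0// -powRrM; congr (_ `^ _); lra.
Qed.

Lemma geom_lt1 s : 0 < s -> 0 <= 2 `^ (- s) < (1 : R).
Proof.
move=> s0; rewrite powR_ge0 /= powRN invf_lt1 ?powR_gt0//.
apply: (@le_lt_trans _ _ (1 `^ s)); first by rewrite powR1.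
by apply: gt0_ltr_powR; rewrite ?nnegrE ?ler01 ?ler0n ?ltr1n //.
Qed.

Lemma admissible_level s A b l x : admissible s A b ->
  `|wlevel b l x| <= (A * C) * (2 `^ (- s)) ^+ l.
Proof.
move=> [s0 _ bA]; rewrite -decayE.
apply: le_trans (ler_norm_sum _ _ _) _.
apply: (@le_trans _ _ (\sum_(k < 2 ^ l) `|b l k| * (C * 2 `^ (l%:R / 2)))).
  by apply: ler_sum => k _; rewrite normrM ler_wpM2l.
rewrite -mulr_suml.
have -> : A * C * (decay s l * 2 `^ (l%:R / 2)) = A * decay s l * (C * 2 `^ (l%:R / 2)).
  by ring.
by apply: ler_wpM2r; rewrite ?mulr_ge0 ?powR_ge0// ltW.
Qed.

Lemma wseries_continuous s A M b : admissible s A b -> continuous (wseries M b).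
Proof.
move=> ab x; have [s0 _ _] := ab; have /andP[q0 q1] := geom_lt1 s0.
apply: cvgD; first by apply: cvgM; [exact: cvg_cst|exact: cF].
apply: (sum_series_continuous q0 q1 (fun l x => admissible_level l x ab)).
move=> l; apply: continuous_sum => k y; apply: cvgM; first exact: cvg_cst.
exact: cpsi_continuous.
Qed.

Lemma wseries_square_integrable s A M b : admissible s A b ->
  square_integrable I01 (wseries M b).
Proof.
by move=> ab; apply: continuous_square_integrable01; exact: wseries_continuous ab.
Qed.

Lemma wseries_tail s A M b L x : admissible s A b ->
  `|wseries M b x - (M * F x + \sum_(l < L) wlevel b l x)| <=
    A * C * (2 `^ (- s)) ^+ L / (1 - 2 `^ (- s)).
Proof.
move=> ab; have [s0 _ _] := ab; have /andP[q0 q1] := geom_lt1 s0.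
rewrite /wseries opprD addrACA subrr add0r.
exact: (sum_series_tail q0 q1 (fun l x => admissible_level l x ab)).
Qed.

Lemma wseries_agree s A A' M b b' L x : admissible s A b -> admissible s A' b' ->
  (forall l k, (l < L)%N -> b l k = b' l k) ->
  `|wseries M b x - wseries M b' x| <=
    (A + A') * C * (2 `^ (- s)) ^+ L / (1 - 2 `^ (- s)).
Proof.
move=> ab ab' E.
have T := wseries_tail M L x ab; have T' := wseries_tail M L x ab'.
have EE : \sum_(l < L) wlevel b l x = \sum_(l < L) wlevel b' l x.
  by apply: eq_bigr => l _; apply: eq_bigr => k _; rewrite E.
rewrite EE in T.
have -> : wseries M b x - wseries M b' x =
  (wseries M b x - (M * F x + \sum_(l < L) wlevel b' l x)) -
  (wseries M b' x - (M * F x + \sum_(l < L) wlevel b' l x)) by ring.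
apply: le_trans (ler_normB _ _) _; apply: le_trans (lerD T T') _.
by rewrite -!mulrDl.
Qed.

Lemma geometric_squeeze (q c z : R) : 0 <= q < 1 ->
  (\forall n \near \oo, `|z| <= c * q ^+ n) -> z = 0.
Proof.
move=> /andP[q0 q1] H; apply/eqP; rewrite -normr_eq0 eq_le normr_ge0 andbT.
apply/ler_addgt0Pr => e e0; rewrite add0r.
have h : `|q| < 1 by rewrite ger0_norm.
have /cvgrPdist_lt/(_ _ e0) G := cvg_geometric c h.
near \oo => n.
have h1 : `|z| <= c * q ^+ n by near: n.
have h2 : `|0 - geometric c q n| < e by near: n.
rewrite (le_trans h1)// (le_trans (ler_norm _))//.
by move: h2; rewrite sub0r normrN => /ltW.
Unshelve. all: end_near. Qed.

Lemma wseries_bump s A A' M b b' L k0 (c : R) x :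
  admissible s A b -> admissible s A' b' -> (k0 < 2 ^ L)%N ->
  (forall l k, b' l k = b l k + (if (l == L) && (k == k0) then c else 0)) ->
  wseries M b' x = wseries M b x + c * cpsi w L k0 x.
Proof.
move=> ab ab' kL E; have [s0 _ _] := ab; apply/eqP; rewrite -subr_eq0; apply/eqP.
apply: (geometric_squeeze (c := (A + A') * C / (1 - 2 `^ (- s))) (geom_lt1 s0)).
near=> n; have Ln : (L < n)%N by near: n; exists L.+1.
have T := wseries_tail M n x ab; have T' := wseries_tail M n x ab'.
have EE : \sum_(l < n) wlevel b' l x = \sum_(l < n) wlevel b l x + c * cpsi w L k0 x.
  rewrite (bigD1 (Ordinal Ln))//= [in RHS](bigD1 (Ordinal Ln))//= addrAC; congr (_ + _).
    rewrite /wlevel (bigD1 (Ordinal kL))//= [in RHS](bigD1 (Ordinal kL))//= addrAC.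
    congr (_ + _); first by rewrite E !eqxx mulrDl.
    by apply: eq_bigr => k kk; rewrite E eqxx (negbTE (_ : val k != k0))// addr0.
  apply: eq_bigr => l lL; apply: eq_bigr => k _.
  by rewrite E (negbTE (_ : val l != L))// addr0.
rewrite EE in T'.
have -> : wseries M b' x - (wseries M b x + c * cpsi w L k0 x) =
  (wseries M b' x - (M * F x + (\sum_(l < n) wlevel b l x + c * cpsi w L k0 x))) -
  (wseries M b x - (M * F x + \sum_(l < n) wlevel b l x)) by ring.
apply: le_trans (ler_normB _ _) _; apply: le_trans (lerD T' T) _.
by rewrite le_eqVlt; apply/orP; left; apply/eqP; ring.
Unshelve. all: end_near. Qed.

Lemma F_square_integrable : square_integrable I01 F.
Proof. exact: continuous_square_integrable01. Qed.

Lemma wlevel_square_integrable b l : square_integrable I01 (wlevel b l).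
Proof.
apply: square_integrable_sum => // k _; apply: square_integrableZ => //.
exact: cpsi_square_integrable.
Qed.

(** Uniform convergence passes to inner products with a fixed [g]. When [g] is a basis function,
    orthonormality makes the inner products of the partial sums eventually constant. *)
Lemma inner_wseries_eq s A M b g (v : R) : admissible s A b ->
  square_integrable I01 g ->
  (\forall L \near \oo, inner I01 (fun x => M * F x + \sum_(l < L) wlevel b l x) g = v) ->
  inner I01 (wseries M b) g = v.
Proof.
move=> ab sg H; have [s0 _ _] := ab.
have sf := wseries_square_integrable M ab.
apply/eqP; rewrite -subr_eq0; apply/eqP.
apply: (geometric_squeeze (c := A * C / (1 - 2 `^ (- s)) *
   \int[mu]_(x in I01) `|g x|) (geom_lt1 s0)).
near=> L.
have <- : inner I01 (fun x => M * F x + \sum_(l < L) wlevel b l x) g = v by near: L.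
have sp : square_integrable I01 (fun x => M * F x + \sum_(l < L) wlevel b l x).
  apply: square_integrableD => //.
    by apply: square_integrableZ => //; exact: F_square_integrable.
  by apply: square_integrable_sum => // l _; exact: wlevel_square_integrable.
rewrite -innerBl//.
apply: le_trans (le_inner01 _ sg (fun x _ => wseries_tail M L x ab)) _.
  exact: square_integrableB.
by rewrite le_eqVlt; apply/orP; left; apply/eqP; ring.
Unshelve. all: end_near. Qed.

Lemma inner_wlevel b l g : square_integrable I01 g ->
  inner I01 (wlevel b l) g = \sum_(k < 2 ^ l) b l k * inner I01 (cpsi w l k) g.
Proof.
move=> sg; rewrite inner_suml//; last first.
  move=> k _; apply: square_integrableZ => //; exact: cpsi_square_integrable.
by apply: eq_bigr => k _; rewrite innerZl//; exact: cpsi_square_integrable.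
Qed.

Lemma inner_wpartial M b L g : square_integrable I01 g ->
  inner I01 (fun x => M * F x + \sum_(l < L) wlevel b l x) g =
  M * inner I01 F g + \sum_(l < L) \sum_(k < 2 ^ l) b l k * inner I01 (cpsi w l k) g.
Proof.
move=> sg; have sF := F_square_integrable.
have sl l : square_integrable I01 (wlevel b l) by exact: wlevel_square_integrable.
rewrite innerDl//; last 2 first.
- exact: square_integrableZ.
- by apply: square_integrable_sum.
rewrite innerZl//; congr (_ + _); rewrite inner_suml//.
by apply: eq_bigr => l _; rewrite inner_wlevel.
Qed.

Lemma inner_F g : inner I01 F g = inner I01 (Phi w 0) g.
Proof. by apply: inner_ext => // x xI; rewrite F_Phi. Qed.

Lemma wseries_beta s A M b l k : admissible s A b ->
  (wj0 w <= l)%N -> (k < 2 ^ l)%N -> beta w (wseries M b) l k = b l k.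
Proof.
move=> ab jl kl; have sP := sqint_Psi hw jl kl; have [s0 sb _] := ab.
have [_ _ _ _ [_ _ PhiPsi _ _]] := hw.
apply: (inner_wseries_eq ab sP); near=> L.
have lL : (l < L)%N by near: L; exists l.+1.
rewrite inner_wpartial// inner_F PhiPsi ?expn_gt0// mulr0 add0r.
have E l' k' : b l' k' * inner I01 (cpsi w l' k') (Psi w l k) =
    b l' k' * ((l' == l) && (k' == k))%:R.
  have [->|bn] := eqVneq (b l' k') 0; first by rewrite !mul0r.
  have /andP[jl' ik'] := sb _ _ bn.
  by rewrite inner_cpsi_Psi// ltnW.
rewrite (bigD1 (Ordinal lL))//= [X in _ + X]big1 ?addr0; last first.
  move=> l' ll'; rewrite big1// => k' _; rewrite E.
  by rewrite (negbTE (_ : val l' != l))// mulr0.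
rewrite (bigD1 (Ordinal kl))//= E !eqxx mulr1 big1 ?addr0// => k' kk.
by rewrite E eqxx (negbTE (_ : val k' != k))// mulr0.
Unshelve. all: end_near. Qed.

Lemma wseries_alpha s A M b k : admissible s A b ->
  (k < 2 ^ wj0 w)%N -> alpha w (wseries M b) k = if k == 0%N then M else 0.
Proof.
move=> ab kl; have sP := sqint_Phi hw kl; have [s0 sb _] := ab.
have [_ _ _ _ [_ PhiPhi _ _ _]] := hw.
apply: (inner_wseries_eq ab sP); near=> L.
rewrite inner_wpartial// inner_F PhiPhi ?expn_gt0// big1 ?addr0; last first.
  move=> l _; rewrite big1// => k' _.
  have [->|bn] := eqVneq (b l k') 0; first by rewrite !mul0r.
  have /andP[jl' ik'] := sb _ _ bn.
  by rewrite inner_cpsi_Phi// ?mulr0// ltnW.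
by rewrite eq_sym; case: eqP => _; rewrite ?mulr1 ?mulr0.
Unshelve. all: end_near. Qed.

Lemma wseries_Cs_ball s A M b : admissible s A b -> 0 <= M ->
  (forall l k, `|b l k| <= M * decay s l) -> Cs_ball w s M (wseries M b).
Proof.
move=> ab M0 bM; split; first exact: wseries_square_integrable ab.
rewrite /Cs_norm ge_max; apply/andP; split.
  apply: ge_ereal_sup => _ [k /= kl <-].
  rewrite (wseries_alpha M ab)// lee_fin; case: eqP => _; last by rewrite normr0.
  by rewrite ger0_norm.
apply: ge_ereal_sup => _ [[l k] /= [jl kl] <-].
rewrite (wseries_beta M ab)// lee_fin -ler_pdivlMl ?powR_gt0//.
by rewrite -powRN mulrC.
Qed.

Lemma beta_partial_sum f i J l k : square_integrable I01 f -> (wj0 w <= i)%N ->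
  (i <= l)%N -> (l <= J)%N -> (k < 2 ^ l)%N ->
  beta w (partial_sum w f i J) l k = beta w f l k.
Proof.
move=> sf ji il lJ kl; have jl := leq_trans ji il.
have sP := sqint_Psi hw jl kl.
have [_ _ _ _ [_ _ PhiPsi PsiPsi _]] := hw.
have sPhi : square_integrable I01
    (fun x => if i == wj0 w then \sum_(0 <= k < 2 ^ wj0 w) alpha w f k * Phi w k x else 0).
  have [_|_] := eqVneq i (wj0 w); last exact: square_integrable0.
  under [X in square_integrable _ X]eq_fun do rewrite big_mkord.
  apply: square_integrable_sum => // k' _; apply: square_integrableZ => //.
  exact: sqint_Phi.
have sl l' : (i <= l' < J.+1)%N ->
    square_integrable I01 (fun x => \sum_(0 <= k < 2 ^ l') beta w f l' k * Psi w l' k x).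
  move=> /andP[il' _]; under [X in square_integrable _ X]eq_fun do rewrite big_mkord.
  apply: square_integrable_sum => // k' _; apply: square_integrableZ => //.
  by apply: sqint_Psi => //; exact: leq_trans il'.
have slsum : square_integrable I01 (fun x => \sum_(i <= l < J.+1)
     \sum_(0 <= k < 2 ^ l) beta w f l k * Psi w l k x).
  under [X in square_integrable _ X]eq_fun do rewrite big_nat.
  exact: square_integrable_sum.
rewrite {1}/beta /partial_sum innerDl//.
have -> : inner I01 (fun x => if i == wj0 w then
    \sum_(0 <= k < 2 ^ wj0 w) alpha w f k * Phi w k x else 0) (Psi w l k) = 0.
  case: eqP => _; last by rewrite inner0l.
  transitivity (inner I01 (fun x => \sum_(k < 2 ^ wj0 w) alpha w f k * Phi w k x) (Psi w l k)).
    by apply: inner_ext => // x _; rewrite big_mkord.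
  rewrite inner_suml// => [|k' _]; last first.
    by apply: square_integrableZ => //; exact: sqint_Phi.
  rewrite big1// => k' _; rewrite innerZl//; last exact: sqint_Phi.
  by rewrite PhiPsi// mulr0.
rewrite add0r.
transitivity (\sum_(i <= l' < J.+1 | (i <= l' < J.+1)%N)
   inner I01 (fun x => \sum_(0 <= k < 2 ^ l') beta w f l' k * Psi w l' k x) (Psi w l k)).
  rewrite -inner_suml//; apply: inner_ext => // x _; exact: big_nat.
rewrite -big_nat.
rewrite (bigD1_seq l)/=; last 2 first.
- by rewrite mem_index_iota il ltnS.
- exact: iota_uniq.
have E l' : (i <= l')%N ->
   inner I01 (fun x => \sum_(0 <= k < 2 ^ l') beta w f l' k * Psi w l' k x) (Psi w l k) =
   \sum_(k' < 2 ^ l') beta w f l' k' * ((l' == l) && (val k' == k))%:R.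
  move=> il'; have jl' := leq_trans ji il'.
  transitivity (inner I01 (fun x => \sum_(k < 2 ^ l') beta w f l' k * Psi w l' k x) (Psi w l k)).
    by apply: inner_ext => // x _; rewrite big_mkord.
  rewrite inner_suml// => [|k' _]; last first.
    by apply: square_integrableZ => //; exact: sqint_Psi.
  by apply: eq_bigr => k' _; rewrite innerZl ?PsiPsi//; exact: sqint_Psi.
rewrite E// (bigD1 (Ordinal kl))//= !eqxx mulr1 big1 ?addr0; last first.
  by move=> k' kk; rewrite (negbTE (_ : val k' != k))// mulr0.
rewrite big_seq_cond big1 ?addr0// => l'; rewrite mem_index_iota => /andP[/andP[il' _] ll'].
by rewrite E// big1// => k' _; rewrite (negbTE ll') mulr0.
Qed.

Lemma alpha_partial_sum f J k : square_integrable I01 f -> (k < 2 ^ wj0 w)%N ->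
  alpha w (partial_sum w f (wj0 w) J) k = alpha w f k.
Proof.
move=> sf kl; have sP := sqint_Phi hw kl.
have [_ _ _ _ [_ PhiPhi PhiPsi _ _]] := hw.
rewrite {1}/alpha /partial_sum eqxx.
transitivity (inner I01 (fun x => (\sum_(k < 2 ^ wj0 w) alpha w f k * Phi w k x) +
   \sum_(wj0 w <= l < J.+1 | (wj0 w <= l < J.+1)%N)
     \sum_(k < 2 ^ l) beta w f l k * Psi w l k x) (Phi w k)).
  apply: inner_ext => // x _; rewrite big_mkord -big_nat; congr (_ + _).
  by apply: eq_bigr => l _; rewrite big_mkord.
have sl l' : (wj0 w <= l' < J.+1)%N ->
    square_integrable I01 (fun x => \sum_(k < 2 ^ l') beta w f l' k * Psi w l' k x).
  move=> /andP[il' _].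
  apply: square_integrable_sum => // k' _; apply: square_integrableZ => //.
  exact: sqint_Psi.
have s1 (k' : 'I_(2 ^ wj0 w)) : square_integrable I01 (fun x => alpha w f k' * Phi w k' x).
  by apply: square_integrableZ => //; exact: sqint_Phi.
rewrite innerDl//; last 2 first.
- exact: square_integrable_sum.
- exact: square_integrable_sum.
rewrite inner_suml// (bigD1 (Ordinal kl))//= innerZl// PhiPhi// eqxx mulr1.
rewrite big1 ?addr0; last first.
  move=> k' kk; rewrite innerZl//; last exact: sqint_Phi.
  by rewrite PhiPhi// (negbTE (_ : val k' != k))// mulr0.
rewrite inner_suml// big1 ?addr0// => l /andP[jl _].
rewrite inner_suml// => [|k' _]; last first.
  by apply: square_integrableZ => //; exact: sqint_Psi.
rewrite big1// => k' _; rewrite innerZl//; last exact: sqint_Psi.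
by rewrite innerC PhiPsi// mulr0.
Qed.

(** The witness may depend on [z < e] because the norm is a supremum. This slack is what the limit
    function needs, its smoothness being an infimum that no stage attains. *)
Lemma wseries_self_similar s A M b (e : R) (rho : nat -> nat) :
  admissible s A b -> 0 <= M -> e <= 1 ->
  (forall j, (wj0 w <= j)%N -> (0 < rho j)%N) ->
  (forall l k, `|b l k| <= M * decay s l) ->
  (forall j, (wj0 w < j)%N -> forall z, z < e -> exists l k,
    [/\ (j <= l <= rho j * j)%N, (k < 2 ^ l)%N & z * M * decay s l <= `|b l k|]) ->
  weakly_self_similar w e rho s M (wseries M b).
Proof.
move=> ab M0 e1 rho0 bM H; split; first exact: wseries_Cs_ball ab M0 bM.
have sf := wseries_square_integrable M ab.
move=> j jj; have [jE|jn] := eqVneq j (wj0 w).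
  rewrite {}jE in jj *; rewrite /Cs_norm le_max; apply/orP; left.
  apply: (@le_trans _ _ `|alpha w (wseries M b) 0|%:E).
    rewrite (wseries_alpha M ab) ?expn_gt0//= lee_fin ger0_norm//.
    by rewrite -[leRHS]mul1r ler_wpM2r.
  apply: ereal_sup_ubound; exists 0%N => /=; first by rewrite expn_gt0.
  by rewrite alpha_partial_sum// expn_gt0.
have jlt : (wj0 w < j)%N by rewrite ltn_neqAle eq_sym jn.
apply/lee_subgt0Pr => r r0.
have [z ze zM] : exists2 z, z < e & e * M - r <= z * M.
  have [->|Mn] := eqVneq M 0.
    by exists (e - 1); rewrite ?gtrBl// !mulr0 sub0r oppr_le0 ltW.
  have Mp : 0 < M by rewrite lt_neqAle eq_sym Mn.
  by exists (e - r / M); rewrite ?gtrBl ?divr_gt0// mulrBl divfK.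
have [l [k [/andP[jl lr] kl hb]]] := H j jlt z ze.
rewrite /Cs_norm le_max; apply/orP; right.
apply: (@le_trans _ _ (2 `^ (l%:R * (s + 2^-1)) *
   `|beta w (partial_sum w (wseries M b) j (rho j * j)%N) l k|)%:E).
  rewrite beta_partial_sum// (wseries_beta M ab)//; last exact: leq_trans jl.
  rewrite -EFinB lee_fin (le_trans zM)//.
  by rewrite -ler_pdivrMl ?powR_gt0// -powRN mulrC.
apply: ereal_sup_ubound; exists (l, k) => //=.
by split => //; exact: leq_trans jl.
Qed.

End WaveletSeries.

(** * The step of the construction *)

Section Numerics.
Context {R : realType}.

Lemma powR2_expR (x : R) : 2 `^ x = expR (x * ln 2).
Proof. by rewrite /powR pnatr_eq0. Qed.

Lemma ln2_gt0 : 0 < ln 2 :> R.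
Proof. by rewrite ln_gt0// ltr1n. Qed.

Lemma ln_le_id (y : R) : 0 < y -> ln y <= y.
Proof. by move=> y0; have := expR_ge1Dx (ln y); rewrite lnK//; lra. Qed.

Lemma linear_expR_le (a xi b : R) : 0 <= a -> 0 < xi -> 0 < b ->
  \forall L \near \oo, a * L%:R <= b * expR (L%:R * xi).
Proof.
move=> a0 xi0 b0; near=> L.
have LR : 4 * a / (b * xi ^+ 2) <= L%:R by near: L; exact: nbhs_infty_ger.
have L0 : 0 <= L%:R :> R by [].
have h1 : L%:R * xi / 2 <= expR (L%:R * xi / 2).
  by have := expR_ge1Dx (L%:R * xi / 2); lra.
have h2 : (L%:R * xi / 2) ^+ 2 <= expR (L%:R * xi).
  have -> : expR (L%:R * xi) = expR (L%:R * xi / 2) ^+ 2.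
    by rewrite expr2 -expRD; congr expR; lra.
  by rewrite lerXn2r// nnegrE ?expR_ge0// divr_ge0// mulr_ge0// ltW.
apply: (@le_trans _ _ (b * (L%:R * xi / 2) ^+ 2)); last by rewrite ler_pM2l.
move: LR; rewrite ler_pdivrMr ?mulr_gt0 ?exprn_gt0// => LR.
have -> : b * (L%:R * xi / 2) ^+ 2 = L%:R * (L%:R * (b * xi ^+ 2)) / 4 by field.
by rewrite ler_pdivlMr// (_ : a * L%:R * 4 = L%:R * (4 * a)); [exact: ler_wpM2l|ring].
Unshelve. all: end_near. Qed.

(* [n] is the largest sample size at which a bump of height [M * decay s' L] at
   one of the about [2 ^ L] positions of level [L] cannot be detected. *)
Lemma step_numerics (s0 smax s kap c M del T Cn : R) (N0 g : nat) :
  0 < s0 -> s0 < s -> s < smax -> 1 < kap -> 0 < M -> 0 < del -> 0 <= T -> 0 < Cn ->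
  2 * smax + 1 < 2 * g%:R * s0 ->
  exists r, (g <= r)%N /\ forall Lmin, exists L' n,
    let L := (r * L')%N in let s' := s - ln kap / (L'%:R * ln 2) in
    [/\ (Lmin <= L')%N /\ s0 < s', (N0 <= n)%N,
      n%:R * (M * decay s' L) ^+ 2 <= L%:R * ln 2 / 2,
      2 * (`|c| * rate s n) * (Cn * 2 `^ (- (L%:R / 2))) < M * decay s' L &
      n%:R * (T * (2 `^ (- s0)) ^+ (g * L)) ^+ 2 <= ln (1 + del ^+ 2)].
Proof.
move=> s00 s0s ssmax kap1 M0 del0 T0 Cn0 hg.
have lam0 := ln2_gt0; set lam : R := ln 2 in lam0.
have lk0 : 0 < ln kap by rewrite ln_gt0.
have s_gt0 : 0 < s by exact: lt_trans s0s.
(* Solving the detection bound for the sample size gives [a L 2^(L (2 s' + 1))]. Then [ln n <= A L],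
   and [n / ln n] is at least [c1 2^(L (2 s' + 1))]. *)
pose a : R := lam / (2 * M ^+ 2).
have a0 : 0 < a by rewrite divr_gt0// mulr_gt0// exprn_gt0.
pose A : R := a + (2 * smax + 1) * lam.
have A0 : 0 < A by rewrite addr_gt0// mulr_gt0// addr_gt0// mulr_gt0//; lra.
pose c1 : R := a / (2 * A).
have c10 : 0 < c1 by rewrite divr_gt0// mulr_gt0.
pose t : R := s / (2 * s + 1).
have s21 : 0 < 2 * s + 1 by lra.
have t0 : 0 < t by rewrite divr_gt0.
(* The bump beats the rate as soon as [G < 2^(L (s - s') / (2 s + 1))]. Since
   [L (s - s') ln 2 = r ln kap], the right-hand side does not involve [L'], so [r] can be fixed
   before [L'] is chosen. *)
pose G : R := 2 * `|c| * Cn * c1 `^ (- t) / M.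
have [r0 r0G] : exists r0 : nat, G < r0%:R * ln kap / (2 * s + 1).
  have lks : 0 < ln kap / (2 * s + 1) by rewrite divr_gt0.
  exists (Num.truncn (G / (ln kap / (2 * s + 1)))).+1.
  by rewrite -mulrA -ltr_pdivrMr// truncnS_gt.
pose r := (maxn 1 (maxn g r0)).
have rG : G < r%:R * ln kap / (2 * s + 1).
  apply: (lt_le_trans r0G); rewrite ler_pM2r ?invr_gt0// ler_pM2r// ler_nat.
  by rewrite /r !leq_max leqnn ?orbT.
have r1 : (0 < r)%N by rewrite /r !leq_max leqnn ?orbT.
exists r; split; first by rewrite /r !leq_max leqnn ?orbT.
move=> Lmin.
have xi0 : 0 < (2 * g%:R * s0 - (2 * smax + 1)) * lam by rewrite mulr_gt0// subr_gt0.
have b0 : 0 < ln (1 + del ^+ 2) by rewrite ln_gt0// ltrDl exprn_gt0.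
have aT0 : 0 <= a * T ^+ 2 by rewrite mulr_ge0 ?sqr_ge0 ?ltW.
have [L1 _ HL1] := linear_expR_le aT0 xi0 b0.
near \oo => L'.
pose L := (r * L')%N; pose s' := s - ln kap / (L'%:R * lam).
have LL' : (L' <= L)%N by rewrite /L leq_pmull.
have L'0 : (0 < L')%N by near: L'; exists 1%N.
have L'R : 0 < L'%:R :> R by rewrite ltr0n.
have LR : 1 <= L%:R :> R by rewrite ler1n (leq_trans L'0).
have s's : s' < s by rewrite /s' gtrBl divr_gt0// mulr_gt0.
have s0s' : s0 < s'.
  have : ln kap / ((s - s0) * lam) < L'%:R by near: L'; exact: nbhs_infty_gtr.
  rewrite ltr_pdivrMr ?mulr_gt0 ?subr_gt0// => h.
  have : ln kap / (L'%:R * lam) < s - s0.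
    by rewrite ltr_pdivrMr ?mulr_gt0// mulrCA.
  by rewrite /s'; lra.
(* The real sample size at which the detection bound is an equality; [n] is its integer part. *)
pose x0 : R := a * L%:R * 2 `^ (L%:R * (2 * s' + 1)).
have p1 : 1 <= 2 `^ (L%:R * (2 * s' + 1)) :> R.
  have s2 : 0 <= 2 * s' + 1 by lra.
  by rewrite powR2_expR -[leLHS]expR0 ler_expR !mulr_ge0// ltW.
have x0L : a * L%:R <= x0.
  by rewrite /x0 -[leLHS]mulr1 ler_wpM2l// mulr_ge0// ltW.
(* This makes [n] at least [x0 / 2], [N0] and 3; in particular [ln n] is positive. *)
have xbig : 2 * (N0%:R + 3) <= a * L%:R.
  have : 2 * (N0%:R + 3) / a <= L'%:R by near: L'; exact: nbhs_infty_ger.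
  rewrite ler_pdivrMr// => h.
  apply: (@le_trans _ _ (a * L'%:R)); last by rewrite ler_pM2l// ler_nat.
  by rewrite [a * _]mulrC.
have x03 : 2 * (N0%:R + 3) <= x0 by exact: le_trans x0L.
have N00 : 0 <= N0%:R :> R by [].
have x0p : 0 < x0 by lra.
pose n := Num.truncn x0.
have /andP[nx0 nx1] : n%:R <= x0 < n.+1%:R by apply: truncn_itv; exact: ltW.
rewrite -natr1 in nx1.
have n2 : x0 / 2 <= n%:R by lra.
have n3 : 3 <= n%:R :> R by lra.
have E2 : (M * decay s' L) ^+ 2 * x0 = L%:R * lam / 2.
  have -> : (M * decay s' L) ^+ 2 * x0 = a * M ^+ 2 * L%:R *
      (decay s' L ^+ 2 * 2 `^ (L%:R * (2 * s' + 1))) by rewrite /x0; ring.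
  have -> : decay s' L ^+ 2 * 2 `^ (L%:R * (2 * s' + 1)) = 1.
    by rewrite /decay !powR2_expR expr2 -!expRD -[RHS]expR0; congr expR; field.
  by rewrite /a; field; rewrite gt_eqF.
exists L', n; split.
- by split => //; near: L'; exists Lmin.
- by rewrite -(ler_nat R); lra.
- rewrite -E2 mulrC ler_wpM2l ?sqr_ge0//.
- have lnn : 0 < ln (n%:R : R) by rewrite ln_gt0//; lra.
  have lnA : ln (n%:R : R) <= A * L%:R.
    apply: (@le_trans _ _ (ln x0)).
      by rewrite ler_ln ?posrE//; lra.
    have -> : ln x0 = ln (a * L%:R) + L%:R * (2 * s' + 1) * lam.
      rewrite /x0 lnM ?posrE ?powR_gt0//; last by rewrite mulr_gt0//; lra.
      by rewrite ln_powR.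
    have -> : A * L%:R = a * L%:R + L%:R * ((2 * smax + 1) * lam) by rewrite /A; ring.
    apply: lerD.
      by apply: ln_le_id; rewrite mulr_gt0//; lra.
    rewrite -mulrA ler_wpM2l// ler_wpM2r ?ltW//; lra.
  have nln : c1 * 2 `^ (L%:R * (2 * s' + 1)) <= n%:R / ln n%:R.
    rewrite ler_pdivlMr//.
    apply: (@le_trans _ _ (c1 * 2 `^ (L%:R * (2 * s' + 1)) * (A * L%:R))).
      by rewrite ler_wpM2l// mulr_ge0 ?powR_ge0// ltW.
    apply: le_trans n2; rewrite le_eqVlt; apply/orP; left; apply/eqP.
    by rewrite /c1 /x0; field; rewrite gt_eqF.
  have rate_le : rate s n <= c1 `^ (- t) * 2 `^ (- (L%:R * (2 * s' + 1) * t)).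
    rewrite /rate (_ : - s / (2 * s + 1) = - t); last by rewrite /t mulNr.
    rewrite [_ `^ (- t)]powRN.
    have -> : c1 `^ (- t) * 2 `^ (- (L%:R * (2 * s' + 1) * t)) =
        ((c1 * 2 `^ (L%:R * (2 * s' + 1))) `^ t)^-1.
      rewrite powRM ?powR_ge0// ?ltW// invfM -powRN; congr (_ * _).
      by rewrite -powRrM powRN.
    have y0 : 0 < n%:R / ln n%:R :> R by rewrite divr_gt0//; lra.
    have z0 : 0 < c1 * 2 `^ (L%:R * (2 * s' + 1)) by rewrite mulr_gt0 ?powR_gt0.
    rewrite lef_pV2 ?posrE; [|exact: powR_gt0|exact: powR_gt0].
    by apply: ge0_ler_powR => //; rewrite ?nnegrE ltW.
  have KEY : 2 * `|c| * Cn * c1 `^ (- t) < M * 2 `^ (L%:R * (s - s') / (2 * s + 1)).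
    rewrite -ltr_pdivrMl// [M^-1 * _]mulrC -/G.
    apply: (lt_le_trans rG); rewrite powR2_expR.
    have -> : L%:R * (s - s') / (2 * s + 1) * ln 2 = r%:R * ln kap / (2 * s + 1).
      rewrite -/lam /s' /L natrM; field.
      by rewrite !gt_eqF.
    by have := expR_ge1Dx (r%:R * ln kap / (2 * s + 1)); lra.
  apply: (@le_lt_trans _ _ (2 * (`|c| * (c1 `^ (- t) *
      2 `^ (- (L%:R * (2 * s' + 1) * t)))) * (Cn * 2 `^ (- (L%:R / 2))))).
    apply: ler_wpM2r; first by rewrite mulr_ge0 ?powR_ge0// ltW.
    by rewrite ler_pM2l// ler_wpM2l.
  have -> : 2 * (`|c| * (c1 `^ (- t) * 2 `^ (- (L%:R * (2 * s' + 1) * t)))) *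
      (Cn * 2 `^ (- (L%:R / 2))) = (2 * `|c| * Cn * c1 `^ (- t)) *
      (2 `^ (- (L%:R * (2 * s' + 1) * t)) * 2 `^ (- (L%:R / 2))) by ring.
  have -> : M * decay s' L = M * 2 `^ (L%:R * (s - s') / (2 * s + 1)) *
      (2 `^ (- (L%:R * (2 * s' + 1) * t)) * 2 `^ (- (L%:R / 2))).
    rewrite -mulrA; congr (_ * _); rewrite /decay !powR2_expR -!expRD; congr expR.
    by rewrite /t; field; rewrite gt_eqF.
  by rewrite ltr_pM2r// mulr_gt0// powR_gt0.
(* The sample size is at most of order [L 2^(L (2 smax + 1))] and the squared change is of order
   [2^(-2 g L s0)]; the condition on [g] leaves an exponential margin that absorbs the factor
   [L]. *)
- have hL : a * T ^+ 2 * L%:R <=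
    ln (1 + del ^+ 2) * expR (L%:R * ((2 * g%:R * s0 - (2 * smax + 1)) * lam)).
    apply: HL1 => /=; apply: leq_trans LL'; near: L'; by exists L1.
  apply: (@le_trans _ _ (x0 * (T * (2 `^ (- s0)) ^+ (g * L)) ^+ 2)).
    by rewrite ler_wpM2r// sqr_ge0.
  have -> : (2 `^ (- s0)) ^+ (g * L) = expR (- (g%:R * L%:R * s0 * lam)) :> R.
    rewrite -powR_mulrn ?powR_ge0// -powRrM powR2_expR natrM; congr expR.
    by rewrite -/lam; ring.
  apply: (@le_trans _ _ (a * T ^+ 2 * L%:R *
     expR (- (L%:R * ((2 * g%:R * s0 - (2 * smax + 1)) * lam))))).
    rewrite (_ : x0 * _ = a * T ^+ 2 * L%:R * (2 `^ (L%:R * (2 * s' + 1)) *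
       expR (- (g%:R * L%:R * s0 * lam)) ^+ 2)); last by rewrite /x0; ring.
    apply: ler_wpM2l; first by rewrite mulr_ge0.
    rewrite powR2_expR expr2 -!expRD ler_expR -/lam.
    have : L%:R * lam * (2 * s' + 1) <= L%:R * lam * (2 * smax + 1).
      by rewrite ler_wpM2l ?mulr_ge0 ?ltW//; lra.
    lra.
  rewrite expRN ler_pdivrMr ?expR_gt0//.
Unshelve. all: end_near. Qed.

End Numerics.

(** * Alternatives that the data cannot detect *)

Section Indistinguishability.
Context {R : realType}.
Local Notation mu := (@lebesgue_measure R).
Local Notation I01 := (`[0 : R, 1]%classic : set R).
Local Notation integrable01 f := (mu.-integrable I01 (EFin \o f)).
Context (w : wavelet_system R).
Hypothesis hw : cdv_system w.
Context d (T : measurableType d) (P : probability T R) (B : R -> T -> R).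
Hypothesis hB : brownian_motion P B.

Lemma law_fin_num (f : R -> R) n A : integrable01 f -> data_event A ->
  law P B f n A \is a fin_num.
Proof.
move=> fi dA; rewrite ge0_fin_numE; last exact: measure_ge0.
apply: le_lt_trans (ltry 1); apply: probability_le1.
exact: (measurable_law hB n fi dA).
Qed.

(** A mixture with a single component: the energy of the change is at most [tau^2], so the second
    moment of the likelihood ratio is at most [expR (n tau^2) <= 1 + e^2]. *)
Lemma law_small_change (f g : R -> R) (n : nat) (tau e : R) A :
  (0 < n)%N -> 0 < e -> integrable01 f ->
  square_integrable I01 (fun x => g x - f x) ->
  (forall x, I01 x -> `|g x - f x| <= tau) ->
  n%:R * tau ^+ 2 <= ln (1 + e ^+ 2) -> data_event A ->
  (law P B g n A <= law P B f n A + e%:E)%E.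
Proof.
move=> n0 e0 fi sh hb htau dA; set h := (fun x => g x - f x) in sh hb.
have e21 : 0 < 1 + e ^+ 2 by rewrite addr_gt0// exprn_gt0.
have hh : inner I01 h h <= tau ^+ 2.
  have tau0 : 0 <= tau.
    have := hb 0; rewrite /= in_itv/= lexx ler01 => /(_ isT); exact: le_trans.
  have s1 : square_integrable I01 (fun=> 1).
    by apply: (@bounded_square_integrable01 R _ 1) => // x _; rewrite normr1.
  have -> : inner I01 h h = inner I01 (fun x => h x * h x) (fun=> 1).
    by apply: eq_Rintegral => x _; rewrite mulr1.
  apply: le_trans (ler_norm _) _.
  have -> : tau ^+ 2 = tau ^+ 2 * \int[mu]_(x in I01) `|1 : R|.
    rewrite (eq_Rintegral _ (g := fun=> 1)); last by move=> x _; rewrite normr1.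
    rewrite Rintegral_cst// mul1r.
    by rewrite -[X in _ * X]/(fine (mu I01)) mu01 mulr1.
  have bd x : I01 x -> `|h x * h x| <= tau ^+ 2.
    by move=> xI; rewrite normrM expr2 ler_pM// hb.
  apply: le_inner01 => //; apply: (@bounded_square_integrable01 R _ (tau ^+ 2)) => //.
  have [mh _] := sh; exact: measurable_funM.
have := @law_mixture_bound R d T P B hB unit f (fun=> h) n 0 e A.
rewrite card_unit !big_const card_unit /= invr1 mul1e adde0.
rewrite (_ : (f \+ h)%R = g); last by apply/funext => x /=; rewrite /h addrC subrK.
apply => //; first by move=> _; exact: square_integrable01_int.
move=> p _; rewrite !big_const card_unit /= !addr0 expr1n mulr1.
rewrite -[leRHS]lnK ?posrE// ler_expR (le_trans _ htau)//.
by rewrite ler_wpM2l// (le_trans (energy_le p sh)).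
Qed.

(** Twice the half-width [2 K + 1] outside which the continuous wavelet is known to vanish. *)
Definition bump_spacing : nat := (4 * wK w + 2)%N.

Definition bump_count (L : nat) : nat := ((2 ^ L - (wN w).*2).-1 %/ bump_spacing)%N.

(** The successor keeps every position strictly to the right of [wN w], the index reserved for the
    rough tail. *)
Definition bump_pos (q : nat) : nat := (wN w + bump_spacing * q.+1)%N.

Lemma bump_pos_interior L q : (q < bump_count L)%N -> interior_index w L (bump_pos q).
Proof.
move=> qQ; rewrite /interior_index /bump_pos leq_addr /=.
have h : (bump_spacing * q.+1 <= (2 ^ L - (wN w).*2).-1)%N.
  apply: leq_trans (leq_divM _ bump_spacing).
  by rewrite mulnC leq_mul2r qQ orbT.
have s0 : (0 < bump_spacing)%N by rewrite /bump_spacing addn2.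
have s1 : (0 < bump_spacing * q.+1)%N by rewrite muln_gt0 s0.
move: h s1; move: (bump_spacing * q.+1)%N (2 ^ L)%N => u v; lia.
Qed.

Lemma bump_pos_gt q : (wN w < bump_pos q)%N.
Proof. by rewrite /bump_pos -[X in (X < _)%N]addn0 ltn_add2l muln_gt0 /bump_spacing addn2. Qed.

Lemma cpsi_cell_eq0 L m k i : (i < 2 ^ (L + m))%N ->
  (i.+1 + 2 ^ m * (2 * wK w).+1 <= 2 ^ m * k)%N \/
  (2 ^ m * (k + (2 * wK w).+1) <= i)%N ->
  cell (cpsi w L k) (L + m) i = 0.
Proof.
move=> ip H; apply: cell_eq0 => //.
  by apply: square_integrable01_int; exact: cpsi_square_integrable.
move=> x /andP[x1 x2]; apply: cpsi_eq0 => //.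
have Lp : 0 < (2 ^+ L : R) by rewrite exprn_gt0.
have mp : 0 < (2 ^+ m : R) by rewrite exprn_gt0.
rewrite /dyad exprD ler_pdivrMr ?mulr_gt0// in x1.
rewrite /dyad exprD ler_pdivlMr ?mulr_gt0// in x2.
set y := 2 ^+ L * x; set M := 2 ^+ m : R in mp x1 x2.
have y1 : i%:R <= M * y by rewrite /y (_ : M * _ = x * (2 ^+ L * M)) ?x1//; ring.
have y2 : M * y <= i.+1%:R by rewrite /y (_ : M * _ = x * (2 ^+ L * M)) ?x2//; ring.
rewrite natr1 ler_normr; apply/orP; case: H => H.
- right; have : M * (y + (2 * wK w).+1%:R) <= M * k%:R.
    by move: H; rewrite -(ler_nat R) natrD !natrM natrX -/M; lra.
  by rewrite ler_pM2l//; lra.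
- left; have : M * (k%:R + (2 * wK w).+1%:R) <= M * y.
    by move: H; rewrite -(ler_nat R) natrM natrX natrD -/M; lra.
  by rewrite ler_pM2l//; lra.
Qed.

(** The supports overlap at most in an end point, and their end points are multiples of [2^-L]. A
    cell of a grid of level at least [L] therefore meets the interior of at most one of them. *)
Lemma bump_energy_eq0 L m c q q' : (q < q')%N ->
  energy (L + m) (fun x => c * cpsi w L (bump_pos q) x)
                 (fun x => c * cpsi w L (bump_pos q') x) = 0.
Proof.
move=> qq'; have ci k : integrable01 (cpsi w L k).
  by apply: square_integrable01_int; exact: cpsi_square_integrable.
have cz k i : (i < 2 ^ (L + m))%N -> cell (cpsi w L k) (L + m) i = 0 ->
    cell (fun x => c * cpsi w L k x) (L + m) i = 0.
  move=> ip h; rewrite cellE//; last exact: integrableMz.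
  rewrite RintegralZl//; last by apply: integrableS (ci k) => //; exact: dyad_cell_sub.
  by rewrite -cellE// h mulr0.
apply: energy_eq0 => i ip.
have [h|h] := leqP (2 ^ m * (bump_pos q + (2 * wK w).+1)) i.
  by left; apply: cz => //; apply: cpsi_cell_eq0 => //; right.
right; apply: cz => //; apply: cpsi_cell_eq0 => //; left.
apply: (@leq_trans (2 ^ m * (bump_pos q + (2 * wK w).+1) + 2 ^ m * (2 * wK w).+1)).
  by rewrite leq_add2r.
rewrite -mulnDr leq_mul2l; apply/orP; right.
rewrite /bump_pos.
have : (bump_spacing * q.+1 + bump_spacing <= bump_spacing * q'.+1)%N.
  by rewrite -mulnSr leq_mul2l ltnS qq' orbT.
rewrite {2}/bump_spacing; lia.
Qed.

(** In the chi-square sum each diagonal term is at most [e^2] times the number of positions, and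
    disjointness of the bumps makes all other terms equal to 1. Since the bound holds on average
    over the positions, it holds for one of them. *)
Lemma bump_exists (f : R -> R) (L n : nat) (c e : R) A :
  (wj0 w <= L)%N -> (0 < n)%N -> 0 < e -> integrable01 f -> (0 < bump_count L)%N ->
  expR (n%:R * c ^+ 2) <= e ^+ 2 * (bump_count L)%:R -> data_event A ->
  exists2 k, interior_index w L k && (wN w < k)%N &
    (law P B (fun x => f x + c * cpsi w L k x)%R n A <= law P B f n A + e%:E)%E.
Proof.
move=> jL n0 e0 fi Q0 chi dA; set Q := bump_count L in Q0 chi.
have ci k : integrable01 (fun x => c * cpsi w L k x).
  apply: integrableMz => //; apply: square_integrable01_int.
  exact: cpsi_square_integrable.
pose h (q : 'I_Q) (x : R) : R := c * cpsi w L (bump_pos q) x.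
have hi q : integrable01 (f \+ h q).
  exact: (integrableDz (measurable_itv _) fi (ci _)).
have := @law_mixture_bound R d T P B hB 'I_Q f h n L e A.
rewrite card_ord => /(_ Q0 n0 e0 fi (fun q => ci _)) H.
have {}H : ((Q%:R^-1)%:E * \sum_(q < Q) law P B (f \+ h q)%R n A <=
    law P B f n A + e%:E)%E.
  apply: H => // p Lp.
  have diag (q : 'I_Q) : expR (n%:R * energy p (h q) (h q)) <= e ^+ 2 * Q%:R.
    apply: le_trans chi; rewrite ler_expR ler_wpM2l//.
    have sc := cpsi_square_integrable hw L (bump_pos q).
    have sh : square_integrable I01 (h q) by exact: square_integrableZ.
    apply: le_trans (energy_le p sh) _.
    rewrite /h innerZl// innerC innerZl// inner_cpsi_self//; last exact: bump_pos_interior.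
    by rewrite mulr1 expr2.
  have off (q q' : 'I_Q) : q != q' -> energy p (h q) (h q') = 0.
    rewrite -(subnKC Lp) neq_ltn => /orP[]qq'; first exact: bump_energy_eq0.
    rewrite -[RHS](bump_energy_eq0 L (p - L) c qq') /energy; congr (_ * _).
    by apply: eq_bigr => i _; rewrite mulrC.
  apply: (@le_trans _ _ (\sum_(q < Q) (e ^+ 2 * Q%:R + Q%:R))).
    apply: ler_sum => q _; rewrite (bigD1 q)//=; apply: lerD; first exact: diag.
    rewrite (eq_bigr (fun=> 1)); last first.
      by move=> q' qq'; rewrite off 1?eq_sym// mulr0 expR0.
    rewrite sumr_const ler_nat; apply: leq_trans (max_card _) _.
    by rewrite card_ord.
  rewrite sumr_const card_ord -[leLHS]mulr_natl le_eqVlt; apply/orP; left; apply/eqP.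
  by ring.
have [v vE] : exists v : R, (law P B f n A + e%:E)%E = v%:E.
  by exists (fine (law P B f n A) + e); rewrite EFinD fineK// law_fin_num.
rewrite vE in H *.
pose y q := fine (law P B (f \+ h q)%R n A).
have yE q : law P B (f \+ h q)%R n A = (y q)%:E by rewrite /y fineK// law_fin_num.
apply: contrapT => no.
have vy q : v < y q.
  rewrite ltNge; apply/negP => yv; apply: no; exists (bump_pos q).
    by rewrite bump_pos_interior// bump_pos_gt.
  by rewrite -[X in (X <= _)%E]/(law P B (f \+ h q)%R n A) yE lee_fin.
have QR : 0 < Q%:R :> R by rewrite ltr0n.
move: H; rewrite (eq_bigr (fun q => (y q)%:E)); last by move=> q _; exact: yE.
rewrite sumEFin -EFinM lee_fin ler_pdivrMl//.
apply/negP; rewrite -ltNge.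
have -> : Q%:R * v = \sum_(q < Q) v by rewrite sumr_const card_ord mulr_natl.
by apply: ltr_sum => //; apply/hasP; exists (Ordinal Q0); rewrite ?mem_index_enum.
Qed.

End Indistinguishability.

(** * Coefficients of the successive stages *)

Section StepCoefficients.
Context {R : realType}.
Context (w : wavelet_system R) (rho : nat -> nat) (M s0 smax : R).
Hypothesis hN0 : ((wN w).*2 <= 2 ^ wj0 w)%N.
Hypothesis rho_gt0 : forall j, (wj0 w <= j)%N -> (0 < rho j)%N.
Hypothesis M0 : 0 < M.
Hypothesis s00 : 0 < s0.
Implicit Types (b : nat -> nat -> R) (s eta : R) (J : nat).

(* The stages of the construction: coefficients of smoothness [s], self-similar
   with margin [eta], and equal to those of a fixed rough function from level
   [J] on. *)
Definition stage s eta J b : Prop :=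
  [/\ s0 < s < smax /\ interior_supported w b,
      forall l, \sum_(k < 2 ^ l) `|b l k| <= 2 * M * decay s l,
      forall l k, `|b l k| <= M * decay s l,
      (wj0 w < J)%N /\
      forall l k, (J <= l)%N -> b l k = if k == wN w then M * decay s l else 0 &
      forall j, (wj0 w < j)%N -> exists l k,
        [/\ (j <= l <= rho j * j)%N, (l <= maxn j J)%N, (k < 2 ^ l)%N &
            eta * M * decay s l <= `|b l k|]].

Lemma decay_le s s' l : s' <= s -> decay s l <= decay s' l :> R.
Proof.
move=> ss; rewrite /decay ler_powR ?ler1n// lerN2 ler_wpM2l//.
by rewrite lerD2r.
Qed.

Lemma interior_edge l : (wj0 w < l)%N -> interior_index w l (wN w).
Proof.
move=> jl; rewrite /interior_index leqnn /= ltn_subRL addnn.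
by apply: leq_ltn_trans hN0 _; rewrite ltn_exp2l.
Qed.

Lemma sum_single (n k0 : nat) (v : R) :
  \sum_(k < n) `|if (k : nat) == k0 then v else 0| <= `|v|.
Proof.
have [kn|kn] := ltnP k0 n.
  rewrite (bigD1 (Ordinal kn))//= eqxx big1 ?addr0// => k kk.
  by rewrite (negbTE (_ : val k != k0))// normr0.
rewrite big1 ?normr_ge0// => k _.
have [kk|_] := eqVneq (k : nat) k0; last by rewrite normr0.
by have := ltn_ord k; rewrite kk ltnNge kn.
Qed.

Lemma stage_admissible s eta J b : stage s eta J b ->
  admissible w s (2 * M) b.
Proof.
by move=> [[/andP[s0s _] sb] b1 _ _ _]; split => //; exact: lt_trans s0s.
Qed.

Definition add_bump b L k0 (c : R) (l k : nat) : R :=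
  b l k + (if (l == L) && (k == k0) then c else 0).

(** The function with coefficients [add_bump] keeps the old tail and is the one that the mixture
    argument compares with the current function. Resetting the tail from level [J'] on is a separate
    change, small in sup norm. *)
Definition next_coefs b L k0 (c s' : R) J' (l k : nat) : R :=
  if (l < J')%N then add_bump b L k0 c l k
  else if k == wN w then M * decay s' l else 0.

(** Witnesses by range of [j]: the old one up to [L'], the bump up to [L], the first level [g * L]
    of the new tail for [L < j < g * L] (in the window as [g <= rho j]), and level [j] itself
    afterwards. *)
Lemma next_stage s eta eta' J b (r g L' k0 : nat) :
  let L := (r * L')%N in
  let s' := s - ln (eta / eta') / (L'%:R * ln 2) in
  stage s eta J b -> 0 < eta' -> eta' < eta -> eta <= 1 -> s0 < s' ->
  (1 < g)%N -> (g <= r)%N -> (J <= L')%N ->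
  (forall j, (L' <= j)%N -> (r <= rho j)%N) ->
  interior_index w L k0 -> (wN w < k0)%N ->
  stage s' eta' (g * L) (next_coefs b L k0 (M * decay s' L) s' (g * L)) /\
  admissible w s' (2 * M) (add_bump b L k0 (M * decay s' L)).
Proof.
move=> L s' [[/andP[s0s ssmax] sb] b1 bM [jJ bD] bW] e'0 e'e e1 s0s' g1 gr JL' rhor ik Nk0.
have L'0 : (0 < L')%N by apply: leq_trans JL'; exact: leq_ltn_trans jJ.
have r1 : (1 < r)%N by exact: leq_trans gr.
have L'L : (L' < L)%N by rewrite /L ltn_Pmull.
have JL : (J <= L)%N by exact: leq_trans JL' (ltnW L'L).
have L0 : (0 < L)%N by exact: leq_ltn_trans L'L.
have LgL : (L < g * L)%N by rewrite ltn_Pmull.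
have jL : (wj0 w < L)%N by exact: leq_trans JL.
have kap1 : 1 < eta / eta' by rewrite ltr_pdivlMr// mul1r.
have ln20 := @ln2_gt0 R.
have L'R : 0 < L'%:R :> R by rewrite ltr0n.
have s's : s' < s by rewrite /s' gtrBl divr_gt0 ?ln_gt0// mulr_gt0.
have dss l : decay s l <= decay s' l :> R by exact/decay_le/ltW.
have Md l : 0 < M * decay s' l by rewrite mulr_gt0// decay_gt0.
have k0N : (k0 == wN w) = false by apply/negbTE; rewrite neq_ltn Nk0 orbT.
have a1 l : \sum_(k < 2 ^ l) `|add_bump b L k0 (M * decay s' L) l k| <= 2 * M * decay s' l.
  have [->|lL] := eqVneq l L; last first.
    apply: (@le_trans _ _ (2 * M * decay s l)).
      apply: le_trans (b1 l); apply: ler_sum => k _.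
      by rewrite /add_bump (negbTE lL) /= addr0.
    by rewrite ler_wpM2l// mulr_ge0// ltW.
  (* Level [L] carries both the old tail at [wN w] and the bump at [k0]; this accounts for the
     factor 2 in [2 * M]. *)
  apply: (@le_trans _ _ (\sum_(k < 2 ^ L) (`|if (k : nat) == wN w then M * decay s L else 0| +
     `|if (k : nat) == k0 then M * decay s' L else 0|))).
    by apply: ler_sum => k _; rewrite /add_bump eqxx /= bD//; exact: ler_normD.
  rewrite big_split /=; apply: le_trans (lerD (sum_single _ _ _) (sum_single _ _ _)) _.
  have p1 : 0 <= M * decay s L by rewrite ltW// mulr_gt0// decay_gt0.
  rewrite (ger0_norm p1) (ger0_norm (ltW (Md L))).
  have : M * decay s L <= M * decay s' L by rewrite ler_pM2l.
  by lra.
have asup : interior_supported w (add_bump b L k0 (M * decay s' L)).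
  move=> l k; rewrite /add_bump; case: ifPn => [/andP[/eqP-> /eqP->] _|_].
    by rewrite jL ik.
  by rewrite addr0; exact: sb.
split; last by split => //; exact: lt_trans s0s'.
split.
- split; first by rewrite s0s' (lt_trans s's).
  move=> l k; rewrite /next_coefs; case: ltnP => lJ; first exact: asup.
  have [->|_] := eqVneq k (wN w); last by rewrite eqxx.
  have jl : (wj0 w < l)%N by apply: leq_trans lJ; exact: ltn_trans jL LgL.
  by move=> _; rewrite jl interior_edge.
- move=> l; rewrite /next_coefs; case: ltnP => lJ; first exact: a1.
  apply: le_trans (sum_single _ _ _) _; rewrite (ger0_norm (ltW (Md _))).
  by rewrite -mulrA; have := Md l; lra.
- move=> l k; rewrite /next_coefs; case: ltnP => lJ; last first.
    by case: eqP => _; [rewrite (ger0_norm (ltW (Md _)))|rewrite normr0 ltW].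
  rewrite /add_bump; case: ifPn => [/andP[/eqP-> /eqP->]|_].
    by rewrite bD// k0N add0r ger0_norm ?(ltW (Md _)).
  by rewrite addr0 (le_trans (bM l k))// ler_pM2l.
- split; first exact: ltn_trans jL LgL.
  by move=> l k lJ; rewrite /next_coefs ltnNge lJ.
move=> j jj.
have [jL'|L'j] := leqP j L'.
  have [l [k [/andP[jl lr] lJ kl hb]]] := bW j jj.
  (* This uses the clause [l <= maxn j J] of [stage]: the old witness sits below the bump, and its
     loss [2^(l (s - s'))] is at most [2^(L' (s - s')) = eta / eta']. *)
  have lL' : (l <= L')%N by apply: leq_trans lJ _; rewrite geq_max jL' JL'.
  have lL : (l < L)%N by exact: leq_ltn_trans L'L.
  have lgL : (l < g * L)%N by exact: ltn_trans LgL.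
  exists l, k; split => //; first by rewrite jl lr.
    by rewrite leq_max (ltnW lgL) orbT.
  rewrite /next_coefs lgL /add_bump (ltn_eqF lL) /= addr0.
  apply: le_trans hb; rewrite mulrAC [leRHS]mulrAC ler_pM2r//.
  have -> : decay s' l = decay s l * 2 `^ (l%:R * (s - s')) :> R.
    rewrite /decay !powR2_expR -expRD; congr expR; ring.
  have h : 2 `^ (l%:R * (s - s')) <= eta / eta' :> R.
    rewrite powR2_expR -[leRHS]lnK ?posrE; last exact: lt_trans kap1.
    have ds : (s - s') * ln 2 = ln (eta / eta') / L'%:R.
      by rewrite /s'; field; rewrite !gt_eqF.
    rewrite ler_expR -mulrA ds mulrA ler_pdivrMr// mulrC.
    by rewrite ler_pM2l ?ln_gt0// ler_nat.
  rewrite mulrCA [leRHS]mulrC ler_pM2l ?decay_gt0//.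
  by rewrite mulrC -ler_pdivlMr.
have rj : (r <= rho j)%N by apply: rhor; exact: ltnW.
have e'1 : eta' <= 1 by rewrite ltW// (lt_le_trans e'e).
have [jLe|Lj] := leqP j L.
  exists L, k0; split.
  - by rewrite jLe /L leq_mul// ltnW.
  - by rewrite leq_max (ltnW LgL) orbT.
  - exact: interior_lt ik.
  rewrite /next_coefs LgL /add_bump !eqxx /= bD// k0N add0r (ger0_norm (ltW (Md _))).
  by rewrite -mulrA ger_pMl.
have [jg|gj] := ltnP j (g * L).
  exists (g * L)%N, (wN w); split.
  - by rewrite (ltnW jg) leq_mul// ?(leq_trans gr)// ltnW.
  - by [].
  - by apply: interior_lt; apply: interior_edge; exact: ltn_trans LgL.
  rewrite /next_coefs ltnn eqxx (ger0_norm (ltW (Md _))).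
  by rewrite -mulrA ger_pMl.
exists j, (wN w); split.
- by rewrite leqnn leq_pmull// rho_gt0// ltnW.
- by [].
- by apply: interior_lt; apply: interior_edge.
rewrite /next_coefs ltnNge gj /= eqxx (ger0_norm (ltW (Md _))).
by rewrite -mulrA ger_pMl.
Qed.

(** The detection bound yields diagonal chi-square terms of size at most [2^(L/2)], while the number
    of positions is of order [2^L]. *)
Lemma bump_count_large (e : R) : 0 < e ->
  \forall L \near \oo, 2 `^ (L%:R / 2) <= e * (bump_count w L)%:R.
Proof.
move=> e0; pose D : R := (bump_spacing w)%:R.
have D0 : 0 < D by rewrite ltr0n /bump_spacing addn2.
have ln20 := @ln2_gt0 R.
pose E : R := (wN w).*2%:R + 1 + D.
have E0 : 0 < E by rewrite /E; have : 0 <= (wN w).*2%:R :> R by []; lra.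
near=> L.
pose u : R := 2 `^ (L%:R / 2).
have uL : L%:R * ln 2 / 2 <= u.
  rewrite /u powR2_expR [L%:R / 2 * _]mulrAC.
  by apply: le_trans (expR_ge1Dx _); rewrite lerDr.
have h1 : (2 * E + 1) * 2 / ln 2 <= L%:R by near: L; exact: nbhs_infty_ger.
have h2 : (2 * D / e) * 2 / ln 2 <= L%:R by near: L; exact: nbhs_infty_ger.
have u1 : 2 * E + 1 <= u by rewrite ler_pdivrMr// in h1; lra.
have u2 : 2 * D / e <= u by rewrite ler_pdivrMr// in h2; lra.
have uu : u ^+ 2 = (2 ^ L)%:R.
  by rewrite natrX /u; have := powR_half_sqr (R := R) L; rewrite -exprnP -pmulrn.
have Q : (2 ^ L)%:R <= D * (bump_count w L)%:R + E.
  have bs0 : (0 < bump_spacing w)%N by rewrite /bump_spacing addn2.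
  have hm := ltn_pmod (2 ^ L - (wN w).*2).-1 bs0.
  have hq : (2 ^ L - (wN w).*2).-1 = (bump_count w L * bump_spacing w +
    (2 ^ L - (wN w).*2).-1 %% bump_spacing w)%N := divn_eq _ _.
  have : (2 ^ L <= bump_count w L * bump_spacing w + ((wN w).*2 + 1 + bump_spacing w))%N.
    move: hm hq; move: ((2 ^ L - (wN w).*2).-1 %% bump_spacing w)%N.
    move: (bump_count w L * bump_spacing w)%N (2 ^ L)%N => y z x; clear; lia.
  rewrite /E /D; move: (bump_spacing w) (bump_count w L) (wN w).*2 => x y z.
  by rewrite -(ler_nat R) !natrD natrM [x%:R * _]mulrC.
rewrite -uu in Q.
rewrite -/u -ler_pdivrMl// mulrC -(ler_pM2l D0).
have : 2 * D / e * u <= u ^+ 2 by rewrite expr2 ler_wpM2r// powR_ge0.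
have : 2 * E * u <= u ^+ 2.
  rewrite expr2 ler_wpM2r ?powR_ge0//; lra.
have : 2 * E <= 2 * E * u by rewrite ler_peMr//; lra.
have -> : D * (u / e) = 2 * D / e * u / 2 by field; rewrite gt_eqF.
lra.
Unshelve. all: end_near. Qed.

End StepCoefficients.

(** * Events of the data and bands *)

Section DataEvents.
Context {R : realType}.
Local Notation mu := (@lebesgue_measure R).
Local Notation I01 := (`[0 : R, 1]%classic : set R).
Local Notation integrable01 f := (mu.-integrable I01 (EFin \o f)).

Lemma limn_esup_near_le (u : (\bar R)^nat) (l e : R) :
  (limn_esup u <= l%:E)%E -> 0 < e -> \forall n \near \oo, (u n <= (l + e)%:E)%E.
Proof.
move=> ul e0; have : (limn_esup u < (l + e)%:E)%E.
  by apply: le_lt_trans ul _; rewrite lte_fin ltrDl.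
move=> /ereal_inf_lt[_ [V Voo <-]] /ltW supV.
apply: filterS Voo => n Vn; apply: le_trans supV.
by apply: ereal_sup_ubound; exists n.
Qed.

Lemma data_eventC (A : set (R -> R)) : data_event A -> data_event (C01 `\` A).
Proof. exact: sigma_algebraCD. Qed.

Lemma data_eventU (A A' : set (R -> R)) :
  data_event A -> data_event A' -> data_event (A `|` A').
Proof.
move=> dA dA'; rewrite -bigcup2E; apply: sigma_algebra_bigcup => -[|[|i]] //=.
exact: sigma_algebra0.
Qed.

Lemma band_dist (fhat : nat -> (R -> R) -> R -> R) (rad : nat -> (R -> R) -> R)
    (n : nat) (y f g : R -> R) (t : R) : I01 t ->
  band fhat rad n y f -> band fhat rad n y g -> `|f t - g t| <= 2 * rad n y.
Proof.
move=> It [_ hf] [_ hg].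
have H (h : R -> R) : (sup_norm (fun t => h t - fhat n y t)%R <= (rad n y)%:E)%E ->
    `|h t - fhat n y t| <= rad n y.
  move=> hh; rewrite -lee_fin; apply: le_trans hh.
  by apply: ereal_sup_ubound; exists t.
have -> : f t - g t = (f t - fhat n y t) - (g t - fhat n y t) by ring.
apply: le_trans (ler_normB _ _) _.
by rewrite mulr_natl mulr2n lerD// H.
Qed.

Context d (T : measurableType d) (P : probability T R) (B : R -> T -> R).
Hypothesis hB : brownian_motion P B.

Lemma law_le (f : R -> R) n A A' : integrable01 f -> data_event A -> data_event A' ->
  A `<=` A' -> (law P B f n A <= law P B f n A')%E.
Proof.
move=> fi dA dA' AA'; apply: le_measure; rewrite ?inE; try exact: (measurable_law hB).
by move=> x; exact: AA'.
Qed.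

Lemma lawU (f : R -> R) n A A' : integrable01 f -> data_event A -> data_event A' ->
  (law P B f n (A `|` A') <= law P B f n A + law P B f n A')%E.
Proof.
by move=> fi dA dA'; apply: measureU2; exact: (measurable_law hB).
Qed.

Lemma law_setC (f : R -> R) n A : integrable01 f -> data_event A ->
  (law P B f n (C01 `\` A) = 1 - law P B f n A)%E.
Proof.
move=> fi dA; rewrite /law -probability_setC; last exact: (measurable_law hB).
congr (P _); apply/seteqP; split => x /=; first by case.
by move=> nA; split => //; exact: (observation_C01 hB).
Qed.

End DataEvents.

(** * One step against a given band *)

Section Step.
Context {R : realType}.
Local Notation mu := (@lebesgue_measure R).
Local Notation I01 := (`[0 : R, 1]%classic : set R).
Context (w : wavelet_system R).
Hypothesis hw : cdv_system w.
Context (F : R -> R).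
Hypothesis cF : continuous F.
Hypothesis F_Phi : forall x, I01 x -> F x = Phi w 0 x.
Context (C : R).
Hypothesis C0 : 0 < C.
Hypothesis cpsiC : forall l k x, `|cpsi w l k x| <= C * 2 `^ (l%:R / 2).
Context (rho : nat -> nat) (M s0 smax : R).
Hypothesis rho_gt0 : forall j, (wj0 w <= j)%N -> (0 < rho j)%N.
Hypothesis rho_oo : rho j @[j --> \oo] --> \oo.
Hypothesis M0 : 0 < M.
Hypothesis s00 : 0 < s0.
Context d (T : measurableType d) (P : probability T R) (B : R -> T -> R).
Hypothesis hB : brownian_motion P B.
Context (fhat : nat -> (R -> R) -> R -> R) (rad : nat -> (R -> R) -> R).
Hypothesis mband : band_measurable fhat rad.
Context (gamma : R).
Hypothesis hgamma : 0 < gamma < 2^-1.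

Local Notation wseries := (wseries w F M).
Let miss n (f : R -> R) := C01 `&` [set y | ~ band fhat rad n y f].

Lemma admissible_le s A b : admissible w s A b -> 0 <= A -> s0 <= s ->
  admissible w s0 A b.
Proof.
move=> [_ sb bA] A0 ss; split => // l; apply: le_trans (bA l) _.
by rewrite ler_wpM2l// decay_le.
Qed.

Lemma data_event_miss n f : C01 f -> data_event (miss n f).
Proof.
move=> cf; rewrite (_ : miss n f = C01 `\` (C01 `&` [set y | band fhat rad n y f])).
  by apply: data_eventC; have [_] := mband n; exact.
apply/seteqP; split => y /= [cy nb]; split => //; first by case.
by move=> bf; apply: nb.
Qed.

(** The conclusion covers every continuation [b''] of [b'], because later steps still alter the
    levels from [J'] on. This uniformity carries the failure at sample size [n] over to the
    limit. *)
Lemma stage_step s eta eta' J b m : let del := (1 - 2 * gamma) / 10 in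
  stage w rho M s0 smax s eta J b -> 0 < eta' -> eta' < eta -> eta <= 1 ->
  (limn_esup (fun n => law P B (wseries b) n (miss n (wseries b))) <= gamma%:E)%E ->
  bounded_in_prob (law P B (wseries b)) rad (rate s) ->
  exists s' J' b' n, [/\ stage w rho M s0 smax s' eta' J' b',
    s' < s /\ (J < J')%N, forall l k, (l < J)%N -> b' l k = b l k, (m <= n)%N &
    forall b'', admissible w s0 (2 * M) b'' ->
      (forall l k, (l < J')%N -> b'' l k = b' l k) ->
      ((gamma + del)%:E < law P B (wseries b'') n (miss n (wseries b'')))%E].
Proof.
move=> del st e'0 e'e e1 cov bdd.
have /andP[ga0 ga1] := hgamma.
(* The budget: [gamma + del] for missing the current function, and [del] each for a large radius,
   the bump, and all changes from [g * L] on. The new function is then missed with probability at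
   least [1 - gamma - 4 del], which exceeds [gamma + del] because [5 del < 1 - 2 gamma]. *)
have del0 : 0 < del by rewrite /del; lra.
have [_ [_ hN0] _ _ _] := hw.
have cont s1 A1 b1 : admissible w s1 A1 b1 -> C01 (wseries b1).
  move=> ab; apply: continuous_subspaceT.
  exact: (wseries_continuous hw cF C0 cpsiC ab).
have sqi s1 A1 b1 : admissible w s1 A1 b1 -> square_integrable I01 (wseries b1).
  exact: (wseries_square_integrable hw cF C0 cpsiC M).
have int s1 A1 b1 (ab : admissible w s1 A1 b1) := square_integrable01_int (sqi _ _ _ ab).
have ab := stage_admissible s00 st.
have [[/andP[s0s ssmax] sb] b1 bM [jJ bD] bW] := st.
have M20 : 0 <= 2 * M by rewrite mulr_ge0 ?ltW.
have [c hc] := bdd _ del0.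
have hmiss := limn_esup_near_le cov del0.
have [N0 _ HN0] : \forall n \near \oo, [/\ (0 < n)%N, (m <= n)%N,
    (law P B (wseries b) n (miss n (wseries b)) <= (gamma + del)%:E)%E &
    (law P B (wseries b) n (C01 `&` [set y | c * rate s n < `|rad n y|]%R) <= del%:E)%E].
  near=> n; split; near: n; [exact: nbhs_infty_gt|exact: nbhs_infty_ge|exact: hmiss|exact: hc].
have kap1 : 1 < eta / eta' by rewrite ltr_pdivlMr// mul1r.
have [Cn Cn0 HCn] := norm1_Psi hw.
have /andP[q0 q1] := geom_lt1 s00.
(* The constant in the sup-norm distance of two functions that agree below a level, each with
   coefficient constant [2 * M]. *)
pose Tc : R := (2 * M + 2 * M) * C / (1 - 2 `^ (- s0)).
have Tc0 : 0 <= Tc.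
  by rewrite divr_ge0 ?subr_ge0 ?(ltW q1)// mulr_ge0 ?(ltW C0)// addr_ge0.
(* The first successor makes [g] exceed the quotient, so that [2^(-2 g L s0)] outweighs the sample
   size; the second ensures [1 < g]. *)
pose g := (Num.truncn ((2 * smax + 1) / (2 * s0))).+2.
have hg : 2 * smax + 1 < 2 * g%:R * s0.
  have s20 : 0 < 2 * s0 by rewrite mulr_gt0.
  have : (2 * smax + 1) / (2 * s0) < g%:R.
    by apply: lt_trans (truncnS_gt _) _; rewrite ltr_nat.
  by rewrite ltr_pdivrMr//; lra.
have [r [gr Hr]] := step_numerics c N0 s00 s0s ssmax kap1 M0 del0 Tc0 Cn0 hg.
have del20 : 0 < del ^+ 2 by rewrite exprn_gt0.
have [L0 _ HL0] : \forall j \near \oo, [/\ (r <= rho j)%N, (J <= j)%N &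
    2 `^ (j%:R / 2) <= del ^+ 2 * (bump_count w j)%:R].
  near=> j; split; near: j; [exact: (rho_oo (nbhs_infty_ge r))|exact: nbhs_infty_ge|].
  exact: bump_count_large.
have [L' [n [[LL' s0s'] N0n nL signal small]]] := Hr L0.
set L := (r * L')%N in nL signal small; set s' := _ - _ in s0s' nL signal small.
have [n0 mn missn radn] := HN0 n N0n.
have [_ JL' _] := HL0 L' LL'.
have r1 : (1 < r)%N by exact: leq_trans gr.
have L'L : (L' <= L)%N by rewrite leq_pmull// ltnW.
have [_ JL countL] := HL0 L (leq_trans LL' L'L).
have jL : (wj0 w < L)%N by exact: leq_trans JL.
have count0 : (0 < bump_count w L)%N.
  rewrite -(ltr_nat R) -(pmulr_rgt0 _ del20).
  by apply: lt_le_trans countL; rewrite powR_gt0.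
set mis := miss n (wseries b) in missn.
set big := C01 `&` _ in radn.
have dmis : data_event mis by apply: data_event_miss; exact: cont ab.
have dbig : data_event big.
  have [+ _] := mband n => /(_ [set v | c * rate s n < `|v|]); apply.
  have := @normr_measurable R setT measurableT _ (measurable_itv `]c * rate s n, +oo[).
  by rewrite setTI; congr measurable; apply/seteqP; split => v /=; rewrite in_itv/= andbT.
(* Off [A] the band contains the current function and has radius of order [rate s n]. Only [A] is
   transferred between laws. *)
pose A := mis `|` big.
have dA : data_event A := data_eventU dmis dbig.
have lawA : (law P B (wseries b) n A <= (gamma + 2 * del)%:E)%E.
  apply: le_trans (lawU hB n (int _ _ _ ab) dmis dbig) _.
  have -> : (gamma + 2 * del)%:E = ((gamma + del)%:E + del%:E)%E.
    by rewrite -EFinD; congr EFin; ring.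
  exact: leeD.
set a := M * decay s' L in nL signal.
have chi : expR (n%:R * a ^+ 2) <= del ^+ 2 * (bump_count w L)%:R.
  apply: le_trans countL; rewrite powR2_expR ler_expR (le_trans nL)//.
  by rewrite mulrAC.
have [k0 /andP[ik Nk] lawk] :=
  bump_exists hw hB (ltnW jL) n0 del0 (int _ _ _ ab) count0 chi dA.
have [st' ab1'] := next_stage hN0 rho_gt0 M0 s00 st e'0 e'e e1 s0s' (isT : 1 < g)%N gr JL'
  (fun j jl => (let: And3 h _ _ := HL0 j (leq_trans LL' jl) in h)) ik Nk.
have ab1 := admissible_le ab1' M20 (ltW s0s').
have f1E : (fun x => wseries b x + a * cpsi w L k0 x) = wseries (add_bump b L k0 a).
  apply/funext => x; symmetry.
  exact: (wseries_bump F C0 cpsiC M x (admissible_le ab M20 (ltW s0s)) ab1 (interior_lt ik)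
    (fun l k => erefl)).
rewrite f1E in lawk.
have LgL : (L < g * L)%N by rewrite ltn_Pmull// (leq_ltn_trans _ jL).
exists s', (g * L)%N, (next_coefs w M b L k0 a s' (g * L)), n; split => //.
- split; last exact: leq_ltn_trans LgL.
  rewrite /s' gtrBl divr_gt0 ?ln_gt0// mulr_gt0 ?ln2_gt0// ltr0n.
  by apply: leq_trans JL'; exact: leq_ltn_trans jJ.
- move=> l k lJ; have lL : (l < L)%N by exact: leq_trans JL.
  by rewrite /next_coefs (ltn_trans lL LgL) /add_bump (ltn_eqF lL) addr0.
move=> b2 ab2 b2E.
have b2E1 l k : (l < g * L)%N -> b2 l k = add_bump b L k0 a l k.
  by move=> lg; rewrite b2E// /next_coefs lg.
have law2 : (law P B (wseries b2) n A <= (gamma + 4 * del)%:E)%E.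
  apply: (@le_trans _ _ (law P B (wseries (add_bump b L k0 a)) n A + del%:E)%E).
    apply: (@law_small_change R d T P B hB _ _ n (Tc * (2 `^ (- s0)) ^+ (g * L))) => //.
    - exact: int ab1.
    - by apply: square_integrableB => //; [exact: sqi ab2|exact: sqi ab1].
    - move=> x _; apply: le_trans (wseries_agree F C0 cpsiC M x ab2 ab1 b2E1) _.
      by rewrite /Tc [leRHS]mulrAC.
  have -> : (gamma + 4 * del)%:E = ((gamma + 2 * del)%:E + del%:E + del%:E)%E.
    by rewrite -!EFinD; congr EFin; ring.
  by apply: leeD => //; apply: le_trans lawk _; apply: leeD.
have sub : C01 `\` A `<=` miss n (wseries b2).
  move=> y [cy /not_orP[nmis nbig]]; split => //= band2.
  have band1 : band fhat rad n y (wseries b).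
    by apply: contrapT => nb; apply: nmis.
  have rady : `|rad n y| <= c * rate s n.
    by rewrite leNgt; apply/negP => h; apply: nbig.
  have diff x : I01 x -> `|wseries b x - wseries b2 x| <= 2 * (`|c| * rate s n).
    move=> Ix; apply: le_trans (band_dist Ix band1 band2) _.
    rewrite ler_pM2l//; apply: le_trans (ler_norm _) _; apply: le_trans rady _.
    by rewrite ler_wpM2r ?powR_ge0// ler_norm.
  have kl := interior_lt ik.
  have sPsi := sqint_Psi hw (ltnW jL) kl.
  have sdiff := square_integrableB (measurable_itv _) (sqi _ _ _ ab) (sqi _ _ _ ab2).
  (* The coefficient of the difference at the bump is exactly [a] in absolute value, as level [L] is
     below [g * L]. Two functions in a band of small radius would have a difference with a smaller
     coefficient, by the L^1 bound on [Psi]; this contradicts [signal]. *)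
  have := le_inner01 sdiff sPsi diff.
  rewrite innerBl//; last 2 first.
  - exact: sqi ab.
  - exact: sqi ab2.
  rewrite -!/(beta w _ L k0).
  rewrite (wseries_beta hw cF F_Phi C0 cpsiC M ab (ltnW jL) kl).
  rewrite (wseries_beta hw cF F_Phi C0 cpsiC M ab2 (ltnW jL) kl).
  rewrite b2E1// /add_bump !eqxx/= opprD addrA subrr sub0r normrN.
  apply/negP; rewrite -ltNge.
  have a0 : 0 < a by rewrite mulr_gt0// decay_gt0.
  rewrite (ger0_norm (ltW a0)); apply: le_lt_trans signal.
  by rewrite ler_wpM2l ?mulr_ge0 ?powR_ge0// HCn// ltnW.
apply: (@lt_le_trans _ _ (law P B (wseries b2) n (C01 `\` A))); last first.
  apply: (law_le hB n (int _ _ _ ab2)) => //; first exact: data_eventC.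
  by apply: data_event_miss; exact: cont ab2.
rewrite (law_setC hB)//; last exact: int ab2.
have i2 := int _ _ _ ab2.
rewrite -(fineK (law_fin_num hB n i2 dA)) in law2 *.
move: law2; rewrite -EFinB lee_fin lte_fin /del; lra.
Unshelve. all: end_near. Qed.

End Step.

(** * The limit function *)

Section Limit.
Context {R : realType}.
Local Notation I01 := (`[0 : R, 1]%classic : set R).
Context (w : wavelet_system R).
Hypothesis hw : cdv_system w.
Context (F : R -> R).
Hypothesis cF : continuous F.
Hypothesis F_Phi : forall x, I01 x -> F x = Phi w 0 x.
Context (C : R).
Hypothesis C0 : 0 < C.
Hypothesis cpsiC : forall l k x, `|cpsi w l k x| <= C * 2 `^ (l%:R / 2).
Context (rho : nat -> nat) (M s0 smax eps : R).
Hypothesis rho_gt0 : forall j, (wj0 w <= j)%N -> (0 < rho j)%N.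
Hypothesis M0 : 0 < M.
Hypothesis s00 : 0 < s0.
Hypothesis heps : 0 < eps < 1.

Local Notation stage := (stage w rho M s0 smax).

Definition initial_coefs (s : R) (l k : nat) : R :=
  if (wj0 w < l)%N && (k == wN w) then M * decay s l else 0.

Lemma initial_stage s : s0 < s -> s < smax ->
  stage s 1 (wj0 w).+1 (initial_coefs s).
Proof.
move=> s0s ssmax; have [_ [_ hN0] _ _ _] := hw.
have Md l : 0 < M * decay s l by rewrite mulr_gt0// decay_gt0.
have E l k : (wj0 w < l)%N ->
    initial_coefs s l k = if k == wN w then M * decay s l else 0.
  by move=> jl; rewrite /initial_coefs jl.
split.
- rewrite s0s ssmax; split => // l k; rewrite /initial_coefs.
  case: ifPn => [/andP[jl /eqP->] _|_]; last by rewrite eqxx.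
  by rewrite jl interior_edge.
- move=> l; apply: (@le_trans _ _ (M * decay s l)); last first.
    by have := Md l; rewrite -mulrA; lra.
  have [jl|jl] := ltnP (wj0 w) l.
    under eq_bigr do rewrite E//.
    by rewrite -[leRHS]gtr0_norm// sum_single.
  by rewrite big1 ?(ltW (Md _))// => k _; rewrite /initial_coefs ltnNge jl normr0.
- move=> l k; rewrite /initial_coefs; case: ifP => _; last by rewrite normr0 ltW.
  by rewrite gtr0_norm.
- by split => // l k; exact: E.
move=> j jj; exists j, (wN w); split.
- by rewrite leqnn leq_pmull// rho_gt0// ltnW.
- by rewrite leq_max leqnn.
- exact/interior_lt/interior_edge.
by rewrite E// eqxx mul1r gtr0_norm.
Qed.

Lemma stage_self_similar s eta J b : stage s eta J b -> eps <= eta ->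
  weakly_self_similar w eps rho s M (wseries w F M b).
Proof.
move=> st epseta; have ab := stage_admissible s00 st.
have [_ _ bM _ bW] := st; have /andP[_ /ltW eps1] := heps.
apply: (wseries_self_similar hw cF F_Phi C0 cpsiC ab) => //; first exact: ltW.
move=> j jj z zeps; have [l [k [jl _ kl hb]]] := bW j jj.
exists l, k; split => //; apply: le_trans hb.
by rewrite ler_wpM2r ?(ltW (decay_gt0 _ _))// ler_wpM2r ?(ltW M0)// ltW// (lt_le_trans zeps).
Qed.

(** The limiting smoothness [s] is the infimum of the [s_ m]. Upper bounds on the coefficients
    survive because [decay s] dominates every [decay (s_ m)]; lower bounds survive since each window
    involves finitely many levels. *)
Lemma limit_stage (s_ eta_ : nat -> R) (J_ : nat -> nat) (b_ : nat -> nat -> nat -> R) :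
  (forall m, stage (s_ m) (eta_ m) (J_ m) (b_ m)) -> (forall m, eps <= eta_ m) ->
  (forall m, s_ m.+1 < s_ m) -> (forall m, (J_ m < J_ m.+1)%N) ->
  (forall m l k, (l < J_ m)%N -> b_ m.+1 l k = b_ m l k) ->
  exists b s, [/\ admissible w s0 (2 * M) b,
    forall m l k, (l < J_ m)%N -> b l k = b_ m l k, s0 <= s < smax &
    weakly_self_similar w eps rho s M (wseries w F M b)].
Proof.
move=> st etae sS JS bS.
have s_le m i : s_ (m + i)%N <= s_ m.
  by elim: i => [|i IH]; rewrite ?addn0// addnS (le_trans (ltW (sS _))).
have J_le m i : (J_ m <= J_ (m + i))%N.
  by elim: i => [|i IH]; rewrite ?addn0// addnS (leq_trans IH)// ltnW.
have bE m i l k : (l < J_ m)%N -> b_ (m + i)%N l k = b_ m l k.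
  move=> lJ; elim: i => [|i IH]; rewrite ?addn0// addnS bS//.
  exact: leq_trans lJ (J_le _ _).
(* The coefficients of level [l] are thus settled from stage [l] on, which justifies the diagonal
   choice of [b]. *)
have Jm m : (m < J_ m)%N.
  elim: m => [|m IH]; last exact: leq_ltn_trans IH (JS m).
  by have [_ _ _ [+ _] _] := st 0%N; exact: leq_ltn_trans.
pose b l k := b_ l l k.
have bm m l k : (l < J_ m)%N -> b l k = b_ m l k.
  move=> lJ; have [ml|/ltnW lm] := leqP m l; first by rewrite /b -(subnKC ml) bE ?subnKC.
  by rewrite /b -(subnKC lm) bE.
have s0s m : s0 < s_ m < smax by have [[]] := st m.
pose s := inf (range s_).
have hinf : has_inf (range s_).
  split; first by exists (s_ 0%N), 0%N.
  by exists s0 => _ [m _ <-]; have /andP[/ltW] := s0s m.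
have s_s m : s <= s_ m by apply: ge_inf; [exact: (proj2 hinf)|exists m].
have s0s' : s0 <= s.
  by apply: lb_le_inf; [exact: (proj1 hinf)|move=> _ [m _ <-]; have /andP[/ltW] := s0s m].
have sb : interior_supported w b by move=> l k; have [[_ +] _ _ _ _] := st l; exact.
have adm s' : 0 < s' -> s' <= s -> admissible w s' (2 * M) b.
  move=> s'0 s's; split => // l; have [_ b1 _ _ _] := st l.
  apply: le_trans (b1 l) _; rewrite ler_wpM2l ?mulr_ge0 ?(ltW M0)// decay_le//.
  exact: le_trans s's (s_s l).
exists b, s; split => //; first exact: adm.
  by rewrite s0s' (le_lt_trans (s_s 0%N))//; have /andP[] := s0s 0%N.
have /andP[eps0 /ltW eps1] := heps.
apply: (wseries_self_similar hw cF F_Phi C0 cpsiC (adm s (lt_le_trans s00 s0s') (lexx _))) => //.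
- exact: ltW.
- move=> l k; have [_ _ + _ _] := st l => /(_ l k) /le_trans; apply.
  by rewrite ler_pM2l// decay_le.
move=> j jj z zeps; pose N := (rho j * j)%N.
(* A late stage has [2^(N (s_ m - s)) <= eps / z], so passing to [s] costs no more than the slack
   between [z] and [eps]. The condition [N <= m] ensures that the whole window is settled at stage
   [m]. *)
have [m Nm small] : exists2 m, (N <= m)%N &
    forall l, (l <= N)%N -> z * decay s l <= eps * decay (s_ m) l.
  have [z0|z0] := leP z 0.
    exists N => // l _; apply: (@le_trans _ _ 0); last first.
      by rewrite mulr_ge0 ?ltW ?decay_gt0.
    by rewrite pmulr_lle0 ?decay_gt0.
  have ez : 1 < eps / z by rewrite ltr_pdivlMr// mul1r.
  have ln20 := @ln2_gt0 R.
  have Np : 0 < N.+1%:R * ln 2 :> R by rewrite mulr_gt0// ltr0n.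
  have del0 : 0 < ln (eps / z) / (N.+1%:R * ln 2) by rewrite divr_gt0// ln_gt0.
  have [_ [m0 _ <-] sm0] := inf_adherent del0 hinf.
  exists (m0 + N)%N; first exact: leq_addl.
  move=> l lN; have sm : s_ (m0 + N)%N - s <= ln (eps / z) / (N.+1%:R * ln 2).
    by rewrite lerBlDl (le_trans (s_le _ _))// ltW.
  have -> : decay s l = decay (s_ (m0 + N)%N) l * 2 `^ (l%:R * (s_ (m0 + N)%N - s)) :> R.
    rewrite /decay !powR2_expR -expRD; congr expR; ring.
  rewrite mulrCA [leRHS]mulrC ler_pM2l ?decay_gt0// mulrC -ler_pdivlMr//.
  rewrite powR2_expR -[leRHS]lnK ?posrE; last exact: lt_trans ez.
  rewrite ler_expR -mulrA mulrCA.
  apply: le_trans (_ : _ <= (s_ (m0 + N)%N - s) * (N.+1%:R * ln 2)) _.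
    rewrite ler_wpM2l ?subr_ge0// ler_pM2r// ler_nat.
    exact: leq_trans lN (leqnSn _).
  by rewrite -ler_pdivlMr.
have [_ _ _ _ bW] := st m; have [l [k [/andP[jl lN] _ kl hb]]] := bW j jj.
exists l, k; split => //; first by rewrite jl.
rewrite (bm m); last exact: leq_ltn_trans (leq_trans lN Nm) (Jm m).
apply: le_trans hb; rewrite mulrAC [leRHS]mulrAC ler_pM2r//.
apply: le_trans (small l lN) _.
by rewrite ler_wpM2r ?(ltW (decay_gt0 _ _)).
Qed.

End Limit.

Theorem theorem3p5 (R : realType) (w : wavelet_system R) (hw : cdv_system w)
    (d : measure_display) (T : measurableType d) (P : probability T R)
    (B : R -> T -> R) (hB : brownian_motion P B)
    (s_max : R) (hs_max : 0 < s_max < (wN w)%:R)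
    (eps : R) (heps : 0 < eps < 1)
    (rho : nat -> nat) (rho_gt0 : forall j, (wj0 w <= j)%N -> (0 < rho j)%N)
    (rho_oo : rho j @[j --> \oo] --> \oo)
    (gamma : R) (hgamma : 0 < gamma < 2^-1)
    (s_min : R) (hs_min : 0 < s_min < s_max)
    (M : R) (hM : 0 < M) :
  let F := \bigcup_(s in [set s : R | s_min < s < s_max])
             weakly_self_similar w eps rho s M in
  ~ exists (fhat : nat -> (R -> R) -> R -> R) (rad : nat -> (R -> R) -> R),
      [/\ band_measurable fhat rad,
          (* an element of F is represented here by its continuous version *)
          forall f, F f -> C01 f ->
            (limn_esup (fun n => law P B f n
               (C01 `&` [set y | ~ band fhat rad n y f])) <= gamma%:E)%E &
          forall (s : R) f, s_min < s < s_max -> weakly_self_similar w eps rho s M f ->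
            bounded_in_prob (law P B f) rad (rate s)].
Proof.
move=> F [fhat [rad [mband cov bdd]]].
have /andP[smin0 smin_max] := hs_min; have /andP[eps0 eps1] := heps.
have /andP[ga0 ga1] := hgamma.
have hN : (0 < wN w)%N.
  by rewrite -(ltr_nat R); case/andP: hs_max; exact: lt_trans.
have [G cG G_Phi] := scaling_edge_continuous hw hN.
have [C C0 cpsiC] := cpsi_bounded hw.
(* The limit is only known to satisfy [s0 <= s], so [s0] is taken strictly above [s_min]. *)
pose s0 := (s_min + s_max) / 2; pose s1 := (s0 + s_max) / 2.
have smin_s0 : s_min < s0 by rewrite /s0; lra.
have s0max : s0 < s_max by rewrite /s0; lra.
have s00 : 0 < s0 by exact: lt_trans smin_s0.
have s01 : s0 < s1 by rewrite /s1; lra.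
have s1max : s1 < s_max by rewrite /s1; lra.
(* Margins that start at 1 and decrease strictly while staying above [eps]: each step has a ratio
   larger than 1 to spend. *)
pose eta (m : nat) : R := eps + (1 - eps) * 2^-1 ^+ m.
have etae m : eps < eta m by rewrite ltrDl mulr_gt0 ?subr_gt0// exprn_gt0.
have etaS m : eta m.+1 < eta m.
  rewrite /eta ltrD2l ltr_pM2l ?subr_gt0// exprS gtr_pMl ?exprn_gt0//; lra.
have eta1 m : eta m <= 1.
  elim: m => [|m IH]; first by rewrite /eta expr0 mulr1 addrC subrK.
  exact: le_trans (ltW (etaS m)) IH.
pose del : R := (1 - 2 * gamma) / 10.
pose f_ := wseries w G M.
pose St (p : nat * (R * nat * (nat -> nat -> R))) :=
  stage w rho M s0 s_max p.2.1.1 (eta p.1) p.2.1.2 p.2.2.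
pose miss n (f : R -> R) := C01 `&` [set y | ~ band fhat rad n y f].
(* The implication is placed under the existential so that a choice function is total; off the
   stages its value is arbitrary. *)
have step p : exists q : (R * nat * (nat -> nat -> R)) * nat, St p ->
    [/\ St (p.1.+1, q.1), q.1.1.1 < p.2.1.1 /\ (p.2.1.2 < q.1.1.2)%N,
      forall l k, (l < p.2.1.2)%N -> q.1.2 l k = p.2.2 l k, (p.1 <= q.2)%N &
      forall b, admissible w s0 (2 * M) b ->
        (forall l k, (l < q.1.1.2)%N -> b l k = q.1.2 l k) ->
        ((gamma + del)%:E < law P B (f_ b) q.2 (miss q.2 (f_ b)))%E].
  case: p => m [[s J] b]; have [st|nst] := pselect (St (m, (s, J, b))); last first.
    by exists ((s, J, b), 0%N).
  have ss : weakly_self_similar w eps rho s M (f_ b).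
    exact: (stage_self_similar hw cG G_Phi C0 cpsiC rho_gt0 hM s00 heps st (ltW (etae m))).
  have ab := stage_admissible s00 st.
  have [[/andP[s0s ssmax] _] _ _ _ _] := st.
  have sI : s_min < s < s_max by rewrite (lt_trans smin_s0).
  have [s' [J' [b' [n [st' [h1 h2] h3 h4 h5]]]]] :=
    stage_step hw cG G_Phi C0 cpsiC rho_gt0 rho_oo hM s00 hB mband hgamma m st
      (lt_trans eps0 (etae m.+1)) (etaS m) (eta1 m)
      (cov _ (ex_intro2 _ _ s sI ss)
         (continuous_subspaceT (wseries_continuous hw cG C0 cpsiC ab)))
      (bdd s _ sI ss).
  by exists ((s', J', b'), n).
have [nxt Hnxt] := choice step.
pose x_ := fix x_ m := if m is m'.+1 then (nxt (m', x_ m')).1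
  else (s1, (wj0 w).+1, initial_coefs w M s1).
have st m : St (m, x_ m).
  elim: m => [|m IH]; last by have [] := Hnxt _ IH.
  rewrite /St /= /eta expr0 mulr1 addrC subrK.
  exact: (initial_stage hw rho_gt0 hM s01 s1max).
have H m := Hnxt _ (st m).
have [b [s [ab bE /andP[s0s ssmax] ss]]] :=
  @limit_stage R w hw G cG G_Phi C C0 cpsiC rho M s0 s_max eps rho_gt0 hM s00 heps
   (fun m => (x_ m).1.1) eta (fun m => (x_ m).1.2) (fun m => (x_ m).2)
   st (fun m => ltW (etae m)) (fun m => (let: And5 _ h _ _ _ := H m in proj1 h))
   (fun m => (let: And5 _ h _ _ _ := H m in proj2 h))
   (fun m => (let: And5 _ _ h _ _ := H m in h)).
have sI : s_min < s < s_max by rewrite (lt_le_trans smin_s0).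
have cf : C01 (f_ b).
  exact: (continuous_subspaceT (wseries_continuous hw cG C0 cpsiC ab)).
have del0 : 0 < del by rewrite /del; lra.
(* Coverage of the limit function bounds its miss probability by [gamma + del] from [N] on, whereas
   step [N] supplied a sample size at least [N] where this fails. *)
have [N _ HN] := limn_esup_near_le (cov _ (ex_intro2 _ _ s sI ss) cf) del0.
have [_ _ _ Nn /(_ b ab (bE N.+1))] := H N.
by apply/negP; rewrite -leNgt; exact: HN.
Qed.
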